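(* For any positive integers $t,m$ with $m(t-1)\leq 24$, there exists some positive integer $n_0$ such that when $n\geq n_0$, $$c_t^{(m)}(tn+r)>0\quad\text{for } r\in P_t^{(m)},\qquad c_t^{(m)}(tn+r)<0\quad\text{for } r\in N_t^{(m)}.$$
   Context: For positive integers $t,m$, the integers $c_t^{(m)}(n)$ are defined by $\sum_{n\ge 0}c_t^{(m)}(n)q^n=\frac{(q;q)_\infty^m}{(q^t;q^t)_\infty^m}$, where $(a;q)_\infty=\prod_{n=0}^\infty(1-aq^n)$, $|q|<1$. For a positive integer $k$ and an integer $h$ with $\gcd(h,k)=1$, the Dedekind sum is $s(h,k)=\sum_{r=1}^{k-1}\frac{r}{k}\left(\frac{hr}{k}-\left\lfloor\frac{hr}{k}\right\rfloor-\frac12\right)$, with $s(h,1)=0$. Define $$\alpha_t^{(m)}(n)=\sum_{0\le h<t,\ \gcd(h,t)=1}\exp\left(-m\pi i\, s(h,t)-\frac{2\pi i n h}{t}\right),$$ which is real and depends only on $n$ modulo $t$. Define $$P_t^{(m)}=\{r: 0\le r<t,\ \alpha_t^{(m)}(r)>0\},\qquad N_t^{(m)}=\{r: 0\le r<t,\ \alpha_t^{(m)}(r)<0\}.$$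
   Formalization: The case t = 1 is excluded (t ≥ 2 is assumed): for t = 1 the quotient is 1, so c_1^{(m)}(n) = 0 for all n ≥ 1, although α_1^{(m)}(0) = 1 > 0 puts 0 in P_1^{(m)}, so the claim is false there for every m. *)

(* Defs.v *)
From mathcomp Require Import all_boot all_order all_algebra.
From mathcomp Require Import all_classical all_reals all_analysis.
From mathcomp Require Import complex.

Set Implicit Arguments.
Unset Strict Implicit.
Unset Printing Implicit Defensive.

Import Order.TTheory GRing.Theory Num.Theory.
Import numFieldNormedType.Exports.

Local Open Scope classical_set_scope.
Local Open Scope ring_scope.
Local Open Scope complex_scope.

Section Defs.
Variable R : realType.

(* The topology on the complex numbers is carried by the alias R[i]^o. *)
Definition qpoch (a q : R[i]) : R[i] :=
  limn (fun N : nat => \prod_(0 <= n < N) (1 - a * q ^+ n) : R[i]^o).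

(* The generating function determines c, by uniqueness of power series
   expansions. *)
Definition is_coef_seq (t m : nat) (c : nat -> int) : Prop :=
  forall q : R[i], `|q| < 1 ->
    series (fun n : nat => (c n)%:~R * q ^+ n : R[i]^o) @ \oo -->
      (qpoch q q ^+ m / qpoch (q ^+ t) (q ^+ t) ^+ m : R[i]^o).

Definition dedekind_sum (h : int) (k : nat) : R :=
  \sum_(1 <= r < k)
    r%:R / k%:R * (h%:~R * r%:R / k%:R
                   - (Num.floor (h%:~R * r%:R / k%:R : R))%:~R - 1 / 2).

Definition cexp (z : R[i]) : R[i] :=
  (expR (complex.Re z))%:C * (cos (complex.Im z) +i* sin (complex.Im z)).

Definition alpha (t m n : nat) : R[i] :=
  \sum_(0 <= h < t | coprime h t)
    cexp (- (m%:R * pi%:C * 'i * (dedekind_sum h%:Z t)%:C)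
          - (2 * pi%:C * 'i * n%:R * h%:R) / t%:R).

(* In the order of R[i], 0 < z means that z is real and positive, and z < 0
   that z is real and negative. *)
Definition Pset (t m : nat) : set nat :=
  [set r | (r < t)%N /\ 0 < alpha t m r].

Definition Nset (t m : nat) : set nat :=
  [set r | (r < t)%N /\ alpha t m r < 0].

End Defs.

(* Main.v *)
Require Import Defs.
From mathcomp Require Import all_boot all_order all_algebra.
From mathcomp Require Import all_classical all_reals all_analysis.
From mathcomp Require Import complex ring lra zify.

(** The coefficients are analysed by the circle method, with the generating
    function F(q) = (q;q)^m / (q^t;q^t)^m replaced by the exponential of an
    explicit series. Expanding the logarithm of every factor and summing over the
    factors first gives (quotient_exp)

      F(q) = exp (m L(q)),  L(q) = sum over k >= 1 of (lam(q^(tk)) - lam(q^k)) / k,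

    where lam(q) = q / (1 - q). Every point of the circle |q| = e^(-x) has the form
    e^(2 pi i h / t - z) with z = x - i phi and |phi| <= pi / t.

    If h is prime to t and |phi| <= 16 x, write lam(q^(tk)) - lam(q^k) as minus the
    sum over 0 < s < t of xi^k e^(-s w) / (1 - e^(-t w)), with w = k z and
    xi = e^(2 pi i h s / t), and expand the quotient as
    1 / (t w) + (1/2 - s/t) e^(-w) + remainder. The pole sums to A / z with
    A = zeta(2) (1 - 1/t) / t; the middle term sums to logarithms of 1 - xi e^(-z),
    whose limits at z = 0 combine into - pi i s(h,t) (log_constant); the remainder
    sums to o(1) by summation by parts, as xi <> 1 (rem_series_small). Hence
    F(q) = (omega_h + o(1)) exp (m A / z), where omega_h = e^(- m pi i s(h,t)) is the
    coefficient in alpha (major_arc).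

    At all other points a single term of L(q) falls short of the bound that leads
    to A / x by a fixed multiple of 1 / x (minor_far, minor_noncoprime), so that F(q)
    is exponentially smaller than e^(m A / x).

    The coefficient c(n) is the limit of averages of F(q) q^(-n) over the vertices
    of regular polygons on the circle (coef_average). With tM vertices, the points
    with the same phi form a column of t points, one for each h, and for n = r
    modulo t the column is alpha(r) exp (B/z + n z) up to errors, B = m A, because the
    omega_h e^(-2 pi i r h / t) add up to alpha(r) (column_estimate). Taking n x^2 = B
    makes z = x the saddle point. The weight exp (B/z + n z) has positive real part
    until its phase reaches 1, and by then its modulus is below e^(2B/x) by more than
    any power of x (weight_inner, weight_outer). So alpha(r) c(n) e^(-2B/x) is at least
    the contribution of the center |phi| <= x^2 / B, which is of order x^2, minus
    errors of order x^3 (coef_sign). For n large the sign of c(n) is that of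
    alpha(r), and finitely many residues r share a common threshold. *)

Set Implicit Arguments.
Unset Strict Implicit.
Unset Printing Implicit Defensive.

Import Order.TTheory GRing.Theory Num.Theory.
Import numFieldNormedType.Exports.

Local Open Scope classical_set_scope.
Local Open Scope ring_scope.

(** * Real modulus and exponential of complex numbers *)

Section ComplexBasics.
Variable R : realType.
Local Open Scope complex_scope.
Implicit Types (z w v : R[i]) (x y : R).

(** The modulus as a real number: with it every estimate below is an inequality
    in R, within reach of the linear and nonlinear arithmetic tactics. *)
Definition nc z : R := ComplexField.Normc.normc z.

Lemma nc_sqrE z : nc z = Num.sqrt (complex.Re z ^+ 2 + complex.Im z ^+ 2).
Proof. by case: z. Qed.

Lemma normE z : `|z| = (nc z)%:C.
Proof. by case: z. Qed.

Lemma nc_ge0 z : 0 <= nc z.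
Proof. by rewrite nc_sqrE sqrtr_ge0. Qed.

Lemma nc_sqr z : nc z ^+ 2 = complex.Re z ^+ 2 + complex.Im z ^+ 2.
Proof. by rewrite nc_sqrE sqr_sqrtr // addr_ge0 ?sqr_ge0. Qed.

Lemma ncM z w : nc (z * w) = nc z * nc w.
Proof. exact: ComplexField.Normc.normcM. Qed.

Lemma ncV z : nc z^-1 = (nc z)^-1.
Proof. exact: ComplexField.Normc.normcV. Qed.

Lemma nc0 : nc 0 = 0 :> R.
Proof. exact: ComplexField.Normc.normc0. Qed.

Lemma nc1 : nc 1 = 1 :> R.
Proof. exact: ComplexField.Normc.normc1. Qed.

Lemma nc_eq0 z : (nc z == 0) = (z == 0).
Proof.
by apply/eqP/eqP => [|->]; [exact: ComplexField.Normc.eq0_normc|exact: nc0].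
Qed.

Lemma nc_gt0 z : (0 < nc z) = (z != 0).
Proof. by rewrite lt0r nc_ge0 nc_eq0 andbT. Qed.

Lemma ncN z : nc (- z) = nc z.
Proof. exact: normcN. Qed.

Lemma ncD z w : nc (z + w) <= nc z + nc w.
Proof. exact: le_normcD. Qed.

Lemma ncBC z w : nc (z - w) = nc (w - z).
Proof. by rewrite -ncN opprB. Qed.

Lemma ncB z w : nc (z - w) <= nc z + nc w.
Proof. by rewrite -(ncN w) ncD. Qed.

Lemma ncBr z w : nc z - nc w <= nc (z - w).
Proof. by have := ncD (z - w) w; rewrite subrK; lra. Qed.

Lemma ncX z n : nc (z ^+ n) = nc z ^+ n.
Proof. by elim: n => [|n IH]; rewrite ?expr0 ?nc1 // !exprS ncM IH. Qed.

Lemma ncR x : nc x%:C = `|x|.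
Proof. by rewrite nc_sqrE /= expr0n addr0 sqrtr_sqr. Qed.

Lemma nc_nat n : nc n%:R = n%:R :> R.
Proof. by rewrite -(rmorph_nat (real_complex R)) ncR ger0_norm. Qed.

Lemma nc_sum I (r : seq I) (P : pred I) (F : I -> R[i]) :
  nc (\sum_(i <- r | P i) F i) <= \sum_(i <- r | P i) nc (F i).
Proof.
elim/big_ind2: _ => [|x1 x2 y1 y2 h1 h2|//]; first by rewrite nc0.
by apply: le_trans (ncD _ _) _; exact: lerD.
Qed.

Lemma ReD z w : complex.Re (z + w) = complex.Re z + complex.Re w.
Proof. by case: z; case: w. Qed.
Lemma ImD z w : complex.Im (z + w) = complex.Im z + complex.Im w.
Proof. by case: z; case: w. Qed.
Lemma ReN z : complex.Re (- z) = - complex.Re z.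
Proof. by case: z. Qed.
Lemma ImN z : complex.Im (- z) = - complex.Im z.
Proof. by case: z. Qed.
Lemma ReM z w : complex.Re (z * w) =
  complex.Re z * complex.Re w - complex.Im z * complex.Im w.
Proof. by case: z; case: w. Qed.
Lemma ImM z w : complex.Im (z * w) =
  complex.Re z * complex.Im w + complex.Im z * complex.Re w.
Proof. by case: z; case: w. Qed.
Lemma ReV z : complex.Re z^-1 = complex.Re z / nc z ^+ 2.
Proof. by rewrite nc_sqr; case: z. Qed.
Lemma ImV z : complex.Im z^-1 = - complex.Im z / nc z ^+ 2.
Proof. by rewrite nc_sqr; case: z => a b /=; rewrite mulNr. Qed.
Lemma Re_nat n : complex.Re (n%:R : R[i]) = n%:R.
Proof. by rewrite -(rmorph_nat (real_complex R)). Qed.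
Lemma Im_nat n : complex.Im (n%:R : R[i]) = 0.
Proof. by rewrite -(rmorph_nat (real_complex R)). Qed.
Lemma Re_natM n z : complex.Re (n%:R * z) = n%:R * complex.Re z.
Proof. by rewrite ReM Re_nat Im_nat; ring. Qed.
Lemma Im_natM n z : complex.Im (n%:R * z) = n%:R * complex.Im z.
Proof. by rewrite ImM Re_nat Im_nat; ring. Qed.
Lemma Re_sum I (r : seq I) (P : pred I) (F : I -> R[i]) :
  complex.Re (\sum_(i <- r | P i) F i) = \sum_(i <- r | P i) complex.Re (F i).
Proof. by elim/big_rec2: _ => [//|i x y _ <-]; rewrite ReD. Qed.
Lemma Im_sum I (r : seq I) (P : pred I) (F : I -> R[i]) :
  complex.Im (\sum_(i <- r | P i) F i) = \sum_(i <- r | P i) complex.Im (F i).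
Proof. by elim/big_rec2: _ => [//|i x y _ <-]; rewrite ImD. Qed.

Lemma eqC z w : complex.Re z = complex.Re w -> complex.Im z = complex.Im w ->
  z = w.
Proof. by case: z; case: w => ? ? ? ? /= -> ->. Qed.

Lemma normRe_le z : `|complex.Re z| <= nc z.
Proof.
rewrite -(@ler_pXn2r _ 2) ?nnegrE ?nc_ge0 // nc_sqr real_normK ?num_real //.
by rewrite lerDl sqr_ge0.
Qed.
Lemma normIm_le z : `|complex.Im z| <= nc z.
Proof.
rewrite -(@ler_pXn2r _ 2) ?nnegrE ?nc_ge0 // nc_sqr real_normK ?num_real //.
by rewrite lerDr sqr_ge0.
Qed.
Lemma Re_le z : complex.Re z <= nc z.
Proof. exact: le_trans (ler_norm _) (normRe_le _). Qed.
Lemma nc_le z : nc z <= `|complex.Re z| + `|complex.Im z|.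
Proof.
rewrite -(@ler_pXn2r _ 2) ?nnegrE ?nc_ge0 ?addr_ge0 // nc_sqr.
rewrite sqrrD !real_normK ?num_real //.
by have := mulr_ge0 (normr_ge0 (complex.Re z)) (normr_ge0 (complex.Im z)); lra.
Qed.

Lemma cexpD z w : cexp (z + w) = cexp z * cexp w.
Proof.
apply: eqC; rewrite !(ReM, ImM, ReD, ImD) /= ?expRD ?cosD ?sinD; ring.
Qed.
Lemma cexp0 : cexp 0 = 1 :> R[i].
Proof. by apply: eqC; rewrite !(ReM, ImM) /= expR0 cos0 sin0; ring. Qed.
Lemma Re_cexp z : complex.Re (cexp z) = expR (complex.Re z) * cos (complex.Im z).
Proof. by rewrite ReM /=; ring. Qed.
Lemma Im_cexp z : complex.Im (cexp z) = expR (complex.Re z) * sin (complex.Im z).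
Proof. by rewrite ImM /=; ring. Qed.
Lemma nc_cexp z : nc (cexp z) = expR (complex.Re z).
Proof.
apply/eqP; rewrite -(@eqrXn2 _ 2) ?nc_ge0 ?expR_ge0 // nc_sqr Re_cexp Im_cexp.
by rewrite !exprMn -mulrDr cos2Dsin2 mulr1.
Qed.
Lemma cexp_neq0 z : cexp z != 0.
Proof. by rewrite -nc_gt0 nc_cexp expR_gt0. Qed.
Lemma cexpN z : cexp (- z) = (cexp z)^-1.
Proof.
by apply: (mulfI (cexp_neq0 z)); rewrite divff ?cexp_neq0 // -cexpD subrr cexp0.
Qed.
Lemma cexp_natM n z : cexp (n%:R * z) = cexp z ^+ n.
Proof.
elim: n => [|n IH]; first by rewrite mul0r cexp0 expr0.
by rewrite exprS -IH -cexpD; congr cexp; rewrite -natr1; ring.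
Qed.
Lemma cexp_sum I (r : seq I) (P : pred I) (F : I -> R[i]) :
  cexp (\sum_(i <- r | P i) F i) = \prod_(i <- r | P i) cexp (F i).
Proof.
elim/big_rec2: _ => [|i x y _ <-]; first by rewrite cexp0.
by rewrite cexpD.
Qed.
Lemma cexp_real x : cexp x%:C = (expR x)%:C.
Proof. by apply: eqC; rewrite ?Re_cexp ?Im_cexp /= ?cos0 ?sin0; ring. Qed.

End ComplexBasics.

(** * Taylor bounds for real functions *)

Section RealTools.
Variable R : realType.
Implicit Types (f df : R -> R).

Lemma mvt_bound f df (a b M : R) : a <= b ->
  (forall x : R, a <= x <= b -> is_derive x 1 f (df x)) ->
  (forall x, a <= x <= b -> `|df x| <= M) ->
  `|f b - f a| <= M * (b - a).
Proof.
move=> ab fd fM.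
have [c cab ->] : exists2 c, c \in `[a, b]%R & f b - f a = df c * (b - a).
  apply: MVT_segment => //.
    by move=> x; rewrite in_itv /= => /andP[/ltW ax /ltW xb]; apply: fd; rewrite ax.
  apply: derivable_within_continuous => x; rewrite in_itv /= => xab.
  by have := fd _ xab => -[].
rewrite in_itv /= in cab.
by rewrite normrM (ger0_norm (_ : 0 <= b - a)) ?subr_ge0 // ler_wpM2r ?subr_ge0 ?fM.
Qed.

(** Integrating a bound on the derivative raises the exponent by one: the Taylor
    bounds for sin, cos and exp follow from one another through this lemma. *)
Lemma mvt_pow f df (r C : R) (n : nat) : 0 <= C ->
  (forall x : R, `|x| <= r -> is_derive x 1 f (df x)) ->
  (forall x : R, `|x| <= r -> `|df x| <= C * `|x| ^+ n) -> f 0 = 0 ->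
  forall x : R, `|x| <= r -> `|f x| <= C * `|x| ^+ n.+1.
Proof.
move=> C0 fd fM f0 x xr.
have key (a b y : R) : a <= b -> (forall z : R, a <= z <= b -> `|z| <= `|y|) -> `|y| <= r ->
    `|f b - f a| <= C * `|y| ^+ n * (b - a).
  move=> ab zy yr; apply: (@mvt_bound _ df) => // z /zy zley.
    by apply: fd; exact: le_trans yr.
  apply: le_trans (fM _ (le_trans zley yr)) _.
  by rewrite ler_wpM2l // lerXn2r ?nnegrE.
have [x0|x0] := leP 0 x.
  have := @key 0 x x x0; rewrite f0 !subr0 exprSr mulrA {5}ger0_norm //; apply => //.
  by move=> z /andP[z0 zx]; rewrite !ger0_norm //; lra.
have := @key x 0 x (ltW x0); rewrite f0 sub0r normrN exprSr mulrA sub0r.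
move=> h; apply: le_trans (h _ xr) _; last by rewrite (ltr0_norm x0).
by move=> z /andP[z0 zx]; rewrite !ler0_norm //; lra.
Qed.

Lemma abs_sin_le (x : R) : `|sin x| <= `|x|.
Proof.
have d (y : R) : `|y| <= `|x| -> is_derive y 1 sin (cos y).
  by move=> _; exact: is_derive_sin.
have b (y : R) : `|y| <= `|x| -> `|cos y| <= 1 * `|y| ^+ 0.
  by rewrite expr0 mulr1 cos_max.
have := mvt_pow ler01 d b (sin0 _) (lexx _).
by rewrite mul1r expr1.
Qed.

Lemma abs_cosB1_le (x : R) : `|cos x - 1| <= x ^+ 2.
Proof.
have d (y : R) : `|y| <= `|x| -> is_derive y 1 (fun x => cos x - 1) (- sin y).
  by move=> _; apply: is_derive_eq; rewrite subr0.
have b (y : R) : `|y| <= `|x| -> `|- sin y| <= 1 * `|y| ^+ 1.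
  by rewrite normrN mul1r expr1 abs_sin_le.
have := mvt_pow ler01 d b _ (lexx _).
by rewrite mul1r real_normK ?num_real // cos0 subrr; apply.
Qed.

Lemma abs_sinBx_le (x : R) : `|sin x - x| <= `|x| ^+ 3.
Proof.
have d (y : R) : `|y| <= `|x| -> is_derive y 1 (fun x => sin x - x) (cos y - 1).
  by move=> _; apply: is_derive_eq.
have b (y : R) : `|y| <= `|x| -> `|cos y - 1| <= 1 * `|y| ^+ 2.
  by rewrite mul1r real_normK ?num_real // abs_cosB1_le.
have := mvt_pow ler01 d b _ (lexx _).
by rewrite mul1r sin0 subrr; apply.
Qed.

Lemma abs_cosB2_le (x : R) : `|x| <= 1 -> `|cos x - (1 - x ^+ 2 / 2)| <= `|x| ^+ 3.
Proof.
move=> x1.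
have d (y : R) : `|y| <= 1 -> is_derive y 1 (fun x => cos x - (1 - x ^+ 2 / 2)) (- (sin y - y)).
  by move=> _; apply: is_derive_eq; rewrite /GRing.scale /=; field.
have b (y : R) : `|y| <= 1 -> `|- (sin y - y)| <= 1 * `|y| ^+ 3.
  by rewrite normrN mul1r abs_sinBx_le.
have := mvt_pow ler01 d b _ x1.
rewrite mul1r cos0 => h; apply: le_trans (h _) _; first by ring.
by rewrite exprS ler_piMl // exprn_ge0.
Qed.

Lemma expR1_le4 : expR (1 : R) <= 4.
Proof.
have h : expR (1/2 : R) <= 2.
  have := expR_ge1Dx (- (1/2) : R); rewrite expRN => h.
  have e0 := expR_gt0 (1/2 : R).
  have : (2:R)^-1 <= (expR (1 / 2))^-1 by apply: le_trans h; lra.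
  by rewrite lef_pV2 ?posrE.
have -> : 1 = 1/2 + 1/2 :> R by field.
by rewrite expRD; have := expR_ge0 (1/2 : R); nra.
Qed.

Lemma expR_le4 (x : R) : `|x| <= 1 -> `|expR x| <= 4.
Proof.
move=> x1; rewrite ger0_norm ?expR_ge0 //.
apply: le_trans expR1_le4; rewrite ler_expR.
by apply: le_trans x1; exact: ler_norm.
Qed.

Lemma abs_expRB1_le (x : R) : `|x| <= 1 -> `|expR x - 1| <= 4 * `|x|.
Proof.
move=> x1.
have d (y : R) : `|y| <= 1 -> is_derive y 1 (fun x => expR x - 1) (expR y).
  by move=> _; apply: is_derive_eq; rewrite subr0.
have b (y : R) : `|y| <= 1 -> `|expR y| <= 4 * `|y| ^+ 0.
  by move=> y1; rewrite expr0 mulr1 expR_le4.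
have := mvt_pow (ler0n _ 4) d b _ x1.
by rewrite expr1 expR0 subrr; apply.
Qed.

Lemma abs_expRB2_le (x : R) : `|x| <= 1 -> `|expR x - (1 + x)| <= 4 * `|x| ^+ 2.
Proof.
move=> x1.
have d (y : R) : `|y| <= 1 -> is_derive y 1 (fun x => expR x - (1 + x)) (expR y - 1).
  by move=> _; apply: is_derive_eq; ring.
have b (y : R) : `|y| <= 1 -> `|expR y - 1| <= 4 * `|y| ^+ 1.
  by move=> y1; rewrite expr1 abs_expRB1_le.
have := mvt_pow (ler0n _ 4) d b _ x1.
by rewrite expR0 addr0 subrr; apply.
Qed.

Lemma abs_expRB3_le (x : R) : `|x| <= 1 ->
  `|expR x - (1 + x + x ^+ 2 / 2)| <= 4 * `|x| ^+ 3.
Proof.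
move=> x1.
have d (y : R) : `|y| <= 1 ->
    is_derive y 1 (fun x => expR x - (1 + x + x ^+ 2 / 2)) (expR y - (1 + y)).
  by move=> _; apply: is_derive_eq; rewrite /GRing.scale /=; field.
have b (y : R) : `|y| <= 1 -> `|expR y - (1 + y)| <= 4 * `|y| ^+ 2.
  by move=> y1; rewrite abs_expRB2_le.
have h := mvt_pow (ler0n _ 4) d b _ x1; apply: h.
by rewrite expR0; ring.
Qed.

(** The constant is far from the optimal 2/pi; it is what sin y >= y - y^3 gives
    up to 1/2, extended by monotonicity. *)
Lemma sin_ge (y : R) : 0 <= y <= pi / 2 -> 3 / 16 * y <= sin y.
Proof.
move=> /andP[y0 yp].
have pi2 := pihalf_lt2 R.
have small (z : R) : 0 <= z <= 1 / 2 -> 3 / 4 * z <= sin z.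
  move=> /andP[z0 z1].
  have := abs_sinBx_le z; rewrite ler_norml (ger0_norm z0) => /andP[h _].
  have : z ^+ 3 <= 1/4 * z.
    by rewrite exprSr ler_wpM2r // expr2; nra.
  lra.
have [y1|y1] := leP y (1/2).
  have := small y; rewrite y0 y1 => /(_ isT); lra.
have : sin (1/2) <= sin y :> R.
  have [->//|ne] := eqVneq y (1/2).
  apply/ltW; rewrite ltr_sin ?in_itv /= //.
    by apply/andP; split; lra.
  by apply/andP; split; lra.
by have := small (1/2); rewrite lexx => /(_ _); lra.
Qed.

Lemma cosB1_ge (y : R) : `|y| <= pi -> 9 / 512 * y ^+ 2 <= 1 - cos y.
Proof.
move=> yp.
have -> : 1 - cos y = 2 * sin (`|y| / 2) ^+ 2.
  rewrite -cos_norm.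
  have {1}-> : `|y| = (`|y| / 2) *+ 2 by rewrite mulr2n; field.
  by rewrite cos_mulr2n sin2cos2; ring.
have := @sin_ge (`|y| / 2); rewrite -(real_normK (num_real y)).
have y0 := normr_ge0 y.
move=> h; have {h} : 3 / 16 * (`|y| / 2) <= sin (`|y| / 2) by apply: h; lra.
set s := sin _; nra.
Qed.

End RealTools.

(** * Taylor bounds for the complex exponential *)

Section ComplexTaylor.
Variable R : realType.
Local Open Scope complex_scope.

(** Products of the real expansions of exp, cos and sin in the real and imaginary
    parts of v. Order three is needed because the Laurent expansion studied
    later divides twice by its argument and still has to vanish at 0. *)
Lemma nc_cexp_taylor (v : R[i]) : nc v <= 1 ->
  nc (cexp v - (1 + v + v ^+ 2 / 2)) <= 30 * nc v ^+ 3.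
Proof.
move=> v1; set a := complex.Re v; set b := complex.Im v.
have ha : `|a| <= nc v := normRe_le v.
have hb : `|b| <= nc v := normIm_le v.
have a1 := le_trans ha v1; have b1 := le_trans hb v1.
set n := nc v in v1 ha hb *.
have n0 : 0 <= n by exact: nc_ge0.
have a3 : `|a| ^+ 3 <= n ^+ 3 by rewrite lerXn2r ?nnegrE.
have b3 : `|b| ^+ 3 <= n ^+ 3 by rewrite lerXn2r ?nnegrE.
have a2 : `|a| ^+ 2 <= n ^+ 2 by rewrite lerXn2r ?nnegrE.
have b2 : `|b| ^+ 2 <= n ^+ 2 by rewrite lerXn2r ?nnegrE.
apply: le_trans (nc_le _) _.
have v2 : v ^+ 2 / 2 = (((a ^+ 2 - b ^+ 2) / 2) +i* (a * b)).
  have -> : v = a +i* b by apply: eqC.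
  have -> : 2^-1 = (2^-1 : R)%:C by rewrite rmorphV ?unitfE ?pnatr_eq0 // rmorph_nat.
  by rewrite expr2; apply: eqC; rewrite !(ReM, ImM) /=; field.
rewrite v2 !(ReD, ImD, ReN, ImN) Re_cexp Im_cexp /= -/a -/b.
have -> : expR a * cos b - (1 + a + (a ^+ 2 - b ^+ 2) / 2) =
  (expR a - (1 + a + a ^+ 2 / 2)) * cos b
  + (1 + a + a ^+ 2 / 2) * (cos b - (1 - b ^+ 2 / 2))
  - (1 + a / 2) * (a * b ^+ 2 / 2) by field.
have -> : expR a * sin b - (0 + b + a * b) =
  (expR a - (1 + a)) * sin b + (1 + a) * (sin b - b) by ring.
have cb := cos_max b.
have E3 := abs_expRB3_le a1; have E2 := abs_expRB2_le a1.
have C2 := abs_cosB2_le b1; have S1 := abs_sin_le b; have S3 := abs_sinBx_le b.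
have t1 : `|(expR a - (1 + a + a ^+ 2 / 2)) * cos b| <= 4 * n ^+ 3.
  rewrite normrM -[leRHS]mulr1; apply: ler_pM => //.
  by apply: le_trans E3 _; rewrite ler_pM2l.
have aa : `|1 + a + a ^+ 2 / 2| <= 3.
  by move: a1; rewrite !ler_norml => /andP[? ?]; apply/andP; split; nra.
have t2 : `|(1 + a + a ^+ 2 / 2) * (cos b - (1 - b ^+ 2 / 2))| <= 3 * n ^+ 3.
  by rewrite normrM; apply: ler_pM => //; exact: le_trans C2 _.
have ab2 : `|a * b ^+ 2| <= n ^+ 3.
  by rewrite normrM normrX exprS; apply: ler_pM => //; rewrite exprn_ge0.
have aa2 : `|1 + a / 2| <= 2.
  by move: a1; rewrite !ler_norml => /andP[? ?]; apply/andP; split; nra.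
have t3 : `|(1 + a / 2) * (a * b ^+ 2 / 2)| <= 2 * n ^+ 3.
  rewrite normrM; apply: ler_pM => //.
  by rewrite normrM (ger0_norm (_ : 0 <= 2^-1)) ?invr_ge0 //; have := normr_ge0 (a * b ^+ 2); lra.
have t4 : `|(expR a - (1 + a)) * sin b| <= 4 * n ^+ 3.
  rewrite normrM (exprSr n) mulrA; apply: ler_pM => //; last exact: le_trans S1 hb.
  by apply: le_trans E2 _; rewrite ler_pM2l.
have aa3 : `|1 + a| <= 2.
  by move: a1; rewrite !ler_norml => /andP[? ?]; apply/andP; split; nra.
have t5 : `|(1 + a) * (sin b - b)| <= 2 * n ^+ 3.
  by rewrite normrM; apply: ler_pM => //; exact: le_trans S3 _.
have n3 : 0 <= n ^+ 3 by exact: exprn_ge0.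
have := ler_normD ((expR a - (1 + a)) * sin b) ((1 + a) * (sin b - b)).
have := ler_normB ((expR a - (1 + a + a ^+ 2 / 2)) * cos b
  + (1 + a + a ^+ 2 / 2) * (cos b - (1 - b ^+ 2 / 2))) ((1 + a / 2) * (a * b ^+ 2 / 2)).
have := ler_normD ((expR a - (1 + a + a ^+ 2 / 2)) * cos b)
  ((1 + a + a ^+ 2 / 2) * (cos b - (1 - b ^+ 2 / 2))).
lra.
Qed.

Lemma nc_cexpB1 (v : R[i]) : nc v <= 1 / 10 -> nc (cexp v - 1) <= 2 * nc v.
Proof.
move=> v1; have n0 := nc_ge0 v.
have T : nc (cexp v - (1 + v + v ^+ 2 / 2)) <= 30 * nc v ^+ 3.
  by apply: nc_cexp_taylor; lra.
have := ncD (cexp v - (1 + v + v ^+ 2 / 2)) (v + v ^+ 2 / 2).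
rewrite (_ : _ + (v + _) = cexp v - 1); last by ring.
have := ncD v (v ^+ 2 / 2); rewrite ncM ncX ncV nc_nat.
set n := nc v in v1 n0 T *; nra.
Qed.

Lemma nc_cexpB2 (v : R[i]) : nc v <= 1 / 10 -> nc (cexp v - 1 - v) <= 4 * nc v ^+ 2.
Proof.
move=> v1; have n0 := nc_ge0 v.
have T : nc (cexp v - (1 + v + v ^+ 2 / 2)) <= 30 * nc v ^+ 3.
  by apply: nc_cexp_taylor; lra.
have := ncD (cexp v - (1 + v + v ^+ 2 / 2)) (v ^+ 2 / 2).
rewrite (_ : _ + (_ / 2) = cexp v - 1 - v); last by ring.
rewrite ncM ncX ncV nc_nat.
set n := nc v in v1 n0 T *; nra.
Qed.

End ComplexTaylor.

(** * Limits and sums of complex sequences *)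

Section ComplexLimits.
Variable R : realType.
Local Open Scope complex_scope.
Implicit Types (u v : nat -> R[i]) (l z w : R[i]) (e B : R).

(** Convergence in terms of the real modulus; climP identifies it with
    convergence in the topology of the complex numbers. *)
Definition clim u l := forall e, 0 < e ->
  exists n0, forall n, (n0 <= n)%N -> nc (u n - l) <= e.

Definition csums u l := clim (fun n => \sum_(0 <= k < n) u k) l.

Lemma climP u l : clim u l <-> (u : nat -> R[i]^o) @ \oo --> (l : R[i]^o).
Proof.
split=> [h|/cvgrPdist_le h].
  apply/cvgrPdist_le => e e0.
  have := e0; rewrite ltcE => /andP[/eqP ei er]; have [n0 hn] := h (complex.Re e) er.
  near=> n; rewrite normE lecE /= ei eqxx /= ncBC; apply: hn.
  by near: n; exact: nbhs_infty_ge.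
move=> e e0; have ec : 0 < e%:C :> R[i] by rewrite ltcR.
have [n0 _ hn] := h _ ec; exists n0 => n n0n.
by have := hn n n0n; rewrite normE lecR ncBC.
Unshelve. all: by end_near.
Qed.

Lemma eq_clim u v l : u =1 v -> clim u l -> clim v l.
Proof. by move=> /funext ->. Qed.

Lemma clim_unique u l l' : clim u l -> clim u l' -> l = l'.
Proof.
move=> h h'; apply/eqP; rewrite -subr_eq0 -nc_eq0; apply/eqP/le_anti.
rewrite nc_ge0 andbT; apply/ler_addgt0Pr => e e0; rewrite add0r.
have e2 : 0 < e / 2 by rewrite divr_gt0.
have [n1 h1] := h _ e2; have [n2 h2] := h' _ e2.
have := h1 _ (leq_maxl n1 n2); have := h2 _ (leq_maxr n1 n2).
set x := u _; have := ncB (x - l') (x - l).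
by rewrite (_ : x - l' - (x - l) = l - l'); [lra|ring].
Qed.

Lemma clim_cst l : clim (fun _ => l) l.
Proof. by move=> e e0; exists 0%N => n _; rewrite subrr nc0 ltW. Qed.

Lemma climD u v l l' : clim u l -> clim v l' -> clim (fun n => u n + v n) (l + l').
Proof.
move=> h h' e e0; have e2 : 0 < e / 2 by rewrite divr_gt0.
have [n1 h1] := h _ e2; have [n2 h2] := h' _ e2.
exists (maxn n1 n2) => n; rewrite geq_max => /andP[/h1 a /h2 b].
by have := ncD (u n - l) (v n - l'); rewrite addrACA -opprD; lra.
Qed.

Lemma climZ u l z : clim u l -> clim (fun n => z * u n) (z * l).
Proof.
move=> h e e0; have c0 : 0 < nc z + 1 by rewrite ltr_wpDl // nc_ge0.
have [n0 hn] := h (e / (nc z + 1)) (divr_gt0 e0 c0).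
exists n0 => n /hn; rewrite -mulrBr ncM ler_pdivlMr // => hh.
by have := nc_ge0 (u n - l); have := nc_ge0 z; nra.
Qed.

Lemma clim_sum I (r : seq I) (F : I -> nat -> R[i]) (L : I -> R[i]) :
  (forall i, clim (F i) (L i)) ->
  clim (fun n => \sum_(i <- r) F i n) (\sum_(i <- r) L i).
Proof.
move=> h; elim: r => [|i r IH].
  by rewrite big_nil; apply: eq_clim (clim_cst 0) => n; rewrite big_nil.
rewrite big_cons; apply: eq_clim (climD (h i) IH) => n.
by rewrite big_cons.
Qed.

Lemma clim_dist_le u l z B : clim u l ->
  (exists n0, forall n, (n0 <= n)%N -> nc (u n - z) <= B) -> nc (l - z) <= B.
Proof.
move=> h [m0 hm]; apply/ler_addgt0Pr => e e0; have [n0 hn] := h e e0.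
have := hn _ (leq_maxl n0 m0); have := hm _ (leq_maxr n0 m0).
set x := u _; have := ncB (x - z) (x - l).
by rewrite (_ : x - z - (x - l) = l - z); [lra|ring].
Qed.

Lemma clim_nc_le u l B : clim u l -> (forall n, nc (u n) <= B) -> nc l <= B.
Proof.
move=> h hB; rewrite -(subr0 l); apply: clim_dist_le h _.
by exists 0%N => n _; rewrite subr0.
Qed.

Lemma clim_Re_le u v l l' : clim u l -> clim v l' ->
  (exists n0, forall n, (n0 <= n)%N -> complex.Re (u n) <= complex.Re (v n)) ->
  complex.Re l <= complex.Re l'.
Proof.
move=> h h' [m0 hm]; apply/ler_addgt0Pr => e e0; have e2 : 0 < e / 2 by rewrite divr_gt0.
have [n1 h1] := h _ e2; have [n2 h2] := h' _ e2.
have m1 : (n1 <= maxn m0 (maxn n1 n2))%N by lia.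
have m2 : (n2 <= maxn m0 (maxn n1 n2))%N by lia.
have := h1 _ m1; have := h2 _ m2; have := hm _ (leq_maxl m0 (maxn n1 n2)).
set x := u _; set y := v _.
have := Re_le (l - x); have := Re_le (y - l').
rewrite !(ReD, ReN) (ncBC l x); lra.
Qed.

Lemma clim_squeeze u l (d : nat -> R) : (forall n, nc (u n - l) <= d n) ->
  d @ \oo --> 0 -> clim u l.
Proof.
move=> hd /cvgrPdist_le d0 e e0; have [n0 _ hn] := d0 e e0; exists n0 => n n0n.
apply: le_trans (hd n) _; have := hn n n0n; rewrite sub0r normrN.
exact/le_trans/ler_norm.
Qed.

Lemma clim_cexp u l : clim u l -> clim (fun n => cexp (u n)) (cexp l).
Proof.
move=> h e e0; have c0 : 0 < nc (cexp l) by rewrite nc_gt0 cexp_neq0.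
have d0 : 0 < Num.min (1 / 10) (e / (2 * nc (cexp l))).
  by rewrite lt_min !divr_gt0 // mulr_gt0.
have [n0 hn] := h _ d0; exists n0 => n /hn; rewrite le_min => /andP[h1 h2].
have -> : cexp (u n) - cexp l = cexp l * (cexp (u n - l) - 1).
  by rewrite mulrBr mulr1 -cexpD; congr (cexp _ - _); ring.
rewrite ncM; have := nc_cexpB1 h1.
move: h2; rewrite ler_pdivlMr ?mulr_gt0 // => h2.
by have := nc_ge0 (u n - l); nra.
Qed.

Lemma csumsD u v l l' : csums u l -> csums v l' ->
  csums (fun k => u k + v k) (l + l').
Proof. by move=> h h'; apply: eq_clim (climD h h') => n; rewrite big_split. Qed.

Lemma csumsZ u l z : csums u l -> csums (fun k => z * u k) (z * l).
Proof. by move=> h; apply: eq_clim (climZ z h) => n; rewrite big_distrr. Qed.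

Lemma csumsB u v l l' : csums u l -> csums v l' ->
  csums (fun k => u k - v k) (l - l').
Proof.
move=> h /(csumsZ (-1)) h'; have := csumsD h h'; rewrite mulN1r.
by apply: eq_clim => n; apply: eq_bigr => k _; rewrite mulN1r.
Qed.

Lemma csums_sum I (r : seq I) (F : I -> nat -> R[i]) (L : I -> R[i]) :
  (forall i, csums (F i) (L i)) ->
  csums (fun k => \sum_(i <- r) F i k) (\sum_(i <- r) L i).
Proof.
by move=> h; apply: eq_clim (clim_sum r h) => n; rewrite exchange_big.
Qed.

Lemma eq_csums u v l : u =1 v -> csums u l -> csums v l.
Proof. by move=> /funext ->. Qed.

Lemma csums_cvg u (s1 s2 : R) :
  series (fun k => complex.Re (u k)) @ \oo --> s1 ->
  series (fun k => complex.Im (u k)) @ \oo --> s2 ->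
  csums u (s1 +i* s2).
Proof.
move=> /cvgrPdist_le h1 /cvgrPdist_le h2 e e0.
have e2 : 0 < e / 2 by rewrite divr_gt0.
have [n1 _ h1'] := h1 _ e2; have [n2 _ h2'] := h2 _ e2.
exists (maxn n1 n2) => n; rewrite geq_max => /andP[/h1' /= a /h2' /= b].
apply: le_trans (nc_le _) _; rewrite !(ReD, ImD, ReN, ImN) Re_sum Im_sum.
rewrite distrC in a; rewrite distrC in b; rewrite /series /= in a b.
by apply: le_trans (lerD a b) _; lra.
Qed.

Lemma csums_ex u (v : nat -> R) : (forall k, nc (u k) <= v k) ->
  cvgn (series v) -> exists l, csums u l.
Proof.
move=> uv cv.
have cRe : cvgn (series (fun k => complex.Re (u k))).
  apply: normed_cvg; apply: series_le_cvg cv => k //=.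
    exact: le_trans (nc_ge0 _) (uv k).
  exact: le_trans (normRe_le _) (uv k).
have cIm : cvgn (series (fun k => complex.Im (u k))).
  apply: normed_cvg; apply: series_le_cvg cv => k //=.
    exact: le_trans (nc_ge0 _) (uv k).
  exact: le_trans (normIm_le _) (uv k).
eexists; apply: csums_cvg cRe cIm.
Qed.

Lemma csums_geo u (M r : R) : 0 <= r < 1 -> (forall k, nc (u k) <= M * r ^+ k) ->
  exists l, csums u l.
Proof.
move=> /andP[r0 r1] h; apply: csums_ex h _.
by apply: is_cvg_geometric_series; rewrite ger0_norm.
Qed.

(** Termwise comparison that keeps the difference at one index: on the minor arcs
    the whole exponential saving comes from a single term of the series. *)
Lemma csums_Re_gain u v l l' k0 : csums u l -> csums v l' ->
  (forall k, complex.Re (u k) <= complex.Re (v k)) ->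
  complex.Re l + (complex.Re (v k0) - complex.Re (u k0)) <= complex.Re l'.
Proof.
move=> h h' uv.
have <- : complex.Re (l + (v k0 - u k0)) =
    complex.Re l + (complex.Re (v k0) - complex.Re (u k0)) by rewrite !(ReD, ReN).
apply: clim_Re_le (climD h (clim_cst _)) h' _; exists k0.+1 => n k0n.
rewrite ReD !Re_sum ReD ReN -lerBrDl -sumrB.
rewrite (big_nat_widenl _ 0) // (bigD1_seq k0) ?iota_uniq ?mem_index_iota //=.
rewrite lerDl; apply: sumr_ge0 => k _.
by rewrite subr_ge0.
Qed.

Lemma csums_multiples u l (t : nat) : (0 < t)%N -> csums u l ->
  csums (fun k => if (t %| k.+1)%N then u (k.+1 %/ t).-1 else 0) l.
Proof.
move=> t0 h.
have E n : \sum_(0 <= k < n) (if (t %| k.+1)%N then u (k.+1 %/ t).-1 else 0) =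
    \sum_(0 <= j < n %/ t) u j.
  elim: n => [|n IH]; first by rewrite div0n !big_nil.
  rewrite big_nat_recr //= IH divnS //; case: (t %| n.+1)%N; last by rewrite addr0.
  by rewrite add1n big_nat_recr.
move=> e e0; have [n0 hn] := h e e0; exists (n0 * t)%N => n n0n.
by rewrite E; apply: hn; rewrite leq_divRL.
Qed.

End ComplexLimits.

(** * The logarithm series *)

Section LogSeries.
Variable R : realType.
Local Open Scope complex_scope.
Implicit Types (w : R[i]).

Lemma is_derive_psum (c : nat -> R) n (x : R) :
  is_derive x 1 (fun y : R => \sum_(0 <= k < n) c k / k.+1%:R * y ^+ k.+1)
    (\sum_(0 <= k < n) c k * x ^+ k).
Proof.
elim: n => [|n IH].
  rewrite big_nil; under eq_fun do rewrite big_nil; exact: is_derive_cst.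
rewrite big_nat_recr //=; under eq_fun do rewrite big_nat_recr //=.
have n0 : n.+1%:R != 0 :> R by rewrite pnatr_eq0.
have d : is_derive x 1 (fun y : R => c n / n.+1%:R * y ^+ n.+1) (c n * x ^+ n).
  have := is_deriveZ (c n / n.+1%:R) (is_deriveX n.+1 (is_derive_id x 1)).
  by rewrite exprfctE => h; apply: (is_derive_eq h); rewrite /GRing.scale /=; field.
exact: (is_deriveD IH d).
Qed.

Lemma is_derive_ln_dist (a b x : R) : 0 < (1 - x * a) ^+ 2 + (x * b) ^+ 2 ->
  is_derive x 1 (fun y : R => 2^-1 * ln ((1 - y * a) ^+ 2 + (y * b) ^+ 2))
    ((x * b ^+ 2 - a * (1 - x * a)) / ((1 - x * a) ^+ 2 + (x * b) ^+ 2)).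
Proof.
move=> h; have dl := is_derive1_ln h.
have dg : is_derive x 1 (fun x : R => (1 - x * a) ^+ 2 + (x * b) ^+ 2)
   (2 * (x * b ^+ 2 - a * (1 - x * a))).
  by apply: is_derive_eq; rewrite /GRing.scale /=; ring.
have dc : is_derive x 1 (fun y : R => ln ((1 - y * a) ^+ 2 + (y * b) ^+ 2))
    (((1 - x * a) ^+ 2 + (x * b) ^+ 2)^-1 * (2 * (x * b ^+ 2 - a * (1 - x * a)))).
  exact: (@is_derive1_comp _ _ (fun y : R => (1 - y * a) ^+ 2 + (y * b) ^+ 2) _ _ _ dl dg).
apply: (is_derive_eq (is_deriveZ (2^-1) dc)); rewrite /GRing.scale /=.
move: (lt0r_neq0 h); set D := _ + _ => D0.
by field.
Qed.

Lemma is_derive_atan_ratio (a b x : R) : 1 - x * a != 0 ->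
  is_derive x 1 (fun y : R => atan (- (y * b) / (1 - y * a)))
    (- b / ((1 - x * a) ^+ 2 + (x * b) ^+ 2)).
Proof.
move=> xa; have dl := is_derive1_atan (- (x * b) / (1 - x * a)).
have dx : is_derive x 1 (fun y : R => 1 - y * a) (- a).
  by apply: is_derive_eq; rewrite /GRing.scale /=; ring.
have dv := @is_deriveV _ (fun y : R => 1 - y * a) _ _ _ xa dx.
have dn : is_derive x 1 (fun y : R => - (y * b)) (- b).
  by apply: is_derive_eq; rewrite /GRing.scale /=; ring.
have dc := @is_derive1_comp _ _ (fun y : R => - (y * b) / (1 - y * a)) _ _ _ dl
  (is_deriveM dn dv).
apply: (is_derive_eq dc); rewrite /GRing.scale /=.
have -> : 1 + (- (x * b) / (1 - x * a)) ^+ 2 =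
   ((1 - x * a) ^+ 2 + (x * b) ^+ 2) / (1 - x * a) ^+ 2 by field.
have D0 : (1 - x * a) ^+ 2 + (x * b) ^+ 2 != 0.
  by rewrite lt0r_neq0 // ltr_wpDr ?sqr_ge0 // exprn_even_gt0.
by move: D0; set D := _ + _ => D0; field; rewrite D0.
Qed.

(** The principal logarithm of 1 - w, written in the form valid on the half plane
    Re (1 - w) > 0, which contains the open disc and its boundary without 1. *)
Definition clog1m w : R[i] :=
  ln (nc (1 - w)) +i* atan (complex.Im (1 - w) / complex.Re (1 - w)).

(** Along the ray from 0 to w the derivatives of the partial sums of the logarithm
    series are geometric sums, so they approach w / (1 - x w) uniformly. *)
Lemma psum_remainder w (n : nat) (x : R) : nc w < 1 -> 0 <= x <= 1 ->
  nc (\sum_(0 <= k < n) w ^+ k.+1 * x%:C ^+ k - w / (1 - x%:C * w))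
    <= nc w ^+ n.+1 / (1 - nc w).
Proof.
move=> w1 /andP[x0 x1].
have xw : nc (x%:C * w) <= nc w by rewrite ncM ncR ger0_norm // ler_piMl // nc_ge0.
have dge : 1 - nc w <= nc (1 - x%:C * w).
  by apply: le_trans (ncBr _ _); rewrite nc1 lerD2l lerN2.
have d0 : 1 - x%:C * w != 0 by rewrite -nc_gt0; apply: lt_le_trans dge; rewrite subr_gt0.
have -> : \sum_(0 <= k < n) w ^+ k.+1 * x%:C ^+ k - w / (1 - x%:C * w) =
   - (w * (x%:C * w) ^+ n / (1 - x%:C * w)).
  have -> : \sum_(0 <= k < n) w ^+ k.+1 * x%:C ^+ k = (w - w * (x%:C * w) ^+ n) / (1 - x%:C * w).
    elim: n => [|n IH]; first by rewrite big_nil expr0 mulr1 subrr mul0r.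
    rewrite big_nat_recr //= IH !exprS exprMn; field.
    by rewrite d0.
  by field.
rewrite ncN !ncM ncX ncV exprS -!mulrA.
rewrite ler_wpM2l ?nc_ge0 // ler_pM ?invr_ge0 ?nc_ge0 ?exprn_ge0 ?nc_ge0 //.
  by rewrite lerXn2r ?nnegrE ?nc_ge0.
by rewrite lef_pV2 ?posrE // ?nc_gt0 // subr_gt0.
Qed.

(** The derivative along the ray of partial sum plus logarithm is small by
    psum_remainder. The mean value inequality applies to the real and the
    imaginary part separately, which costs the factor 2. *)
Lemma csums_clog1m w : nc w < 1 ->
  csums (fun k => w ^+ k.+1 / k.+1%:R) (- clog1m w).
Proof.
move=> w1.
apply: (@clim_squeeze _ _ _ (fun n => 2 * (nc w ^+ n.+1 / (1 - nc w)))); last first.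
  rewrite [X in _ --> X](_ : 0 = 2 * (0 / (1 - nc w))); last by ring.
  apply: cvgM; first exact: cvg_cst.
  apply: cvgM; last exact: cvg_cst.
  have := @cvg_expr R (nc w); rewrite ger0_norm ?nc_ge0 // => /(_ w1).
  by rewrite -(cvg_shiftS (fun n => nc w ^+ n)).
move=> n; set M := _ / _.
set a := complex.Re w; set b := complex.Im w.
have ab : a ^+ 2 + b ^+ 2 < 1.
  by rewrite -nc_sqr expr_lt1 ?nc_ge0.
have a1 : `|a| < 1 by apply: le_lt_trans (normRe_le _) w1.
have ax (x : R) : 0 <= x <= 1 -> 0 < 1 - x * a.
  by move: a1; rewrite ltr_norml => /andP[? ?] /andP[? ?]; nra.
have D0 (x : R) : 0 <= x <= 1 -> 0 < (1 - x * a) ^+ 2 + (x * b) ^+ 2.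
  by move=> /ax h; rewrite ltr_wpDr ?sqr_ge0 // exprn_gt0.
have wE (x : R) : 0 <= x <= 1 -> w / (1 - x%:C * w) =
    ((a * (1 - x * a) - x * b ^+ 2) / ((1 - x * a) ^+ 2 + (x * b) ^+ 2)) +i*
    (b / ((1 - x * a) ^+ 2 + (x * b) ^+ 2)).
  move=> /D0 h; have h0 := lt0r_neq0 h.
  apply: eqC; rewrite !(ReM, ImM) ReV ImV nc_sqr !(ReD, ImD, ReN, ImN, ReM, ImM) /= -/a -/b.
    by field; rewrite [X in X != 0](_ : _ = (1 - x * a) ^+ 2 + (x * b) ^+ 2); [|ring].
  by field; rewrite [X in X != 0](_ : _ = (1 - x * a) ^+ 2 + (x * b) ^+ 2); [|ring].
have ReS (x : R) : complex.Re (\sum_(0 <= k < n) w ^+ k.+1 * x%:C ^+ k) =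
    \sum_(0 <= k < n) complex.Re (w ^+ k.+1) * x ^+ k.
  rewrite Re_sum; apply: eq_bigr => k _.
  by rewrite -rmorphXn ReM /= mulr0 subr0.
have ImS (x : R) : complex.Im (\sum_(0 <= k < n) w ^+ k.+1 * x%:C ^+ k) =
    \sum_(0 <= k < n) complex.Im (w ^+ k.+1) * x ^+ k.
  rewrite Im_sum; apply: eq_bigr => k _.
  by rewrite -rmorphXn ImM /= mulr0 add0r.
have div_nat (z : R[i]) (k : nat) : z / k.+1%:R = (complex.Re z / k.+1%:R) +i* (complex.Im z / k.+1%:R).
  have -> : k.+1%:R^-1 = (k.+1%:R^-1 : R)%:C by rewrite rmorphV ?unitfE ?pnatr_eq0 // rmorph_nat.
  by apply: eqC; rewrite !(ReM, ImM) /= mulr0 ?subr0 ?add0r.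
have hRe : `|complex.Re (\sum_(0 <= k < n) w ^+ k.+1 / k.+1%:R) + ln (nc (1 - w))| <= M.
  pose f (x : R) := \sum_(0 <= k < n) complex.Re (w ^+ k.+1) / k.+1%:R * x ^+ k.+1
     + 2^-1 * ln ((1 - x * a) ^+ 2 + (x * b) ^+ 2).
  pose df (x : R) := \sum_(0 <= k < n) complex.Re (w ^+ k.+1) * x ^+ k
     - (a * (1 - x * a) - x * b ^+ 2) / ((1 - x * a) ^+ 2 + (x * b) ^+ 2).
  have d (x : R) : 0 <= x <= 1 -> is_derive x 1 f (df x).
    move=> x01; apply: is_deriveD; first exact: is_derive_psum.
    have h := is_derive_ln_dist (D0 x x01).
    by apply: (is_derive_eq h); rewrite -[RHS]mulNr opprB.
  have := @mvt_bound _ f df 0 1 M ler01 d.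
  rewrite subr0 mulr1 => h.
  have f0 : f 0 = 0.
    rewrite /f !mul0r subr0 expr1n expr0n addr0 ln1 mulr0 addr0.
    by rewrite big1_seq // => k _; rewrite expr0n mulr0.
  have f1 : f 1 = complex.Re (\sum_(0 <= k < n) w ^+ k.+1 / k.+1%:R) + ln (nc (1 - w)).
    rewrite /f Re_sum; congr (_ + _).
      by apply: eq_bigr => k _; rewrite expr1n mulr1 div_nat.
    rewrite !mul1r.
    have -> : (1 - a) ^+ 2 + b ^+ 2 = nc (1 - w) ^+ 2.
      by rewrite nc_sqr !(ReD, ImD, ReN, ImN) /= -/a -/b; ring.
    rewrite lnXn; first by rewrite -mulr_natl; field.
    by apply: lt_le_trans (ncBr _ _); rewrite nc1 subr_gt0.
  rewrite -f1 -[f 1]subr0 -f0; apply: h => x x01.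
  apply: le_trans (psum_remainder n w1 x01); apply: le_trans (normRe_le _).
  by rewrite !(ReD, ReN) ReS wE.
have hIm : `|complex.Im (\sum_(0 <= k < n) w ^+ k.+1 / k.+1%:R) +
     atan (complex.Im (1 - w) / complex.Re (1 - w))| <= M.
  pose f (x : R) := \sum_(0 <= k < n) complex.Im (w ^+ k.+1) / k.+1%:R * x ^+ k.+1
     + atan (- (x * b) / (1 - x * a)).
  pose df (x : R) := \sum_(0 <= k < n) complex.Im (w ^+ k.+1) * x ^+ k
     - b / ((1 - x * a) ^+ 2 + (x * b) ^+ 2).
  have d (x : R) : 0 <= x <= 1 -> is_derive x 1 f (df x).
    move=> x01; apply: is_deriveD; first exact: is_derive_psum.
    by have h := is_derive_atan_ratio b (lt0r_neq0 (ax x x01)); rewrite -mulNr.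
  have := @mvt_bound _ f df 0 1 M ler01 d.
  rewrite subr0 mulr1 => h.
  have f0 : f 0 = 0.
    rewrite /f !mul0r oppr0 mul0r atan0 addr0.
    by rewrite big1_seq // => k _; rewrite expr0n mulr0.
  have f1 : f 1 = complex.Im (\sum_(0 <= k < n) w ^+ k.+1 / k.+1%:R) +
      atan (complex.Im (1 - w) / complex.Re (1 - w)).
    rewrite /f Im_sum; congr (_ + _).
      by apply: eq_bigr => k _; rewrite expr1n mulr1 div_nat.
    by rewrite !(ReD, ImD, ReN, ImN) /= -/a -/b !mul1r add0r.
  rewrite -f1 -[f 1]subr0 -f0; apply: h => x x01.
  apply: le_trans (psum_remainder n w1 x01); apply: le_trans (normIm_le _).
  by rewrite !(ImD, ImN) ImS wE.
rewrite opprK; apply: le_trans (nc_le _) _; rewrite ReD ImD mulr2n mulrDl !mul1r.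
exact: lerD.
Qed.

Lemma cexp_clog1m w : 0 < complex.Re (1 - w) -> cexp (clog1m w) = 1 - w.
Proof.
rewrite /clog1m; set u := 1 - w => u0.
have n0 : 0 < nc u by apply: lt_le_trans (Re_le _).
have c : cos (atan (complex.Im u / complex.Re u)) = complex.Re u / nc u.
  rewrite cos_atan.
  have -> : 1 + (complex.Im u / complex.Re u) ^+ 2 = (nc u / complex.Re u) ^+ 2.
    by rewrite !exprMn nc_sqr; field; rewrite lt0r_neq0.
  by rewrite sqrtr_sqr ger0_norm ?invf_div // divr_ge0 // ltW.
have s : sin (atan (complex.Im u / complex.Re u)) = complex.Im u / nc u.
  have := atanK (complex.Im u / complex.Re u); rewrite /tan c => h.
  have ne : complex.Re u / nc u != 0 by rewrite mulf_neq0 ?invr_eq0 ?lt0r_neq0.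
  have := congr1 (fun x => x * (complex.Re u / nc u)) h; rewrite divfK // => ->.
  by field; rewrite !lt0r_neq0.
apply: eqC; rewrite ?Re_cexp ?Im_cexp /= lnK ?posrE // ?c ?s; field; exact: lt0r_neq0.
Qed.

Lemma Re_1m_gt0 w : nc w < 1 -> 0 < complex.Re (1 - w).
Proof. by move=> w1; rewrite ReD ReN /=; have := Re_le w; lra. Qed.

(** The series stops being available on the circle nc w = 1; its boundary values
    at roots of unity are reached by continuity. *)
Lemma clog1m_continuous w0 (e : R) : 0 < complex.Re (1 - w0) -> 0 < e ->
  exists2 d : R, 0 < d & forall w, nc (w - w0) <= d -> nc (clog1m w - clog1m w0) <= e.
Proof.
move=> u0 e0; have n0 : 0 < nc (1 - w0) by apply: lt_le_trans (Re_le _).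
pose F : set_system R[i] :=
  [set P | exists2 d : R, 0 < d & forall w, nc (w - w0) <= d -> P w].
have FF : Filter F.
  split; first by exists 1.
    move=> P Q [d d0 hd] [d' d0' hd']; exists (Num.min d d'); first by rewrite lt_min d0.
    by move=> w; rewrite le_min => /andP[/hd ? /hd' ?].
  by move=> P Q PQ [d d0 hd]; exists d => // w /hd /PQ.
have cRe : complex.Re (1 - w) @[w --> F] --> complex.Re (1 - w0).
  apply/cvgrPdist_le => d d0; exists d => // w h.
  rewrite !(ReD, ReN) (_ : _ - _ = complex.Re (w - w0)); last by rewrite ReD ReN; ring.
  exact: le_trans (normRe_le _) _.
have cIm : complex.Im (1 - w) @[w --> F] --> complex.Im (1 - w0).
  apply/cvgrPdist_le => d d0; exists d => // w h.
  rewrite !(ImD, ImN) (_ : _ - _ = complex.Im (w - w0)); last by rewrite ImD ImN; ring.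
  exact: le_trans (normIm_le _) _.
have cn : nc (1 - w) @[w --> F] --> nc (1 - w0).
  apply/cvgrPdist_le => d d0; exists d => // w h.
  have n1 := ncBr (1 - w0) (1 - w); have n2 := ncBr (1 - w) (1 - w0).
  rewrite (_ : 1 - w0 - (1 - w) = w - w0) in n1; last by ring.
  rewrite (_ : 1 - w - (1 - w0) = w0 - w) ?(ncBC w0) in n2; last by ring.
  by rewrite ler_norml; lra.
have cl : ln (nc (1 - w)) @[w --> F] --> ln (nc (1 - w0)).
  exact: cvg_comp cn (continuous_ln n0).
have ca : atan (complex.Im (1 - w) / complex.Re (1 - w)) @[w --> F] -->
    atan (complex.Im (1 - w0) / complex.Re (1 - w0)).
  apply: continuous_cvg; first exact: continuous_atan.
  by apply: cvgM => //; apply: cvgV => //; rewrite lt0r_neq0.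
have e2 : 0 < e / 2 by rewrite divr_gt0.
move/cvgrPdist_le : cl => /(_ _ e2) cl; move/cvgrPdist_le : ca => /(_ _ e2) ca.
have [d d0 h] := filterI cl ca.
exists d => // w /h [h1 h2].
apply: le_trans (nc_le _) _; rewrite !(ReD, ImD, ReN, ImN) /=.
by rewrite distrC in h1; rewrite distrC in h2; lra.
Qed.

End LogSeries.

(** * Infinite products as exponentials, and roots of unity *)

Section Products.
Variable R : realType.
Local Open Scope complex_scope.
Implicit Types (q z w : R[i]) (y : R).

Lemma geo_sum_le (r : R) n : 0 <= r < 1 -> \sum_(0 <= k < n) r ^+ k <= (1 - r)^-1.
Proof.
move=> /andP[r0 r1]; have d0 : 0 < 1 - r by lra.
have -> : \sum_(0 <= k < n) r ^+ k = (1 - r ^+ n) / (1 - r).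
  elim: n => [|n IH]; first by rewrite big_nil expr0 subrr mul0r.
  by rewrite big_nat_recr //= IH exprS; field; rewrite lt0r_neq0.
by rewrite ler_piMl ?invr_ge0 ?(ltW d0) // gerBl exprn_ge0.
Qed.

(** The sum of q^n over n >= 1, which appears when the logarithms of all the
    factors 1 - q^n are expanded and summed over n first. *)
Definition lam q : R[i] := q / (1 - q).

Lemma nc_1mX_ge q k : nc q < 1 -> 1 - nc q <= nc (1 - q ^+ k.+1).
Proof.
move=> q1; apply: le_trans (ncBr _ _); rewrite nc1 ncX lerD2l lerN2.
by rewrite exprS ler_piMr ?nc_ge0 // exprn_ile1 ?nc_ge0 ?ltW.
Qed.

Lemma X1m_neq0 q k : nc q < 1 -> 1 - q ^+ k.+1 != 0.
Proof.
by move=> q1; rewrite -nc_gt0; apply: lt_le_trans (nc_1mX_ge k q1); rewrite subr_gt0.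
Qed.

Lemma nc_lam q k : nc q < 1 -> nc (lam (q ^+ k.+1)) <= nc q ^+ k.+1 / (1 - nc q).
Proof.
move=> q1; rewrite ncM ncV ncX ler_wpM2l ?exprn_ge0 ?nc_ge0 //.
rewrite lef_pV2 ?posrE ?nc_gt0 ?X1m_neq0 ?subr_gt0 //.
exact: nc_1mX_ge.
Qed.

Lemma nc_divn_le z k : nc (z / k.+1%:R) <= nc z.
Proof.
rewrite ncM ncV nc_nat ler_piMr ?nc_ge0 // invf_le1 ?ltr0n //.
by rewrite ler1n.
Qed.

Lemma csums_lam q : nc q < 1 ->
  exists S, csums (fun k => lam (q ^+ k.+1) / k.+1%:R) S.
Proof.
move=> q1; apply: (@csums_geo _ _ (nc q / (1 - nc q)) (nc q)).
  by rewrite nc_ge0.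
move=> k; apply: le_trans (nc_divn_le _ _) _.
by apply: le_trans (nc_lam k q1) _; rewrite exprS mulrAC.
Qed.

(** Cutting the product after N factors removes from the k-th term of the series
    the tail of a geometric series, which is the term times q^(kN); hence the
    logarithm of the partial product differs from -S by O(r^N). *)
Lemma clim_qprod q S : nc q < 1 ->
  csums (fun k => lam (q ^+ k.+1) / k.+1%:R) S ->
  clim (fun N => \prod_(0 <= n < N) (1 - q * q ^+ n)) (cexp (- S)).
Proof.
move=> q1 hS; set r := nc q in q1 *; have r0 : 0 <= r by exact: nc_ge0.
have d0 : 0 < 1 - r by lra.
have qn1 n : nc (q ^+ n.+1) < 1 by rewrite ncX exprn_ilt1 ?nc_ge0.
suff h : clim (fun N => \sum_(0 <= n < N) clog1m (q ^+ n.+1)) (- S).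
  apply: eq_clim (clim_cexp h) => N; rewrite cexp_sum; apply: eq_bigr => n _.
  by rewrite cexp_clog1m ?Re_1m_gt0 // exprS.
apply: (@clim_squeeze _ _ _ (fun N => r ^+ N * (1 - r)^-1 ^+ 2)); last first.
  rewrite [X in _ --> X](_ : 0 = 0 * (1 - r)^-1 ^+ 2); last by ring.
  apply: cvgM; last exact: cvg_cst.
  by apply: cvg_expr; rewrite ger0_norm.
move=> N.
have hlog := csums_sum (index_iota 0 N) (fun n => csums_clog1m (qn1 n)).
have := csumsB hS hlog; rewrite sumrN opprK => hd.
rewrite opprK addrC.
apply: (clim_nc_le hd) => K.
rewrite (eq_bigr (fun k => lam (q ^+ k.+1) / k.+1%:R * q ^+ (k.+1 * N))); last first.
  move=> k _; rewrite -big_distrl /= -mulrBl mulrAC; congr (_ / _).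
  rewrite (_ : \sum_(0 <= i < N) (q ^+ i.+1) ^+ k.+1 = lam (q ^+ k.+1) * (1 - q ^+ (k.+1 * N))).
    by ring.
  elim: N {hlog hd} => [|N IH]; first by rewrite big_nil muln0 expr0 subrr mulr0.
  rewrite big_nat_recr //= IH mulnS exprD /lam.
  have -> : (q ^+ N.+1) ^+ k.+1 = q ^+ k.+1 * q ^+ (k.+1 * N).
    by rewrite -exprM mulSn exprD (mulnC N).
  by have := X1m_neq0 k q1; set Q := q ^+ k.+1 => Q1; field.
apply: le_trans (nc_sum _ _ _) _.
apply: (@le_trans _ _ (\sum_(0 <= k < K) (r ^+ N * (1 - r)^-1) * r ^+ k)).
  apply: ler_sum => k _; rewrite ncM ncX -/r.
  apply: (@le_trans _ _ (r ^+ k.+1 / (1 - r) * r ^+ N)).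
    apply: ler_pM; rewrite ?nc_ge0 ?exprn_ge0 //.
      exact: le_trans (nc_divn_le _ _) (nc_lam k q1).
    by rewrite mulSn exprD ler_piMr ?exprn_ge0 // exprn_ile1 // ltW.
  rewrite exprS mulrC -!mulrA ler_wpM2l ?exprn_ge0 //.
  rewrite [leRHS]mulrC mulrA ler_wpM2r ?invr_ge0 ?(ltW d0) //.
  by rewrite ler_piMl ?exprn_ge0 // ltW.
rewrite -big_distrr /= expr2 mulrA ler_wpM2l ?geo_sum_le ?r0 //.
by rewrite mulr_ge0 ?exprn_ge0 ?invr_ge0 // ltW.
Qed.

Lemma qpochE q S : nc q < 1 ->
  csums (fun k => lam (q ^+ k.+1) / k.+1%:R) S -> qpoch q q = cexp (- S).
Proof.
move=> q1 /(clim_qprod q1)/climP h; rewrite /qpoch.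
exact: (cvg_lim (@norm_hausdorff _ _) h).
Qed.

(** The k-th term (counted from 0) of the logarithm of (q;q) / (q^t;q^t). *)
Definition lterm (t : nat) q k : R[i] := (lam ((q ^+ t) ^+ k.+1) - lam (q ^+ k.+1)) / k.+1%:R.

Lemma quotient_exp (t m : nat) q : (0 < t)%N -> nc q < 1 ->
  exists L, csums (lterm t q) L /\
    qpoch q q ^+ m / qpoch (q ^+ t) (q ^+ t) ^+ m = cexp (m%:R * L).
Proof.
move=> t0 q1; have [S hS] := csums_lam q1.
have qt1 : nc (q ^+ t) < 1 by rewrite ncX exprn_ilt1 ?nc_ge0 // -lt0n.
have [T hT] := csums_lam qt1.
exists (T - S); split.
  by apply: eq_csums (csumsB hT hS) => k; rewrite /lterm mulrBl.
rewrite (qpochE q1 hS) (qpochE qt1 hT) cexp_natM -expr_div_n -cexpN -cexpD.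
by congr (cexp _ ^+ _); ring.
Qed.

(** The unit circle, with the angle measured in turns. *)
Definition uc y : R[i] := cexp (0 +i* (2 * pi * y)).

Lemma ucD y1 y2 : uc (y1 + y2) = uc y1 * uc y2.
Proof. by rewrite /uc -cexpD; congr cexp; apply: eqC => /=; ring. Qed.
Lemma uc0 : uc 0 = 1.
Proof. by rewrite /uc mulr0 (_ : 0 +i* 0 = 0) ?cexp0. Qed.
Lemma ucN y : uc (- y) = (uc y)^-1.
Proof. by rewrite /uc -cexpN; congr cexp; apply: eqC => /=; ring. Qed.
Lemma nc_uc y : nc (uc y) = 1. Proof. by rewrite nc_cexp expR0. Qed.
Lemma uc1 : uc 1 = 1.
Proof.
apply: eqC; rewrite /uc ?Re_cexp ?Im_cexp /= expR0 mulr1 mul1r.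
  by rewrite mulr_natl cos2pi.
by rewrite mulr_natl sin2pi.
Qed.
Lemma ucX y n : uc y ^+ n = uc (n%:R * y).
Proof.
elim: n => [|n IH]; first by rewrite expr0 mul0r uc0.
by rewrite exprS IH -ucD -natr1; congr uc; ring.
Qed.
Lemma uc_nat n : uc n%:R = 1.
Proof. by rewrite -(mulr1 n%:R) -ucX uc1 expr1n. Qed.
Lemma Re_uc y : complex.Re (uc y) = cos (2 * pi * y).
Proof. by rewrite Re_cexp /= expR0 mul1r. Qed.
Lemma Im_uc y : complex.Im (uc y) = sin (2 * pi * y).
Proof. by rewrite Im_cexp /= expR0 mul1r. Qed.

Lemma Re_1m_uc y : complex.Re (1 - uc y) = 2 * sin (pi * y) ^+ 2.
Proof.
rewrite ReD ReN Re_uc /= (_ : 2 * pi * y = (pi * y) *+ 2); last by rewrite -mulr_natl; ring.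
by rewrite cos_mulr2n cos2sin2; ring.
Qed.

Lemma sin_piM_gt0 y : 0 < y < 1 -> 0 < sin (pi * y).
Proof.
move=> /andP[y0 y1]; apply: sin_gt0_pi; have := pi_gt0 R => p0.
by rewrite mulr_gt0 //= -[ltRHS]mulr1 ltr_pM2l.
Qed.

Lemma Re_1m_uc_gt0 y : 0 < y < 1 -> 0 < complex.Re (1 - uc y).
Proof. by move=> /sin_piM_gt0 h; rewrite Re_1m_uc mulr_gt0 // exprn_gt0. Qed.

Lemma uc_neq1 y : 0 < y < 1 -> uc y != 1.
Proof.
move=> /Re_1m_uc_gt0; apply: contraTneq => ->.
by rewrite subrr ltxx.
Qed.

Lemma uc_modn (n t : nat) : (0 < t)%N -> uc (n%:R / t%:R) = uc ((n %% t)%:R / t%:R).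
Proof.
move=> t0; rewrite {1}(divn_eq n t) natrD natrM mulrDl mulfK ?pnatr_eq0 -?lt0n //.
by rewrite ucD uc_nat mul1r.
Qed.

Lemma uc_eq1 (n t : nat) : (0 < t)%N -> (uc (n%:R / t%:R) == 1) = (t %| n)%N.
Proof.
move=> t0; rewrite uc_modn // /dvdn.
have [->|n0] := eqVneq (n %% t)%N 0%N; first by rewrite mul0r uc0 eqxx.
apply/negbTE/uc_neq1; rewrite divr_gt0 ?ltr0n ?lt0n //=; last by rewrite -lt0n.
by rewrite ltr_pdivrMr ?ltr0n // mul1r ltr_nat ltn_mod.
Qed.

(** Orthogonality of the characters of Z/t. *)
Lemma sum_uc (n t : nat) : (0 < t)%N ->
  \sum_(0 <= s < t) uc (n%:R / t%:R) ^+ s = if (t %| n)%N then t%:R else 0.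
Proof.
move=> t0; case: ifPn => h.
  have /eqP -> : uc (n%:R / t%:R) == 1 by rewrite uc_eq1.
  by under eq_bigr do rewrite expr1n; rewrite sumr_const_nat subn0.
have u1 : uc (n%:R / t%:R) - 1 != 0 by rewrite subr_eq0 uc_eq1.
apply: (mulfI u1); rewrite mulr0 big_mkord -subrX1 ucX.
by rewrite mulrC divfK ?uc_nat ?subrr // pnatr_eq0 -lt0n.
Qed.

(** The sawtooth y - 1/2 in the argument of 1 - e^(2 pi i y) is where the Dedekind
    sums come from. *)
Lemma clog1m_uc y : 0 < y < 1 ->
  clog1m (uc y) = ln (nc (1 - uc y)) +i* (pi * (y - 2^-1)).
Proof.
move=> h; have s0 := sin_piM_gt0 h; rewrite /clog1m Re_1m_uc; congr (_ +i* _).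
have -> : complex.Im (1 - uc y) = - (2 * sin (pi * y) * cos (pi * y)).
  rewrite ImD ImN Im_uc /= (_ : 2 * pi * y = (pi * y) *+ 2); last by rewrite -mulr_natl; ring.
  by rewrite sin_mulr2n -mulr_natl; ring.
have -> : - (2 * sin (pi * y) * cos (pi * y)) / (2 * sin (pi * y) ^+ 2) =
    tan (pi * (y - 2^-1)).
  rewrite /tan mulrBr -/(pi / 2) sinBpihalf cosBpihalf; field; exact: lt0r_neq0.
have p0 := pi_gt0 R; move: h => /andP[y0 y1].
by rewrite tanK // in_itv /=; apply/andP; split; nra.
Qed.

Lemma nc_1m_ucN y : nc (1 - uc (- y)) = nc (1 - uc y).
Proof.
by rewrite !nc_sqrE !(ReD, ReN, ImD, ImN, Re_uc, Im_uc) /= mulrN cosN sinN !sub0r sqrrN.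
Qed.

End Products.

(** * Upper bounds away from the dominant cusps *)

Section MinorArcs.
Variable R : realType.
Local Open Scope complex_scope.
Implicit Types (q z w : R[i]) (x y phi : R).

(** Telescoping: (k+1)^-2 <= 1/k - 1/(k+1). *)
Lemma inv_sq_sum_le n : \sum_(0 <= k < n.+1) (k.+1%:R^-1 : R) ^+ 2 <= 2 - n.+1%:R^-1.
Proof.
elim: n => [|n IH]; first by rewrite big_nat1 invr1; lra.
rewrite big_nat_recr //= -[n.+2%:R]natr1.
have a0 : 0 < n.+1%:R :> R by rewrite ltr0n.
move: IH; set a := n.+1%:R in a0 * => IH.
apply: le_trans (lerD IH (lexx _)) _.
have -> : a^-1 = (a + 1)^-1 + a^-1 * (a + 1)^-1.
  by field; rewrite !lt0r_neq0 // addr_gt0.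
have h : (a + 1)^-1 ^+ 2 <= a^-1 * (a + 1)^-1.
  rewrite expr2; apply: ler_wpM2r; first by rewrite invr_ge0; lra.
  by rewrite lef_pV2 ?posrE //; lra.
by move: h; set A2 := _ ^+ 2; set B := _ / _; lra.
Qed.

Definition zeta2 : R := limn (series (fun k => (k.+1%:R^-1 : R) ^+ 2)).

Lemma is_cvg_inv_sq : cvgn (series (fun k => (k.+1%:R^-1 : R) ^+ 2)).
Proof.
apply: nondecreasing_is_cvgn.
  by apply/nondecreasing_seqP => n; rewrite /series /= big_nat_recr //= lerDl sqr_ge0.
exists 2 => _ [n _ <-]; apply: le_trans (_ : series (fun k => (k.+1%:R^-1 : R) ^+ 2) n.+1 <= _).
  by rewrite /series /= big_nat_recr //= lerDl sqr_ge0.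
by apply: le_trans (inv_sq_sum_le n) _; rewrite gerBl invr_ge0.
Qed.

Lemma natV_C n : (n%:R^-1 : R[i]) = (n%:R^-1 : R)%:C.
Proof. by rewrite fmorphV rmorph_nat. Qed.

Lemma csums_zeta2 : csums (fun k => (k.+1%:R^-1 : R[i]) ^+ 2) zeta2%:C.
Proof.
apply: csums_cvg.
  rewrite (_ : (fun k => _) = (fun k => (k.+1%:R^-1 : R) ^+ 2)); first exact: is_cvg_inv_sq.
  by apply/funext => k; rewrite natV_C -rmorphXn.
rewrite (_ : series _ = fun _ => 0); first exact: cvg_cst.
apply/funext => n; rewrite /series /= big1_seq // => k _.
by rewrite natV_C -rmorphXn.
Qed.

Lemma zeta2_gt0 : 0 < zeta2.
Proof.
apply: lt_le_trans (_ : series (fun k => (k.+1%:R^-1 : R) ^+ 2) 1 <= _).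
  by rewrite /series /= big_nat1 invr1 expr1n.
apply: nondecreasing_cvgn_le; last exact: is_cvg_inv_sq.
by apply/nondecreasing_seqP => n; rewrite /series /= big_nat_recr //= lerDl sqr_ge0.
Qed.

Lemma Re_lamE q : q != 1 ->
  complex.Re (lam q) = (1 - nc q ^+ 2) / (2 * nc (1 - q) ^+ 2) - 2^-1.
Proof.
move=> q1; have n0 : nc (1 - q) ^+ 2 != 0 by rewrite expf_neq0 // nc_eq0 subr_eq0 eq_sym.
move: n0; rewrite /lam ReM ReV ImV !nc_sqr !(ReD, ReN, ImD, ImN) /= => n0.
by rewrite sub0r in n0; field.
Qed.

(** By Re_lamE the real part of lam is smallest, for a given modulus r, at -r,
    where it equals -r / (1 + r). *)
Lemma Re_lam_ge q : nc q < 1 -> - complex.Re (lam q) <= nc q.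
Proof.
move=> q1; have q1' : q != 1 by apply: contraTneq q1 => ->; rewrite nc1 ltxx.
rewrite Re_lamE //; have r0 := nc_ge0 q; set r := nc q in q1 r0 *.
have n0 : 0 < nc (1 - q) by rewrite nc_gt0 subr_eq0 eq_sym.
have n1 : nc (1 - q) <= 1 + r by apply: le_trans (ncB _ _) _; rewrite nc1.
set n := nc _ in n0 n1 *.
have h : (1 - r) / (2 * (1 + r)) <= (1 - r ^+ 2) / (2 * n ^+ 2).
  rewrite ler_pdivrMr ?mulr_gt0 //; last by lra.
  rewrite mulrAC ler_pdivlMr ?mulr_gt0 ?exprn_gt0 //.
  by rewrite -subr_ge0 (_ : _ - _ = 2 * (1 - r) * ((1 + r) ^+ 2 - n ^+ 2));
    [rewrite subr_sqr; apply: mulr_ge0; nra|ring].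
have h2 : 2^-1 - r <= (1 - r) / (2 * (1 + r)) by rewrite ler_pdivlMr; nra.
lra.
Qed.

Lemma expRN_bounds y : 0 < y <= 1 -> 1 - y <= expR (- y) <= 1 - y / 2.
Proof.
move=> /andP[y0 y1]; apply/andP; split; first by apply: le_trans (expR_ge1Dx _); lra.
rewrite expRN; have h := expR_ge1Dx y.
apply: (@le_trans _ _ (1 + y)^-1); first by rewrite lef_pV2 ?posrE ?expR_gt0 //; lra.
by rewrite -[leLHS]mul1r ler_pdivrMr; [nra|lra].
Qed.

(** The terms lam(q^k)/k with k = t j are 1/t times the terms lam(q^(tj))/j, so
    both kinds merge and L = (1 - 1/t) T - U, where U runs over the k not
    divisible by t. Upper bounds for T and lower bounds for U then make
    L small. *)
Lemma lterm_decomp (t : nat) q L : (0 < t)%N -> nc q < 1 -> csums (lterm t q) L ->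
  exists T U : R[i], [/\ csums (fun k => lam ((q ^+ t) ^+ k.+1) / k.+1%:R) T,
   csums (fun k => if (t %| k.+1)%N then 0 else lam (q ^+ k.+1) / k.+1%:R) U &
   L = (1 - t%:R^-1) * T - U].
Proof.
move=> t0 q1 hL; have [S hS] := csums_lam q1.
have qt1 : nc (q ^+ t) < 1 by rewrite ncX exprn_ilt1 ?nc_ge0 // -lt0n.
have [T hT] := csums_lam qt1.
have LE : L = T - S.
  apply: clim_unique hL _; apply: eq_csums (csumsB hT hS) => k.
  by rewrite /lterm mulrBl.
have tn0 : t%:R != 0 :> R[i] by rewrite pnatr_eq0 -lt0n.
have hU := csumsB hS (csumsZ t%:R^-1 (csums_multiples t0 hT)).
exists T, (S - t%:R^-1 * T); split => //; last by rewrite LE; ring.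
apply: eq_csums hU => k /=; case: ifPn => [/dvdnP[[|j] kE]|_]; last by rewrite mulr0 subr0.
  by rewrite mul0n in kE.
rewrite kE mulnK //= -exprM mulnC natrM.
have : j.+1%:R != 0 :> R[i] by rewrite pnatr_eq0.
by move: (j.+1%:R) => J J0; field; rewrite tn0 J0.
Qed.

(** Each term of T is at most 1 / (t x k^2), since lam(e^(-y)) <= 1/y; the sum
    gives zeta(2) / (t x). What the first term loses is kept. *)
Lemma Re_T_le (t : nat) q x T : (0 < t)%N -> 0 < x -> nc q = expR (- x) ->
  csums (fun k => lam ((q ^+ t) ^+ k.+1) / k.+1%:R) T ->
  complex.Re T <= zeta2 / (t%:R * x) - ((t%:R * x)^-1 - complex.Re (lam (q ^+ t))).
Proof.
move=> t0 x0 qE hT; have tn0 : 0 < t%:R :> R by rewrite ltr0n.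
have tx0 : 0 < t%:R * x by rewrite mulr_gt0.
have hZ := csumsZ ((t%:R * x)^-1)%:C csums_zeta2.
have hle k : complex.Re (lam ((q ^+ t) ^+ k.+1) / k.+1%:R) <=
    complex.Re (((t%:R * x)^-1)%:C * (k.+1%:R^-1) ^+ 2).
  have k0 : 0 < k.+1%:R :> R by rewrite ltr0n.
  have -> : complex.Re (((t%:R * x)^-1)%:C * (k.+1%:R^-1) ^+ 2) =
      (k.+1%:R * (t%:R * x))^-1 * k.+1%:R^-1.
    by rewrite natV_C -rmorphXn -rmorphM /= [in RHS]invfM; ring.
  rewrite natV_C ReM /= mulr0 subr0 ler_wpM2r ?invr_ge0 //.
  apply: le_trans (Re_le _) _; set w := (_ ^+ k.+1).
  have wE : nc w = expR (- (k.+1%:R * (t%:R * x))).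
    by rewrite /w !ncX qE -!expRM_natl; congr expR; ring.
  have y0 : 0 < k.+1%:R * (t%:R * x) by rewrite mulr_gt0.
  set y := k.+1%:R * _ in wE y0 *.
  have w1 : nc w < 1 by rewrite wE expR_lt1; lra.
  have := @nc_lam _ w 0 w1; rewrite expr1 => /le_trans; apply.
  rewrite wE expRN; have e1 := expR_ge1Dx y; have e0 := expR_gt0 y.
  rewrite -[leRHS]mul1r ler_pdivlMr // mulrAC ler_pdivrMr ?mul1r; last first.
    by rewrite subr_gt0 invf_lt1 //; lra.
  rewrite ler_pdivrMl // mulrBr mulr1 mulfV ?lt0r_neq0 //; lra.
have := csums_Re_gain 0 hT hZ hle; rewrite !expr1 invr1 expr1n mulr1 -[in X in _ <= X]rmorphM /=.
by rewrite mulr1 (mulrC zeta2); lra.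
Qed.

(** Since Re lam(w) >= - |w|, the sum U is bounded below by ln (1 - e^(-x)), a
    mere logarithm; what the term of index b gains is kept. *)
Lemma Re_U_ge (t : nat) q x U b : 0 < x -> nc q = expR (- x) ->
  csums (fun k => if (t %| k.+1)%N then 0 else lam (q ^+ k.+1) / k.+1%:R) U ->
  ~~ (t %| b.+1)%N ->
  - complex.Re U <= - ln (1 - expR (- x)) -
     (expR (- x) ^+ b.+1 + complex.Re (lam (q ^+ b.+1))) / b.+1%:R.
Proof.
move=> x0 qE hU hb; set r := expR (- x) in qE *.
have r0 : 0 < r by exact: expR_gt0.
have r1 : r < 1 by rewrite expR_lt1; lra.
have nr : nc r%:C = r by rewrite ncR ger0_norm // ltW.
have hlog : csums (fun k => r%:C ^+ k.+1 / k.+1%:R) (- clog1m r%:C).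
  by apply: csums_clog1m; rewrite nr.
have hN := csumsZ (-1) hU.
have hv k : complex.Re (r%:C ^+ k.+1 / k.+1%:R) = r ^+ k.+1 / k.+1%:R.
  by rewrite natV_C -rmorphXn -rmorphM.
have hu k : complex.Re (-1 * (lam (q ^+ k.+1) / k.+1%:R)) = - complex.Re (lam (q ^+ k.+1)) / k.+1%:R.
  by rewrite natV_C mulN1r ReN ReM /= mulr0 subr0 mulNr.
have hle k : complex.Re (-1 * (if (t %| k.+1)%N then 0 else lam (q ^+ k.+1) / k.+1%:R)) <=
    complex.Re (r%:C ^+ k.+1 / k.+1%:R).
  rewrite hv; case: ifP => _.
    by rewrite mulr0 /= divr_ge0 // exprn_ge0 // ltW.
  rewrite hu ler_wpM2r ?invr_ge0 //.
  by rewrite -qE -ncX; apply: Re_lam_ge; rewrite ncX qE exprn_ilt1 ?ltW.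
have := csums_Re_gain b hN hlog hle.
rewrite (negbTE hb) hu hv mulN1r !ReN.
have -> : complex.Re (clog1m r%:C) = ln (1 - r).
  rewrite /clog1m (_ : 1 - r%:C = (1 - r)%:C); last by rewrite rmorphB.
  by rewrite ncR ger0_norm // subr_ge0 ltW.
rewrite mulNr mulrDl.
by move: (complex.Re U) (r ^+ _ / _) (complex.Re _ / _) (ln _) => u v w l; lra.
Qed.

(** The point e^(2 pi i h / t - z) with z = x - i phi: e^(-x) is the modulus
    and phi the angle from the root of unity. *)
Definition arcpt (t h : nat) x phi : R[i] := uc (h%:R / t%:R) * cexp (- (x -i* phi)).

Lemma nc_arcpt t h x phi : nc (arcpt t h x phi) = expR (- x).
Proof. by rewrite ncM nc_uc mul1r nc_cexp. Qed.

Lemma arcptX (t h : nat) x phi n : (0 < t)%N -> (t %| n * h)%N ->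
  arcpt t h x phi ^+ n = cexp (- (n%:R * x -i* (n%:R * phi))).
Proof.
move=> t0 hn; rewrite exprMn ucX mulrA -natrM.
have /eqP -> : uc ((n * h)%:R / t%:R) == 1 :> R[i] by rewrite uc_eq1.
rewrite mul1r -cexp_natM; congr cexp.
by apply: eqC; rewrite ?Re_natM ?Im_natM /=; ring.
Qed.

Lemma nc_sqr_1m_cexp y theta : nc (1 - cexp (- (y -i* theta))) ^+ 2 =
  (1 - expR (- y)) ^+ 2 + 2 * expR (- y) * (1 - cos theta).
Proof.
rewrite nc_sqr !(ReD, ReN, ImD, ImN) Re_cexp Im_cexp /= opprK sub0r sqrrN exprMn.
rewrite sin2cos2; ring.
Qed.

(** The coefficient of 1/z in the logarithm of the generating function at the
    roots of unity of order exactly t. *)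
Definition growth (t : nat) : R := zeta2 * (1 - t%:R^-1) / t%:R.

(** When phi is large compared with x, q^t is far from 1 and the first term of T
    is at most half of what Re_T_le allows for it. *)
Lemma minor_far (t h : nat) x phi L : (1 < t)%N -> 0 < x -> t%:R * x <= 1 / 2 ->
  `|t%:R * phi| <= pi -> 16 * x <= `|phi| ->
  csums (lterm t (arcpt t h x phi)) L ->
  complex.Re L <= (growth t - (4 * t%:R)^-1) / x + 1 - ln (1 - expR (- x)).
Proof.
move=> t1 x0 tx hpi hphi; have t0 : (0 < t)%N by lia.
set q := arcpt _ _ _ _ => hL; have qE : nc q = expR (- x) by exact: nc_arcpt.
have q1 : nc q < 1 by rewrite qE expR_lt1; lra.
have [T [U [hT hU ->]]] := lterm_decomp t0 q1 hL.
have T1 := Re_T_le t0 x0 qE hT.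
have U1 : - complex.Re U <= - ln (1 - expR (- x)).
  have := @Re_U_ge t q x U 0 x0 qE hU; rewrite dvdn1 expr1 invr1 mulr1 -qE.
  move=> /(_ _); have := Re_lam_ge q1; have -> : t != 1%N by lia.
  by move=> ? /(_ isT); lra.
have tn0 : 0 < t%:R :> R by rewrite ltr0n.
have tx0 : 0 < t%:R * x by rewrite mulr_gt0.
have lamt : complex.Re (lam (q ^+ t)) <= (2 * (t%:R * x))^-1.
  have qt1 : nc (q ^+ t) < 1 by rewrite ncX exprn_ilt1 ?nc_ge0 // -lt0n.
  apply: le_trans (Re_le _) _; rewrite /lam ncM ncV.
  have n2 : 2 * (t%:R * x) <= nc (1 - q ^+ t).
    rewrite -(@ler_pXn2r _ 2) ?nnegrE ?nc_ge0 //; last by rewrite mulr_ge0 // ltW.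
    rewrite /q arcptX ?dvdn_mulr // nc_sqr_1m_cexp.
    (* 16 is chosen for this: |1 - q^t|^2 >= 9/512 (16 t x)^2 = 4.5 (t x)^2,
    which exceeds (2 t x)^2. *)
    have c1 := cosB1_ge hpi.
    have e1 : 1 / 2 <= expR (- (t%:R * x)) by apply: le_trans (expR_ge1Dx _); lra.
    have p2 : (16 * (t%:R * x)) ^+ 2 <= (t%:R * phi) ^+ 2.
      rewrite -[leRHS]real_normK ?num_real // lerXn2r ?nnegrE //; first by rewrite mulr_ge0 // ltW.
      by rewrite normrM (ger0_norm (ltW tn0)) mulrCA ler_wpM2l // ltW.
    move: c1 e1 p2; set c := 1 - cos _; set e := expR _; set p := (t%:R * phi) ^+ 2 => c1 e1 p2.
    have c0 : 0 <= c by have := sqr_ge0 (t%:R * phi); rewrite -/p; lra.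
    have e2 : 0 <= e - 1 / 2 by lra.
    have := sqr_ge0 (1 - e); have := mulr_ge0 e2 c0.
    move: p2; rewrite !exprMn; have : 0 <= t%:R ^+ 2 * x ^+ 2 by rewrite mulr_ge0 ?sqr_ge0.
    by set X := t%:R ^+ 2 * x ^+ 2; lra.
  have n0 : 0 < nc (1 - q ^+ t) by apply: lt_le_trans n2; rewrite mulr_gt0.
  apply: (@le_trans _ _ (nc (1 - q ^+ t))^-1).
    by rewrite ler_piMl ?invr_ge0 ?nc_ge0 // ltW.
  by rewrite lef_pV2 ?posrE // mulr_gt0.
have -> : complex.Re ((1 - t%:R^-1) * T - U) = (1 - t%:R^-1) * complex.Re T - complex.Re U.
  rewrite ReD ReN natV_C (_ : 1 - (t%:R^-1)%:C = (1 - t%:R^-1)%:C); last by rewrite rmorphB.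
  by rewrite ReM /= mul0r subr0.
have ht : 1 / 2 <= 1 - t%:R^-1 :> R.
  have : t%:R^-1 <= 2^-1 :> R by rewrite lef_pV2 ?posrE // ler_nat.
  by lra.
have T2 : complex.Re T <= (zeta2 - 1 / 2) / (t%:R * x).
  by apply: le_trans T1 _; move: lamt; rewrite invfM mulrBl mul1r; lra.
have T3 : (1 - t%:R^-1) * complex.Re T <= (growth t - (4 * t%:R)^-1) / x.
  apply: (@le_trans _ _ ((1 - t%:R^-1) * ((zeta2 - 1 / 2) / (t%:R * x)))).
    by rewrite ler_wpM2l //; lra.
  have -> : (growth t - (4 * t%:R)^-1) / x = ((zeta2 * (1 - t%:R^-1)) - 1 / 4) / (t%:R * x).
    by rewrite /growth; field; rewrite !lt0r_neq0.
  by rewrite mulrA ler_wpM2r ?invr_ge0 ?(ltW tx0) //; lra.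
lra.
Qed.

(** If h is not prime to t, some power q^b with 0 < b < t is close to 1 like q^t,
    so that lam(q^b) is of size 1/x with positive real part; it enters L with a
    minus sign through U. *)
Lemma minor_noncoprime (t h : nat) x phi L : (1 < t)%N -> 0 < x -> 17 * (t%:R * x) <= 1 / 10 ->
  `|phi| <= 16 * x -> ~~ coprime h t ->
  csums (lterm t (arcpt t h x phi)) L ->
  complex.Re L <= (growth t - ((100 * t%:R) ^+ 2)^-1) / x + 1 - ln (1 - expR (- x)).
Proof.
move=> t1 x0 tx hphi hcop; have t0 : (0 < t)%N by lia.
set q := arcpt _ _ _ _ => hL; have qE : nc q = expR (- x) by exact: nc_arcpt.
have q1 : nc q < 1 by rewrite qE expR_lt1; lra.
have [T [U [hT hU ->]]] := lterm_decomp t0 q1 hL.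
have tn0 : 0 < t%:R :> R by rewrite ltr0n.
have tx0 : 0 < t%:R * x by rewrite mulr_gt0.
have T1 : complex.Re T <= zeta2 / (t%:R * x).
  apply: le_trans (Re_T_le t0 x0 qE hT) _.
  rewrite gerBl subr_ge0.
  have qt1 : nc (q ^+ t) < 1 by rewrite ncX exprn_ilt1 ?nc_ge0 // -lt0n.
  apply: le_trans (Re_le _) _; have := @nc_lam _ (q ^+ t) 0 qt1; rewrite expr1 => /le_trans; apply.
  rewrite ncX qE -expRM_natl mulrN expRN; set y := t%:R * x in tx0 *.
  have e1 := expR_ge1Dx y; have e0 := expR_gt0 y.
  rewrite -[leRHS]mul1r ler_pdivlMr // mulrAC ler_pdivrMr ?mul1r; last first.
    by rewrite subr_gt0 invf_lt1 //; lra.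
  rewrite ler_pdivrMl // mulrBr mulr1 mulfV ?lt0r_neq0 //; lra.
have [b [b0 bt tb]] : exists b, [/\ (0 < b)%N, (b < t)%N & (t %| b * h)%N].
  exists (t %/ gcdn h t)%N; have g0 : (0 < gcdn h t)%N by rewrite gcdn_gt0 t0 orbT.
  split.
  - by rewrite divn_gt0 // dvdn_leq // dvdn_gcdr.
  - apply: ltn_Pdiv => //; move: hcop; rewrite /coprime; lia.
  - by rewrite divn_mulAC ?dvdn_gcdr // -muln_divA ?dvdn_gcdl // dvdn_mulr.
case: b => // b in b0 bt tb *.
have tb' : ~~ (t %| b.+1)%N by apply/negP => /dvdn_leq; lia.
have U1 := Re_U_ge x0 qE hU tb'.
have bn0 : 0 < b.+1%:R :> R by rewrite ltr0n.
have bx0 : 0 < b.+1%:R * x by rewrite mulr_gt0.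
have btn : b.+1%:R <= t%:R :> R by rewrite ler_nat ltnW.
have btx : b.+1%:R * x <= t%:R * x by rewrite ler_wpM2r // ltW.
have lamb : (68 ^+ 2 * (b.+1%:R * x))^-1 - 1 / 2 <= complex.Re (lam (q ^+ b.+1)).
  have qb1 : nc (q ^+ b.+1) < 1 by rewrite ncX exprn_ilt1 ?nc_ge0.
  rewrite Re_lamE; last by apply: contraTneq qb1 => ->; rewrite nc1 ltxx.
  rewrite mul1r lerB //.
  have d0 : 0 < nc (1 - q ^+ b.+1) by have := X1m_neq0 b q1; rewrite -nc_gt0.
  (* In the cone |phi| <= 16 x one has |z| <= 17 x. *)
  have d1 : nc (1 - q ^+ b.+1) <= 34 * (b.+1%:R * x).
    rewrite /q arcptX // ncBC.
    have nb : nc (- (b.+1%:R * x -i* (b.+1%:R * phi))) <= 17 * (b.+1%:R * x).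
      rewrite ncN; apply: le_trans (nc_le _) _; rewrite /= normrN !normrM.
      rewrite (ger0_norm (ltW bn0)) (ger0_norm (ltW x0)).
      have := ler_wpM2l (ltW bn0) hphi; lra.
    by apply: le_trans (nc_cexpB1 _) _; lra.
  have d2 : nc (1 - q ^+ b.+1) ^+ 2 <= (34 * (b.+1%:R * x)) ^+ 2.
    by rewrite lerXn2r ?nnegrE ?nc_ge0 // mulr_ge0 // ltW.
  have r2 : b.+1%:R * x / 2 <= 1 - nc (q ^+ b.+1) ^+ 2.
    have /andP[_ h1] : 1 - b.+1%:R * x <= expR (- (b.+1%:R * x)) <= 1 - b.+1%:R * x / 2.
      by apply: expRN_bounds; rewrite bx0 /=; lra.
    have rE : nc (q ^+ b.+1) = expR (- (b.+1%:R * x)).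
      by rewrite ncX qE -expRM_natl mulrN.
    rewrite rE; rewrite rE in qb1; have e0 := expR_gt0 (- (b.+1%:R * x)).
    by move: h1 qb1 e0; set e := expR _ => h1 qb1 e0; nra.
  rewrite ler_pdivlMr ?mulr_gt0 ?exprn_gt0 //; apply: le_trans r2.
  apply: (@le_trans _ _ ((68 ^+ 2 * (b.+1%:R * x))^-1 * (2 * (34 * (b.+1%:R * x)) ^+ 2))).
    apply: ler_wpM2l; last by rewrite ler_pM2l.
    by rewrite invr_ge0 mulr_ge0 ?sqr_ge0 ?(ltW bx0).
  rewrite le_eqVlt; apply/orP; left; apply/eqP; field.
  by rewrite !lt0r_neq0.
have -> : complex.Re ((1 - t%:R^-1) * T - U) = (1 - t%:R^-1) * complex.Re T - complex.Re U.
  rewrite ReD ReN natV_C (_ : 1 - (t%:R^-1)%:C = (1 - t%:R^-1)%:C); last by rewrite rmorphB.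
  by rewrite ReM /= mul0r subr0.
have T3 : (1 - t%:R^-1) * complex.Re T <= growth t / x.
  have -> : growth t / x = (1 - t%:R^-1) * (zeta2 / (t%:R * x)).
    by rewrite /growth; field; rewrite !lt0r_neq0.
  rewrite ler_wpM2l // subr_ge0 invf_le1 // ler1n //.
have G : ((100 * t%:R) ^+ 2)^-1 / x - 1 <=
   (expR (- x) ^+ b.+1 + complex.Re (lam (q ^+ b.+1))) / b.+1%:R.
  apply: (@le_trans _ _ (((68 ^+ 2 * (b.+1%:R * x))^-1 - 1 / 2) / b.+1%:R)); last first.
    rewrite ler_wpM2r ?invr_ge0 //; have : 0 <= expR (- x) ^+ b.+1 by rewrite exprn_ge0 // expR_ge0.
    by move=> e0; rewrite -[leLHS]add0r; exact: lerD.
  rewrite mulrBl lerB //; last first.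
    by rewrite ler_pdivrMr // mul1r; have : 1 <= b.+1%:R :> R by [rewrite ler1n]; lra.
  rewrite -!invfM lef_pV2 ?posrE; last 2 first.
  - by rewrite mulr_gt0 ?exprn_gt0 ?mulr_gt0.
  - by rewrite mulr_gt0 // mulr_gt0 // exprn_gt0.
  rewrite (_ : 68 ^+ 2 * (b.+1%:R * x) * b.+1%:R = (68 * b.+1%:R) ^+ 2 * x); last by ring.
  rewrite ler_wpM2r ?(ltW x0) // lerXn2r ?nnegrE ?mulr_ge0 ?(ltW bn0) ?(ltW tn0) //.
  by have := ltW bn0; lra.
rewrite [X in _ <= X + 1 - _]mulrBl; move: G T3 U1.
move: (complex.Re U) (_ * complex.Re T) (growth t / x) (_^-1 / x) (ln _) => u v g w l.
by move: (_ / b.+1%:R) => s; lra.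
Qed.

End MinorArcs.

(** * The remainder of the Laurent expansion, summed by parts *)

Section Remainder.
Variable R : realType.
Local Open Scope complex_scope.
Implicit Types (z w xi : R[i]) (x y : R) (s t : nat).

(** Minus the first Bernoulli polynomial at s/t, which is the constant term at
    w = 0 of e^(-s w) / (1 - e^(-t w)). *)
Definition bern s t : R := 2^-1 - s%:R / t%:R.

Lemma bern_le s t : (0 < t)%N -> (s <= t)%N -> `|bern s t| <= 1.
Proof.
move=> t0 st; have t0' : 0 < t%:R :> R by rewrite ltr0n.
have h1 : 0 <= s%:R / t%:R :> R by rewrite divr_ge0.
have h2 : s%:R / t%:R <= 1 :> R by rewrite ler_pdivrMr // mul1r ler_nat.
by rewrite /bern ler_norml; move: h1 h2; set y := _ / _; lra.
Qed.

(** What remains of e^(-s w) / (1 - e^(-t w)) after its pole and its constant term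
    at w = 0. The constant is multiplied by e^(-w) so that, with w = k z and
    weights xi^k / k, it sums to a logarithm. *)
Definition rem s t w : R[i] := cexp (- (s%:R * w)) / (1 - cexp (- (t%:R * w)))
   - (t%:R * w)^-1 - (bern s t)%:C * cexp (- w).

Lemma nc_natM n w : nc (n%:R * w) = n%:R * nc w.
Proof. by rewrite ncM nc_nat. Qed.

(** The three parts have the common denominator t w (1 - e^(-t w)), of order two at
    w = 0, and the numerator vanishes to order three there. *)
Lemma rem_near s t w : (0 < t)%N -> (s <= t)%N -> 0 < nc w -> t%:R * nc w <= 1 / 10 ->
  nc (rem s t w) <= 84 * t%:R * nc w.
Proof.
move=> t0 st w0 tw; have T1 : 1 <= t%:R :> R by rewrite ler1n.
have T0 : 0 < t%:R :> R by rewrite ltr0n.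
have ST : s%:R <= t%:R :> R by rewrite ler_nat.
have S0 : 0 <= s%:R :> R by [].
have b1 := bern_le t0 st.
set n := nc w in w0 tw *; set T : R := t%:R in T1 T0 ST tw *; set S : R := s%:R in ST S0.
have n1 : n <= 1 / 10 by nra.
set r1 := cexp (- (s%:R * w)) - 1 - - (s%:R * w).
have hr1 : nc r1 <= 4 * (S * n) ^+ 2.
  have := @nc_cexpB2 R (- (s%:R * w)); rewrite ncN nc_natM -/n -/S; apply.
  by apply: le_trans tw; rewrite ler_wpM2r // ltW.
set r2 := cexp (- (t%:R * w)) - (1 + - (t%:R * w) + (- (t%:R * w)) ^+ 2 / 2).
have hr2 : nc r2 <= 30 * (T * n) ^+ 3.
  have := @nc_cexp_taylor R (- (t%:R * w)); rewrite ncN nc_natM -/n -/T; apply; lra.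
set r3 := cexp (- w) - 1.
have hr3 : nc r3 <= 2 * n by have := @nc_cexpB1 R (- w); rewrite ncN -/n; apply.
set r4 := 1 - cexp (- (t%:R * w)) - t%:R * w.
have hr4 : nc r4 <= 4 * (T * n) ^+ 2.
  have := @nc_cexpB2 R (- (t%:R * w)); rewrite ncN nc_natM -/n -/T => /(_ tw).
  by rewrite -ncN /r4; congr (nc _ <= _); ring.
have Tn0 : 0 < T * n by rewrite mulr_gt0.
have D0 : T * n / 2 <= nc (1 - cexp (- (t%:R * w))).
  have := ncBr (t%:R * w) (- r4); rewrite ncN nc_natM -/n -/T opprK.
  rewrite (_ : _ + r4 = 1 - cexp (- (t%:R * w))); last by rewrite /r4; ring.
  by move: hr4; set m := nc r4; set d := nc _; nra.
have w0' : w != 0 by rewrite -nc_gt0.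
have d0 : 1 - cexp (- (t%:R * w)) != 0.
  by rewrite -nc_gt0; apply: lt_le_trans D0; rewrite divr_gt0.
have tn0 : t%:R != 0 :> R[i] by rewrite pnatr_eq0 -lt0n.
set b := (bern s t)%:C.
have bE : b * t%:R = t%:R / 2 - s%:R.
  rewrite /b /bern rmorphB rmorphM /= !fmorphV !rmorph_nat; field.
  exact: tn0.
have -> : rem s t w = (t%:R * w * r1 + r2 - b * (t%:R * w) * (r3 * (t%:R * w + r4) + r4)) /
    (t%:R * w * (1 - cexp (- (t%:R * w)))).
  have bE' : b = 2^-1 - s%:R / t%:R.
    by rewrite /b /bern rmorphB rmorphM /= !fmorphV !rmorph_nat.
  rewrite /rem -/b bE' /r1 /r2 /r3 /r4.
  by field; rewrite d0 w0' tn0.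
rewrite ncM ncV ncM nc_natM -/n -/T ler_pdivrMr; last first.
  by rewrite mulr_gt0 //; apply: lt_le_trans D0; rewrite divr_gt0.
have nb : nc b <= 1 by rewrite ncR.
apply: (@le_trans _ _ (42 * (T * n) ^+ 3)); last first.
  rewrite (_ : 42 * (T * n) ^+ 3 = 84 * T * n * (T * n * (T * n / 2))); last by field.
  by rewrite ler_wpM2l ?ler_wpM2l ?mulr_ge0 // ltW.
have Sn : (S * n) ^+ 2 <= (T * n) ^+ 2.
  by rewrite lerXn2r ?nnegrE ?mulr_ge0 ?ler_wpM2r // ltW.
have u1 : nc (t%:R * w * r1) <= 4 * (T * n) ^+ 3.
  rewrite ncM nc_natM -/n -/T (exprS (T * n)) mulrCA ler_wpM2l ?(ltW Tn0) //; lra.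
have u2 : nc (r3 * (t%:R * w + r4) + r4) <= 8 * (T * n) ^+ 2.
  apply: le_trans (ncD _ _) _; rewrite ncM.
  have h := ncD (t%:R * w) r4; rewrite nc_natM -/n -/T in h.
  have h' : nc (t%:R * w + r4) <= 2 * (T * n).
    by apply: le_trans h _; move: hr4; set m := nc r4; set X := T * n in Tn0 tw *; nra.
  have h3 : nc r3 <= 2 * (T * n) by apply: le_trans hr3 _; rewrite ler_pM2l // ler_peMl // ltW.
  have := ler_pM (nc_ge0 r3) (nc_ge0 _) h3 h'; move: hr4; set X := T * n.
  by move: (nc r3 * _) (nc r4) => u v; rewrite expr2; lra.
have u3 : nc (b * (t%:R * w) * (r3 * (t%:R * w + r4) + r4)) <= 8 * (T * n) ^+ 3.
  rewrite ncM ncM nc_natM -/n -/T.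
  apply: (@le_trans _ _ (1 * (T * n) * (8 * (T * n) ^+ 2))).
    by apply: ler_pM => //; rewrite ?mulr_ge0 ?nc_ge0 ?(ltW Tn0) // ler_wpM2r // ltW.
  by rewrite le_eqVlt; apply/orP; left; apply/eqP; ring.
apply: le_trans (ncB _ _) _; have := ncD (t%:R * w * r1) r2.
by move: u1 hr2 u3; move: (nc _) (nc _) (nc _) (nc _) => a1 a2 a3 a4; lra.
Qed.

Lemma nc_1m_cexp_ge (eta : R) z : 0 < eta -> eta <= complex.Re z ->
  1 - expR (- eta) <= nc (1 - cexp (- z)).
Proof.
move=> e0 ez; apply: le_trans (ncBr _ _); rewrite nc1 nc_cexp ReN lerD2l lerN2.
by rewrite ler_expR lerN2.
Qed.

Lemma rem_far s t w (eta : R) : (0 < t)%N -> (s <= t)%N -> 0 < eta ->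
  eta <= complex.Re w -> nc (rem s t w) <= (1 - expR (- eta))^-1 + eta^-1 + 1.
Proof.
move=> t0 st e0 ew; have T1 : 1 <= t%:R :> R by rewrite ler1n.
have T0 : 0 < t%:R :> R by rewrite ltr0n.
have w0 : 0 < complex.Re w by apply: lt_le_trans ew.
have e1 : 0 < 1 - expR (- eta) by rewrite subr_gt0 expR_lt1; lra.
have etw : eta <= complex.Re (t%:R * w).
  by rewrite Re_natM; apply: le_trans ew _; rewrite ler_peMl // ltW.
have h1 : nc (cexp (- (s%:R * w)) / (1 - cexp (- (t%:R * w)))) <= (1 - expR (- eta))^-1.
  rewrite ncM ncV -[leRHS]mul1r; apply: ler_pM; rewrite ?nc_ge0 ?invr_ge0 ?nc_ge0 //.
    by rewrite nc_cexp ReN Re_natM expR_le1 oppr_le0 mulr_ge0 // ltW.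
  have h := nc_1m_cexp_ge e0 etw; rewrite lef_pV2 ?posrE //.
  exact: lt_le_trans h.
have h2 : nc (t%:R * w)^-1 <= eta^-1.
  have := Re_le (t%:R * w) => h; rewrite ncV lef_pV2 ?posrE //; first exact: le_trans h.
  by apply: lt_le_trans h; apply: lt_le_trans etw.
have h3 : nc ((bern s t)%:C * cexp (- w)) <= 1.
  rewrite ncM ncR nc_cexp ReN -[leRHS]mul1r; apply: ler_pM; rewrite ?expR_ge0 //.
    exact: bern_le.
  by rewrite expR_le1 oppr_le0 ltW.
apply: le_trans (ncB _ _) _; apply: lerD => //.
by apply: le_trans (ncB _ _) _; exact: lerD.
Qed.

(** One step in k multiplies the exponential by 1 + O(j |z|), and the exponential
    itself is at most 1 / (j k Re z); in the cone |z| <= 17 Re z the two sizes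
    combine to O(1/k). *)
Lemma cexp_step (j k : nat) z : (0 < j)%N -> (0 < k)%N -> 0 < complex.Re z ->
  nc z <= 17 * complex.Re z -> j%:R * nc z <= 1 / 10 ->
  nc (cexp (- (j%:R * (k.+1%:R * z))) - cexp (- (j%:R * (k%:R * z)))) <= 34 / k%:R.
Proof.
move=> j0 k0 z0 zc jz; have J0 : 0 < j%:R :> R by rewrite ltr0n.
have K0 : 0 < k%:R :> R by rewrite ltr0n.
have -> : cexp (- (j%:R * (k.+1%:R * z))) = cexp (- (j%:R * (k%:R * z))) * cexp (- (j%:R * z)).
  by rewrite -cexpD; congr cexp; rewrite -natr1; ring.
rewrite -[X in _ - X]mulr1 -mulrBr ncM nc_cexp ReN !Re_natM.
have h1 : nc (cexp (- (j%:R * z)) - 1) <= 2 * (j%:R * nc z).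
  by have := @nc_cexpB1 R (- (j%:R * z)); rewrite ncN nc_natM; apply.
set x := complex.Re z in z0 zc *.
have y0 : 0 < j%:R * (k%:R * x) by rewrite !mulr_gt0.
have h2 : expR (- (j%:R * (k%:R * x))) <= (j%:R * (k%:R * x))^-1.
  rewrite expRN lef_pV2 ?posrE ?expR_gt0 //; have := expR_ge1Dx (j%:R * (k%:R * x)); lra.
apply: le_trans (ler_pM (expR_ge0 _) (nc_ge0 _) h2 h1) _.
rewrite ler_pdivrMl // (_ : _ * (34 / _) = 2 * (j%:R * (17 * x))); last by field; rewrite lt0r_neq0.
by rewrite ler_pM2l // ler_pM2l.
Qed.

(** Once k Re z is bounded below, every ingredient of rem is bounded and changes
    by O(1/k) when k increases by 1. *)
Lemma rem_step s t k z (eta M : R) : (0 < s)%N -> (s <= t)%N -> (0 < k)%N -> 0 < eta ->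
  0 < complex.Re z -> nc z <= 17 * complex.Re z -> t%:R * nc z <= 1 / 10 ->
  eta <= k%:R * complex.Re z ->
  M = (1 - expR (- eta))^-1 ->
  nc (rem s t (k.+1%:R * z) - rem s t (k%:R * z)) <=
   (34 * M + 34 * M ^+ 2 + eta^-1 + 34) / k%:R.
Proof.
move=> s0 st k0 e0 z0 zc tz ez ME; have t0 : (0 < t)%N by exact: leq_trans st.
have T1 : 1 <= t%:R :> R by rewrite ler1n.
have T0 : 0 < t%:R :> R by rewrite ltr0n.
have K0 : 0 < k%:R :> R by rewrite ltr0n.
have e1 : 0 < 1 - expR (- eta) by rewrite subr_gt0 expR_lt1; lra.
have M0 : 0 < M by rewrite ME invr_gt0.
set w := k%:R * z; set w' := k.+1%:R * z.
have zn : 0 < nc z by apply: lt_le_trans z0 (Re_le _).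
have ew : eta <= complex.Re w by rewrite Re_natM.
have ew' : eta <= complex.Re w'.
  by apply: le_trans ew _; rewrite !Re_natM ler_wpM2r ?(ltW z0) // ler_nat.
have tw u : eta <= complex.Re u -> nc (1 - cexp (- (t%:R * u)))^-1 <= M.
  rewrite ME => eu; have etu : eta <= complex.Re (t%:R * u).
    by rewrite Re_natM; apply: (le_trans eu); rewrite ler_peMl // (le_trans _ eu) // ltW.
  have := nc_1m_cexp_ge e0 etu => h; rewrite ncV lef_pV2 ?posrE //.
  exact: lt_le_trans h.
have tw0 u : eta <= complex.Re u -> 1 - cexp (- (t%:R * u)) != 0.
  move=> eu; have etu : eta <= complex.Re (t%:R * u).
    by rewrite Re_natM; apply: (le_trans eu); rewrite ler_peMl // (le_trans _ eu) // ltW.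
  by have := nc_1m_cexp_ge e0 etu => h; rewrite -nc_gt0; apply: lt_le_trans h.
have sz : s%:R * nc z <= 1 / 10.
  by apply: le_trans tz; rewrite ler_wpM2r ?nc_ge0 // ler_nat.
have z1 : 1%:R * nc z <= 1 / 10.
  by apply: le_trans tz; rewrite ler_wpM2r ?nc_ge0.
have da := cexp_step s0 k0 z0 zc sz.
have db := cexp_step t0 k0 z0 zc tz.
have dc := cexp_step (ltn0Sn 0) k0 z0 zc z1.
rewrite -/w -/w' in da db dc; rewrite !mul1r in dc.
have a1 : nc (cexp (- (s%:R * w))) <= 1.
  rewrite nc_cexp ReN Re_natM expR_le1 oppr_le0 mulr_ge0 //.
  by apply: le_trans ew; exact: ltW.
have inv : nc ((t%:R * w)^-1 - (t%:R * w')^-1) <= eta^-1 / k%:R.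
  have zne : z != 0 by rewrite -nc_gt0.
  have tn0 : t%:R != 0 :> R[i] by rewrite pnatr_eq0 -lt0n.
  have kn0 : k%:R != 0 :> R[i] by rewrite pnatr_eq0 -lt0n.
  have kn1 : k.+1%:R != 0 :> R[i] by rewrite pnatr_eq0.
  have -> : (t%:R * w)^-1 - (t%:R * w')^-1 = (k%:R * (t%:R * w'))^-1.
    rewrite /w /w'; move: kn1; rewrite -natr1 => kn1; field.
    by rewrite kn0 kn1 zne tn0.
  rewrite ncV nc_natM nc_natM invfM mulrC ler_wpM2r ?invr_ge0 ?(ltW K0) //.
  have h : eta <= t%:R * nc w'.
    apply: le_trans ew' _; apply: le_trans (Re_le _) _.
    by rewrite ler_peMl ?nc_ge0.
  by rewrite lef_pV2 ?posrE //; exact: lt_le_trans h.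
have b1 := bern_le t0 st.
have -> : rem s t w' - rem s t w =
  (cexp (- (s%:R * w')) - cexp (- (s%:R * w))) * (1 - cexp (- (t%:R * w')))^-1
  + cexp (- (s%:R * w)) * ((cexp (- (t%:R * w')) - cexp (- (t%:R * w))) *
      ((1 - cexp (- (t%:R * w)))^-1 * (1 - cexp (- (t%:R * w')))^-1))
  + ((t%:R * w)^-1 - (t%:R * w')^-1)
  - (bern s t)%:C * (cexp (- w') - cexp (- w)).
  have := tw0 w ew; have := tw0 w' ew'; rewrite /rem.
  move: (cexp _) (cexp _) (cexp _) (cexp _) (cexp (- w')) (cexp (- w)) => A B C D E F B0 D0.
  move: ((t%:R * w')^-1) ((t%:R * w)^-1) => I J.
  by field; rewrite B0 D0.
have k34 : 0 <= 34 / k%:R :> R by rewrite divr_ge0.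
have p1 := ler_pM (nc_ge0 _) (nc_ge0 _) da (tw w' ew').
have p2 := ler_pM (nc_ge0 _) (nc_ge0 _) (tw w ew) (tw w' ew').
have p3 := ler_pM (nc_ge0 _) (mulr_ge0 (nc_ge0 _) (nc_ge0 _)) db p2.
have p4 : nc (cexp (- (s%:R * w)) * ((cexp (- (t%:R * w')) - cexp (- (t%:R * w))) *
      ((1 - cexp (- (t%:R * w)))^-1 * (1 - cexp (- (t%:R * w')))^-1))) <= 34 / k%:R * (M * M).
  rewrite ncM -[leRHS]mul1r; apply: ler_pM; rewrite ?nc_ge0 //.
  by rewrite !ncM.
have p5 : nc ((bern s t)%:C * (cexp (- w') - cexp (- w))) <= 34 / k%:R.
  by rewrite ncM ncR -[leRHS]mul1r; apply: ler_pM; rewrite ?nc_ge0.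
apply: le_trans (ncB _ _) _; apply: le_trans (lerD (ncD _ _) p5) _.
apply: le_trans (lerD (lerD (ncD _ _) inv) (lexx _)) _.
apply: le_trans (lerD (lerD (lerD _ p4) (lexx _)) (lexx _)) _.
  by rewrite ncM; exact: p1.
by rewrite le_eqVlt; apply/orP; left; apply/eqP; ring.
Qed.

(** Summation by parts: (1 - xi) times the sum telescopes to two boundary terms
    and a sum of differences, which the bound on the differences makes
    telescope again. *)
Lemma abel_bound xi (b : nat -> R[i]) (C2 C4 : R) (a n : nat) :
  nc xi = 1 -> xi != 1 -> (0 < a)%N -> (a <= n)%N ->
  (forall k, (a <= k)%N -> nc (b k) <= C2 / k%:R) ->
  (forall k, (a <= k)%N -> nc (b k.+1 - b k) <= C4 * (k%:R^-1 - k.+1%:R^-1)) ->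
  nc (\sum_(a <= k < n) xi ^+ k * b k) <= (2 * C2 + C4) / (a%:R * nc (1 - xi)).
Proof.
move=> xi1 xin a0 an hb hd.
have A0 : 0 < a%:R :> R by rewrite ltr0n.
have d0 : 0 < nc (1 - xi) by rewrite nc_gt0 subr_eq0 eq_sym.
have C20 : 0 <= C2.
  have := le_trans (nc_ge0 _) (hb a (leqnn _)).
  by rewrite pmulr_lge0 // invr_gt0.
have id : (1 - xi) * \sum_(a <= k < n) xi ^+ k * b k = xi ^+ a * b a - xi ^+ n * b n +
    \sum_(a <= k < n) xi ^+ k.+1 * (b k.+1 - b k).
  elim: n an => [|n IH]; first by rewrite leqn0 => /eqP ->; rewrite !big_geq //; ring.
  rewrite leq_eqVlt => /orP[/eqP ->|]; first by rewrite !big_geq //; ring.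
  rewrite ltnS => an; rewrite !big_nat_recr //= mulrDr IH // exprS.
  by rewrite -exprS exprS; ring.
have sd : nc (\sum_(a <= k < n) xi ^+ k.+1 * (b k.+1 - b k)) <= C4 * (a%:R^-1 - n%:R^-1).
  apply: le_trans (nc_sum _ _ _) _.
  elim: n an {id} => [|n IH]; first by rewrite leqn0 => /eqP ->; rewrite !big_geq // subrr mulr0.
  rewrite leq_eqVlt => /orP[/eqP ->|]; first by rewrite !big_geq // subrr mulr0.
  rewrite ltnS => an; rewrite big_nat_recr //=; apply: le_trans (lerD (IH an) _) _.
    by rewrite ncM ncX xi1 expr1n mul1r; exact: hd.
  by rewrite -mulrDr addrA subrK.
have C40 : 0 <= C4.
  have := le_trans (nc_ge0 _) (hd a (leqnn _)); rewrite pmulr_lge0 // subr_gt0.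
  by rewrite ltf_pV2 ?posrE // ltr_nat.
have N0 : 0 <= n%:R^-1 :> R by rewrite invr_ge0.
have nA : n%:R^-1 <= a%:R^-1 :> R by rewrite lef_pV2 ?posrE ?ler_nat // ltr0n; lia.
rewrite invfM mulrA ler_pdivlMr // mulrC -ncM id.
apply: le_trans (ncD _ _) _; apply: le_trans (lerD (ncB _ _) sd) _.
rewrite !ncM !ncX xi1 !expr1n !mul1r.
have h1 := hb a (leqnn _); have h2 := hb n an.
have h3 : C2 / n%:R <= C2 / a%:R by rewrite ler_wpM2l.
have h4 : C4 * (a%:R^-1 - n%:R^-1) <= C4 / a%:R by rewrite ler_wpM2l // gerBl.
rewrite mulrDl -mulrA; move: h1 h2 h3 h4; move: (C2 / a%:R) (C2 / n%:R) (C4 / _) (C4 * _) (nc _) (nc _).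
by move=> *; lra.
Qed.

(** The terms with k Re z of order 1 are only O(1/k), so absolute values do not
    suffice. Cut at k = eta / Re z. Below, the terms are O(|z|) by rem_near and
    there are eta / Re z of them: O(eta) in total. Above, the oscillation of
    xi^k, xi <> 1, and summation by parts give O(Re z / eta). *)
Lemma rem_series_small s t xi (e : R) : (0 < s)%N -> (s <= t)%N ->
  nc xi = 1 -> xi != 1 -> 0 < e ->
  exists2 d : R, 0 < d & forall z, 0 < complex.Re z < d -> nc z <= 17 * complex.Re z ->
    forall n, nc (\sum_(0 <= k < n) xi ^+ k.+1 * (rem s t (k.+1%:R * z) / k.+1%:R)) <= e.
Proof.
move=> s0 st xi1 xin e0; have t0 : (0 < t)%N by exact: leq_trans st.
have T0 : 0 < t%:R :> R by rewrite ltr0n.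
pose c : R := 84 * t%:R * 17.
have c0 : 0 < c by rewrite !mulr_gt0.
(* c bounds the terms below the cut, c * Re z each; eta is small enough for
rem_near to apply up to the cut and for their sum c * eta to be e / 2. *)
pose eta : R := Num.min (170 * t%:R)^-1 (e / 2 / c).
have eta0 : 0 < eta by rewrite lt_min invr_gt0 mulr_gt0 //= !divr_gt0.
have eta1 : t%:R * (17 * eta) <= 1 / 10.
  have : eta <= (170 * t%:R)^-1 by rewrite ge_min lexx.
  by rewrite -[_^-1]mul1r ler_pdivlMr ?mulr_gt0 //; lra.
have eta2 : c * eta <= e / 2.
  by have : eta <= e / 2 / c by [rewrite ge_min lexx orbT]; rewrite ler_pdivlMr //; lra.
clearbody eta.
pose C2 : R := (1 - expR (- eta))^-1 + eta^-1 + 1.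
pose M : R := (1 - expR (- eta))^-1.
pose C3 : R := 34 * M + 34 * M ^+ 2 + eta^-1 + 34.
have e1 : 0 < 1 - expR (- eta) by rewrite subr_gt0 expR_lt1; lra.
have M0 : 0 < M by rewrite invr_gt0.
have eV : 0 < eta^-1 by rewrite invr_gt0.
have C20 : 0 < C2 by rewrite /C2 -/M; lra.
have C30 : 0 < C3 by rewrite /C3; have := sqr_ge0 M; lra.
have d0 : 0 < nc (1 - xi) by rewrite nc_gt0 subr_eq0 eq_sym.
pose G : R := (2 * C2 + (C3 + C2)) / nc (1 - xi) / eta.
have G0 : 0 < G by rewrite !divr_gt0 //; lra.
have C2E : C2 = (1 - expR (- eta))^-1 + eta^-1 + 1 by [].
have C3E : C3 = 34 * M + 34 * M ^+ 2 + eta^-1 + 34 by [].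
have ME : M = (1 - expR (- eta))^-1 by [].
have GE : G = (2 * C2 + (C3 + C2)) / nc (1 - xi) / eta by [].
have cE : c = 84 * t%:R * 17 by [].
clearbody G C3 M C2 c.
exists (Num.min (170 * t%:R)^-1 (e / 2 / G)).
  by rewrite lt_min invr_gt0 mulr_gt0 //= divr_gt0 // divr_gt0.
move=> z /andP[z0]; rewrite lt_min => /andP[z1 z2] zc n.
set x := complex.Re z in z0 z1 z2 zc *.
have tz : t%:R * nc z <= 1 / 10.
  apply: (@le_trans _ _ (t%:R * (17 * x))); first by rewrite ler_pM2l.
  by move: z1; rewrite -[_^-1]mul1r ltr_pdivlMr ?mulr_gt0 //; lra.
have zn : 0 < nc z by apply: lt_le_trans z0 (Re_le _).
pose a := (Num.truncn (eta / x)).+1.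
have near k : (0 < k)%N -> (k < a)%N -> nc (rem s t (k%:R * z) / k%:R) <= c * x.
  move=> k0 ka; have K0 : 0 < k%:R :> R by rewrite ltr0n.
  have kx : k%:R * x <= eta.
    rewrite -ler_pdivlMr //; apply: le_trans (_ : (Num.truncn (eta / x))%:R <= _).
      by rewrite ler_nat -ltnS.
    by rewrite truncn_le divr_ge0 // ltW.
  have knz : k%:R * nc z <= 17 * eta.
    by apply: le_trans (_ : k%:R * (17 * x) <= _); [rewrite ler_pM2l|lra].
  have h := @rem_near s t (k%:R * z) t0 st.
  rewrite nc_natM in h; rewrite ncM ncV nc_nat ler_pdivrMr //.
  apply: le_trans (h _ _) _; first by rewrite mulr_gt0.
    by apply: le_trans eta1; rewrite ler_pM2l.
  rewrite cE -!mulrA ler_pM2l // ler_pM2l // mulrCA [leRHS]mulrA [leRHS]mulrC ler_pM2l //.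
  by rewrite mulrC.
have big k : (a <= k)%N -> eta <= k%:R * x.
  move=> ak; rewrite -ler_pdivrMr //; apply: ltW; apply: lt_le_trans (truncnS_gt _) _.
  by rewrite ler_nat.
have far m : (a <= m)%N ->
    nc (\sum_(a <= k < m) xi ^+ k * (rem s t (k%:R * z) / k%:R)) <= e / 2.
  move=> am.
  have h := @abel_bound xi (fun k => rem s t (k%:R * z) / k%:R) C2 (C3 + C2) a m xi1 xin isT am.
  apply: le_trans (h _ _) _.
  - move=> k ak; rewrite ncM ncV nc_nat ler_wpM2r ?invr_ge0 //.
    by rewrite C2E; apply: rem_far => //; rewrite Re_natM; exact: big.
  - move=> k ak; have k0 : (0 < k)%N by exact: leq_trans ak.
    have K0 : 0 < k%:R :> R by rewrite ltr0n.
    have kn0 : k%:R != 0 :> R[i] by rewrite pnatr_eq0 -lt0n.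
    have kn1 : k.+1%:R != 0 :> R[i] by rewrite pnatr_eq0.
    have K1 : 0 < k.+1%:R :> R by rewrite ltr0n.
    have -> : rem s t (k.+1%:R * z) / k.+1%:R - rem s t (k%:R * z) / k%:R =
       (rem s t (k.+1%:R * z) - rem s t (k%:R * z)) / k.+1%:R
       - rem s t (k%:R * z) * (k%:R^-1 - k.+1%:R^-1) by ring.
    have dk : k%:R^-1 - k.+1%:R^-1 = (k%:R * k.+1%:R)^-1 :> R.
      move: K1; rewrite -natr1 => K1; field.
      by rewrite !lt0r_neq0.
    have dkc : k%:R^-1 - k.+1%:R^-1 = (k%:R * k.+1%:R)^-1 :> R[i].
      move: kn1; rewrite -natr1 => kn1; field.
      by rewrite kn0 kn1.
    apply: le_trans (ncB _ _) _; rewrite [leRHS]mulrDl dk dkc; apply: lerD.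
      rewrite ncM ncV nc_nat invfM mulrA ler_wpM2r ?invr_ge0 //.
      by rewrite C3E; apply: (rem_step s0 st k0 eta0) => //; exact: big.
    rewrite ncM ncV ncM !nc_nat ler_wpM2r ?invr_ge0 ?mulr_ge0 //.
    by rewrite C2E; apply: rem_far => //; rewrite Re_natM; exact: big.
  apply: (@le_trans _ _ (G * x)); last by move: z2; rewrite ltr_pdivlMr //; lra.
  have N0 : 0 <= (2 * C2 + (C3 + C2)) / nc (1 - xi) by rewrite divr_ge0 ?(ltW d0) //; lra.
  have A0 : 0 < a%:R :> R by rewrite ltr0n.
  rewrite GE invfM mulrCA mulrC -[leRHS]mulrA; apply: ler_wpM2l => //.
  rewrite [_^-1 * x]mulrC.
  by rewrite ler_pdivlMr // ler_pdivrMl // big.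
rewrite (_ : \sum_(0 <= k < n) _ = \sum_(1 <= k < n.+1) xi ^+ k * (rem s t (k%:R * z) / k%:R)); last first.
  by rewrite big_add1.
have nearS m : (m <= a)%N -> nc (\sum_(1 <= k < m) xi ^+ k * (rem s t (k%:R * z) / k%:R)) <= e / 2.
  move=> ma; apply: le_trans (nc_sum _ _ _) _.
  apply: (@le_trans _ _ (\sum_(1 <= k < m) c * x)).
    rewrite [leLHS]big_seq [leRHS]big_seq; apply: ler_sum => k; rewrite mem_index_iota => /andP[k0 km].
    by rewrite ncM ncX xi1 expr1n mul1r near //; exact: leq_trans km ma.
  rewrite sumr_const_nat -[_ *+ (m - 1)]mulr_natr; apply: le_trans eta2; rewrite -mulrA ler_pM2l //.
  rewrite mulrC -ler_pdivlMr //; apply: le_trans (_ : (Num.truncn (eta / x))%:R <= _).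
    by rewrite ler_nat leq_subLR add1n.
  by rewrite truncn_le divr_ge0 // ltW.
have [na|na] := leqP n.+1 a; first by apply: le_trans (nearS _ na) _; lra.
rewrite (@big_cat_nat _ _ _ a) //=; last exact: ltnW.
by apply: le_trans (ncD _ _) _; have := nearS a (leqnn _); have := far n.+1 (ltnW na); lra.
Qed.

End Remainder.

(** * Asymptotics at the roots of unity of order t *)

Section MajorArcs.
Variable R : realType.
Local Open Scope complex_scope.
Implicit Types (z w xi : R[i]) (x y phi : R) (s t h : nat).

Lemma lam_sub_pow t (q : R[i]) : (0 < t)%N -> q != 1 -> q ^+ t != 1 ->
  lam (q ^+ t) - lam q = - \sum_(1 <= s < t) q ^+ s / (1 - q ^+ t).
Proof.
move=> t0 q1 qt1.
have d1 : 1 - q != 0 by rewrite subr_eq0 eq_sym.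
have dt : 1 - q ^+ t != 0 by rewrite subr_eq0 eq_sym.
have E : \sum_(1 <= s < t) q ^+ s = (q - q ^+ t) / (1 - q).
  case: t t0 {qt1 dt} => // t _; elim: t => [|t IH].
    by rewrite big_geq // expr1 subrr mul0r.
  by rewrite big_nat_recr //= IH; move: (q ^+ t.+1) (exprS q t.+1) => Q ->; field.
by rewrite -big_distrl /= E /lam; field; rewrite d1 dt.
Qed.

(** The symmetry s -> t - s, which decides what cancels in log_constant. *)
Lemma modn_complement (s t h : nat) : coprime h t -> (0 < s < t)%N ->
  (0 < (s * h) %% t /\ ((t - s) * h) %% t = t - (s * h) %% t)%N.
Proof.
move=> cop /andP[s0 st].
have t0 : (0 < t)%N by exact: leq_trans st.
have nz u : (0 < u < t)%N -> (0 < (u * h) %% t)%N.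
  move=> /andP[u0 ut]; rewrite lt0n; apply/negP => /eqP e.
  have : (t %| u * h)%N by rewrite /dvdn e.
  by rewrite Gauss_dvdl 1?coprime_sym // => /dvdn_leq; lia.
split; first by apply: nz; rewrite s0.
have h1 : (0 < (s * h) %% t)%N by apply: nz; rewrite s0.
have h2 : (0 < ((t - s) * h) %% t)%N by apply: nz; lia.
have l1 := ltn_pmod (s * h) t0; have l2 := ltn_pmod ((t - s) * h) t0.
have : (t %| (s * h) %% t + ((t - s) * h) %% t)%N.
  by rewrite /dvdn modnDm -mulnDl subnKC ?modnMr ?(ltnW st) // modnMr.
move=> /dvdnP[[|[|k]]]; lia.
Qed.

Lemma floor_ratio (a t : nat) : (0 < t)%N ->
  Num.floor (a%:R / t%:R : R) = (a %/ t)%N%:Z.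
Proof.
move=> t0; have T0 : 0 < t%:R :> R by rewrite ltr0n.
apply: floor_def; rewrite -pmulrn ler_pdivlMr // -natrM ler_nat leq_trunc_div /=.
rewrite intrD /= -pmulrn natr1 ltr_pdivrMr // -natrM ltr_nat.
by rewrite mulSn addnC -ltn_subLR ?leq_trunc_div // {1}(divn_eq a t) addKn ltn_mod.
Qed.

Lemma dedekindE h t : (0 < t)%N -> dedekind_sum R h%:Z t =
  \sum_(1 <= s < t) s%:R / t%:R * (((s * h) %% t)%N%:R / t%:R - 2^-1).
Proof.
move=> t0; have tn0 : t%:R != 0 :> R by rewrite pnatr_eq0 -lt0n.
apply: eq_bigr => s _; congr (_ * _).
rewrite -!pmulrn -natrM mulnC floor_ratio // -pmulrn.
rewrite {1}(divn_eq (s * h) t) natrD natrM; field.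
exact: tn0.
Qed.

(** Under s -> t - s the factor bern is odd and ln |1 - xi| even, so the real part
    cancels. In the imaginary part both factors are sawtooth values, and their
    products sum to the Dedekind sum because the sawtooth alone sums to 0. *)
Lemma log_constant h t : (1 < t)%N -> coprime h t ->
  \sum_(1 <= s < t) (bern R s t)%:C * clog1m (uc ((s * h)%:R / t%:R)) =
   - (pi%:C * 'i * (dedekind_sum R h%:Z t)%:C).
Proof.
move=> t1 cop; have t0 : (0 < t)%N by exact: ltnW.
have T0 : 0 < t%:R :> R by rewrite ltr0n.
have tn0 : t%:R != 0 :> R by rewrite pnatr_eq0 -lt0n.
pose y (s : nat) : R := ((s * h) %% t)%N%:R / t%:R.
have y01 s : (0 < s < t)%N -> 0 < y s < 1.
  move=> /(modn_complement cop)[h1 _]; rewrite /y divr_gt0 ?ltr0n //=.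
  by rewrite ltr_pdivrMr // mul1r ltr_nat ltn_mod.
have yC s : (0 < s < t)%N -> y (t - s)%N = 1 - y s.
  move=> /(modn_complement cop)[_ h1]; rewrite /y h1 natrB; last exact/ltnW/ltn_pmod.
  by field.
have bC s : (0 < s < t)%N -> bern R (t - s) t = - bern R s t.
  by move=> /andP[_ st]; rewrite /bern natrB 1?ltnW //; field.
have term s : (0 < s < t)%N -> (bern R s t)%:C * clog1m (uc ((s * h)%:R / t%:R)) =
    (bern R s t * ln (nc (1 - uc (y s)))) +i* (bern R s t * (pi * (y s - 2^-1))).
  move=> sI; rewrite uc_modn // clog1m_uc; last exact: y01.
  by apply: eqC; rewrite !(ReM, ImM) /= -/(y s); ring.
have anti (F : nat -> R) : (forall s, (0 < s < t)%N -> F (t - s)%N = - F s) ->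
    \sum_(1 <= s < t) F s = 0.
  move=> hF; have : \sum_(1 <= s < t) F s = - \sum_(1 <= s < t) F s.
    rewrite {1}big_nat_rev /= -sumrN [LHS]big_seq [RHS]big_seq; apply: eq_bigr => s.
    by rewrite mem_index_iota add1n subSS => sI; exact: hF.
  by set S := \sum_(_ <= _ < _) _ => e; lra.
rewrite big_seq (eq_bigr (fun s => (bern R s t * ln (nc (1 - uc (y s)))) +i*
    (bern R s t * (pi * (y s - 2^-1))))); last first.
  by move=> s; rewrite mem_index_iota; exact: term.
rewrite -big_seq; apply: eqC.
  rewrite Re_sum; transitivity (0 : R); last by rewrite /=; ring.
  apply: (anti (fun s => bern R s t * ln (nc (1 - uc (y s))))) => s sI; rewrite bC // yC // mulNr; congr (- (_ * ln _)).
  by rewrite ucD ucN uc1 mul1r -ucN nc_1m_ucN.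
rewrite Im_sum /=; transitivity (- (pi * dedekind_sum R h%:Z t)); last by ring.
have z0 : \sum_(1 <= s < t) (y s - 2^-1) = 0.
  by apply: anti => s sI; rewrite yC //; field.
rewrite dedekindE // -mulNr mulr_sumr.
transitivity (\sum_(1 <= s < t) (2^-1 * pi * (y s - 2^-1) + (- pi) * (s%:R / t%:R * (y s - 2^-1)))).
  by apply: eq_bigr => s _; rewrite /bern; ring.
by rewrite big_split /= -mulr_sumr z0 mulr0 add0r.
Qed.

(** The sum of xi^(ks) over 0 < s < t is t - 1 or -1 according to whether t divides
    k; multiplied by -1/k^2 and summed over k, it gives zeta(2) (1 - 1/t). *)
Lemma csums_pole t h z : (1 < t)%N -> coprime h t -> z != 0 ->
  csums (fun k => - (\sum_(1 <= s < t) uc ((s * h)%:R / t%:R) ^+ k.+1) / (t%:R * z) * k.+1%:R^-1 ^+ 2)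
    ((growth R t)%:C / z).
Proof.
move=> t1 cop z0; have t0 : (0 < t)%N by exact: ltnW.
have tn0 : t%:R != 0 :> R[i] by rewrite pnatr_eq0 -lt0n.
have h1 := csums_multiples t0 (@csums_zeta2 R).
have h2 := csumsZ ((t%:R * z)^-1) (csumsB (@csums_zeta2 R) (csumsZ (t%:R^-1) h1)).
have -> : (growth R t)%:C / z = (t%:R * z)^-1 * ((zeta2 R)%:C - t%:R^-1 * (zeta2 R)%:C).
  rewrite /growth !(rmorphM, rmorphB) /= fmorphV rmorph_nat; field.
  by rewrite z0 tn0.
apply: eq_csums h2 => k.
have -> : \sum_(1 <= s < t) uc ((s * h)%:R / t%:R) ^+ k.+1 = (if (t %| k.+1)%N then t%:R else 0) - 1 :> R[i].
  have := @sum_uc R (k.+1 * h) t t0; rewrite Gauss_dvdl 1?coprime_sym //.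
  move=> <-; rewrite [in RHS]big_ltn // expr0 addrC addKr.
  by apply: eq_bigr => s _; rewrite !ucX !natrM; congr uc; ring.
case: ifPn => [/dvdnP[[|j] kE]|_]; last by rewrite mulr0; ring.
  by rewrite mul0n in kE.
rewrite kE mulnK //= natrM.
have : j.+1%:R != 0 :> R[i] by rewrite pnatr_eq0.
by move: (j.+1%:R) => J J0; field; rewrite tn0 J0 z0.
Qed.

Lemma arcptE t h x phi n : arcpt t h x phi ^+ n =
  uc ((n * h)%:R / t%:R) * cexp (- (n%:R * (x -i* phi))).
Proof.
rewrite exprMn ucX mulrA -natrM -cexp_natM; congr (_ * cexp _); ring.
Qed.

(** Pole, logarithm and remainder, obtained by expanding each
    e^(-s w) / (1 - e^(-t w)) at w = k z. *)
Lemma lterm_split t h x phi k (z := x -i* phi) : (1 < t)%N -> 0 < x ->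
  lterm t (arcpt t h x phi) k =
   - (\sum_(1 <= s < t) uc ((s * h)%:R / t%:R) ^+ k.+1) / (t%:R * z) * k.+1%:R^-1 ^+ 2
   - \sum_(1 <= s < t) (bern R s t)%:C *
        ((uc ((s * h)%:R / t%:R) * cexp (- z)) ^+ k.+1 / k.+1%:R)
   - \sum_(1 <= s < t) uc ((s * h)%:R / t%:R) ^+ k.+1 * (rem s t (k.+1%:R * z) / k.+1%:R).
Proof.
move=> t1 x0; have t0 : (0 < t)%N by exact: ltnW.
set q := arcpt _ _ _ _; have q1 : nc q < 1 by rewrite nc_arcpt expR_lt1; lra.
set K := k.+1.
have Kn0 : K%:R != 0 :> R[i] by rewrite pnatr_eq0.
have z0 : z != 0 by rewrite /z eq_complex /= negb_and lt0r_neq0.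
have tn0 : t%:R != 0 :> R[i] by rewrite pnatr_eq0 -lt0n.
have qk1 : nc (q ^+ K) < 1 by rewrite ncX exprn_ilt1 ?nc_ge0.
have ne (w : R[i]) : nc w < 1 -> w != 1 by apply: contraTneq => ->; rewrite nc1 ltxx.
have qt1 : nc ((q ^+ K) ^+ t) < 1 by rewrite ncX exprn_ilt1 ?nc_ge0 // -lt0n.
rewrite /lterm -/K -exprM mulnC exprM lam_sub_pow ?ne //.
rewrite -!sumrN !mulr_suml -!big_split /=; apply: eq_bigr => s _.
have -> : (q ^+ K) ^+ t = cexp (- (t%:R * (K%:R * z))).
  rewrite -exprM arcptE.
  have /eqP -> : uc ((K * t * h)%:R / t%:R) == 1 :> R[i].
    by rewrite uc_eq1 // -mulnA mulnCA dvdn_mulr.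
  by rewrite mul1r natrM -mulrA; congr cexp; rewrite mulrCA.
have -> : (q ^+ K) ^+ s = uc ((s * h)%:R / t%:R) ^+ K * cexp (- (s%:R * (K%:R * z))).
  rewrite -exprM arcptE ucX; congr (uc _ * cexp _); last by rewrite natrM -mulrA mulrCA.
  by rewrite -mulnA natrM mulrA.
rewrite [(uc _ * cexp _) ^+ K]exprMn -(cexp_natM K (- z)) mulrN /rem.
have ct : 1 - cexp (- (t%:R * (K%:R * z))) != 0.
  rewrite subr_eq0 eq_sym; apply: ne; rewrite nc_cexp ReN !Re_natM /= expR_lt1 oppr_lt0.
  by rewrite !mulr_gt0 ?ltr0n.
move: ct Kn0; move: (cexp (- (t%:R * (K%:R * z)))) => A.
move: (cexp (- (s%:R * (K%:R * z)))) (cexp (- (K%:R * z))) (uc _ ^+ K) => B E U.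
move: ((bern R s t)%:C) => b; move: (K%:R : R[i]) => K' A0 K0.
by field; rewrite A0 K0 tn0 z0.
Qed.

(** The pole sums to growth / z, the logarithms converge to their values at roots
    of unity, which add up to the Dedekind constant, and the remainder is small
    by rem_series_small. *)
Lemma major_log t h (e : R) : (1 < t)%N -> coprime h t -> 0 < e ->
  exists2 d : R, 0 < d & forall x phi L, 0 < x < d -> `|phi| <= 16 * x ->
    csums (lterm t (arcpt t h x phi)) L ->
    nc (L - (growth R t)%:C / (x -i* phi) + pi%:C * 'i * (dedekind_sum R h%:Z t)%:C) <= e.
Proof.
move=> t1 cop e0; have t0 : (0 < t)%N by exact: ltnW.
have T0 : 0 < t%:R :> R by rewrite ltr0n.
pose xi s : R[i] := uc ((s * h)%:R / t%:R).
have xi1 s : nc (xi s) = 1 by exact: nc_uc.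
have xin s : (0 < s < t)%N -> xi s != 1.
  by move=> /(modn_complement cop)[h1 _]; rewrite /xi uc_eq1 // /dvdn -lt0n.
have xir s : (0 < s < t)%N -> 0 < complex.Re (1 - xi s).
  move=> /(modn_complement cop)[h1 _]; rewrite /xi uc_modn //; apply: Re_1m_uc_gt0.
  by rewrite divr_gt0 ?ltr0n //= ltr_pdivrMr // mul1r ltr_nat ltn_mod.
pose e' := e / (2 * t%:R).
have e'0 : 0 < e' by rewrite divr_gt0 // mulr_gt0.
have hs s : exists2 d : R, 0 < d & (0 < s < t)%N -> forall z, 0 < complex.Re z < d ->
     nc z <= 17 * complex.Re z ->
     (nc (clog1m (xi s * cexp (- z)) - clog1m (xi s)) <= e') /\
     (forall n, nc (\sum_(0 <= k < n) xi s ^+ k.+1 * (rem s t (k.+1%:R * z) / k.+1%:R)) <= e').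
  have [sI|] := boolP (0 < s < t)%N; last by exists 1.
  have [s0 st] := andP sI.
  have [d1 d10 h1] := rem_series_small s0 (ltnW st) (xi1 s) (xin s sI) e'0.
  have [d2 d20 h2] := clog1m_continuous (xir s sI) e'0.
  exists (Num.min d1 (Num.min (d2 / 34) (1 / 170))).
    by rewrite !lt_min d10 !divr_gt0.
  move=> _ z /andP[z0]; rewrite !lt_min => /and3P[zd1 zd2 zd3] zc; split; last first.
    by apply: h1 => //; rewrite z0.
  apply: h2; rewrite -[X in _ - X]mulr1 -mulrBr ncM xi1 mul1r.
  by apply: le_trans (nc_cexpB1 _) _; rewrite ncN; lra.
have hm m : exists2 d : R, 0 < d & forall s, (s < m)%N -> (0 < s < t)%N ->
    forall z, 0 < complex.Re z < d -> nc z <= 17 * complex.Re z ->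
    (nc (clog1m (xi s * cexp (- z)) - clog1m (xi s)) <= e') /\
    (forall n, nc (\sum_(0 <= k < n) xi s ^+ k.+1 * (rem s t (k.+1%:R * z) / k.+1%:R)) <= e').
  elim: m => [|m [d d0 IH]]; first by exists 1.
  have [d' d'0 h'] := hs m; exists (Num.min d d'); first by rewrite lt_min d0.
  move=> s; rewrite ltnS leq_eqVlt => /orP[/eqP ->|sm] sI z /andP[z0];
    rewrite lt_min => /andP[z1 z2].
    by apply: h' => //; rewrite z0.
  by apply: IH => //; rewrite z0.
have [d d0 hdt] := hm t.
have hd s (sI : (0 < s < t)%N) := hdt s (proj2 (andP sI)) sI.
exists d => // x phi L /andP[x0 xd] hphi hL; set z := x -i* phi.
have zc : nc z <= 17 * complex.Re z.
  by apply: le_trans (nc_le _) _; rewrite /= normrN gtr0_norm //; lra.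
have zd : 0 < complex.Re z < d by rewrite /= x0.
have z0 : z != 0 by rewrite /z eq_complex /= negb_and lt0r_neq0.
have w1 s : nc (xi s * cexp (- z)) < 1.
  by rewrite ncM xi1 mul1r nc_cexp ReN /= expR_lt1 oppr_lt0.
have hlog := csums_sum (index_iota 1 t) (fun s => csumsZ (bern R s t)%:C (csums_clog1m (w1 s))).
have hA := csumsB (csums_pole t1 cop z0) hlog.
have hD := csumsB hL hA.
set Sg := \sum_(1 <= s < t) (bern R s t)%:C * (clog1m (xi s * cexp (- z)) - clog1m (xi s)).
have b1 : nc (L - ((growth R t)%:C / z - \sum_(1 <= s < t) (bern R s t)%:C * - clog1m (xi s * cexp (- z))))
    <= e / 2.
  apply: (clim_nc_le hD) => n.
  rewrite (eq_bigr (fun k => - \sum_(1 <= s < t) xi s ^+ k.+1 * (rem s t (k.+1%:R * z) / k.+1%:R))); last first.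
    by move=> k _; rewrite lterm_split // -/z; ring.
  rewrite sumrN ncN exchange_big /=; apply: le_trans (nc_sum _ _ _) _.
  apply: (@le_trans _ _ (\sum_(1 <= s < t) e')).
    rewrite [leLHS]big_seq [leRHS]big_seq; apply: ler_sum => s; rewrite mem_index_iota => sI.
    by have [_] := hd s sI z zd zc; apply.
  rewrite sumr_const_nat -[_ *+ (t - 1)]mulr_natr (_ : e / 2 = e' * t%:R).
    by rewrite ler_pM2l // ler_nat leq_subr.
  by rewrite /e'; field; rewrite lt0r_neq0.
have b2 : nc Sg <= e / 2.
  apply: le_trans (nc_sum _ _ _) _; apply: (@le_trans _ _ (\sum_(1 <= s < t) e')).
    rewrite [leLHS]big_seq [leRHS]big_seq; apply: ler_sum => s; rewrite mem_index_iota => sI.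
    have [h1 _] := hd s sI z zd zc; rewrite ncM ncR.
    have /andP[_ st] := sI.
    by rewrite -[leRHS]mul1r; apply: ler_pM; rewrite ?nc_ge0 //; exact: bern_le (ltnW st).
  rewrite sumr_const_nat -[_ *+ (t - 1)]mulr_natr (_ : e / 2 = e' * t%:R).
    by rewrite ler_pM2l // ler_nat leq_subr.
  by rewrite /e'; field; rewrite lt0r_neq0.
have SgE : Sg = \sum_(1 <= s < t) (bern R s t)%:C * clog1m (xi s * cexp (- z)) +
    pi%:C * 'i * (dedekind_sum R h%:Z t)%:C.
  rewrite /Sg; under eq_bigr do rewrite mulrBr.
  by rewrite sumrB (log_constant t1 cop) opprK.
have -> : L - (growth R t)%:C / z + pi%:C * 'i * (dedekind_sum R h%:Z t)%:C =
   L - ((growth R t)%:C / z - \sum_(1 <= s < t) (bern R s t)%:C * - clog1m (xi s * cexp (- z))) + Sg.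
  rewrite SgE; under [X in _ - (_ - X)]eq_bigr do rewrite mulrN.
  by rewrite sumrN; ring.
by apply: le_trans (ncD _ _) _; lra.
Qed.

Definition omega t m h : R[i] := cexp (- (m%:R * pi%:C * 'i * (dedekind_sum R h%:Z t)%:C)).

(** The error is relative to the modulus of the main term, which lets it be
    absorbed wherever the main term has a definite sign. *)
Lemma major_arc t m h (e : R) : (1 < t)%N -> coprime h t -> 0 < e ->
  exists2 d : R, 0 < d & forall x phi L, 0 < x < d -> `|phi| <= 16 * x ->
    csums (lterm t (arcpt t h x phi)) L ->
    nc (cexp (m%:R * L) - omega t m h * cexp ((m%:R * growth R t)%:C / (x -i* phi))) <=
      e * nc (cexp ((m%:R * growth R t)%:C / (x -i* phi))).
Proof.
move=> t1 cop e0; have M0 : 0 < m.+1%:R :> R by rewrite ltr0n.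
pose e' := Num.min (1 / 10) (e / 2) / m.+1%:R.
have e'0 : 0 < e' by rewrite divr_gt0 // lt_min !divr_gt0.
have [d d0 hd] := major_log t1 cop e'0; exists d => // x phi L xd hphi hL.
have := hd x phi L xd hphi hL; set B := _ / _; set D := _ * _%:C => h1.
have -> : (m%:R * growth R t)%:C / (x -i* phi) = m%:R * B.
  by rewrite rmorphM rmorph_nat mulrA.
have -> : cexp (m%:R * L) - omega t m h * cexp (m%:R * B) =
    omega t m h * cexp (m%:R * B) * (cexp (m%:R * (L - B + D)) - 1).
  rewrite mulrBr mulr1 /omega -!cexpD; congr (cexp _ - _).
  by rewrite /D; ring.
have n1 : nc (omega t m h) = 1.
  by rewrite nc_cexp !(ReN, ReM, ImM, Re_nat, Im_nat) /= !(mulr0, mul0r, subr0, addr0) oppr0 expR0.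
rewrite ncM ncM n1 mul1r mulrC ler_wpM2r ?nc_ge0 //.
have h2 : nc (m%:R * (L - B + D)) <= Num.min (1 / 10) (e / 2).
  rewrite nc_natM; apply: (@le_trans _ _ (m.+1%:R * e')).
    by apply: ler_pM; rewrite ?nc_ge0 // ler_nat.
  by rewrite mulrC divfK ?lt0r_neq0.
move: h2; rewrite le_min => /andP[h2 h3].
by apply: le_trans (nc_cexpB1 h2) _; lra.
Qed.

End MajorArcs.

(** * Coefficients as averages over shifted roots of unity *)

Section Coefficients.
Variable R : realType.
Local Open Scope complex_scope.
Implicit Types (q z w : R[i]) (x y : R).

Lemma csums_bounded (u : nat -> R[i]) l : csums u l -> exists B : R, forall k, nc (u k) <= B.
Proof.
move=> h; have [n0 hn] := h 1 ltr01.
exists (2 + \sum_(0 <= k < n0) nc (u k)) => k.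
have S0 (r : seq nat) : 0 <= \sum_(j <- r) nc (u j) by apply: sumr_ge0 => j _; exact: nc_ge0.
have [kn|kn] := leqP n0 k.
  have := hn k kn; have := hn k.+1 (leqW kn); rewrite big_nat_recr //=.
  set S := \sum_(0 <= j < k) u j => h1 h2.
  have := ncB (S + u k - l) (S - l); rewrite (_ : _ - _ - (_ - _) = u k); last by ring.
  by have := S0 (index_iota 0 n0); lra.
rewrite (bigD1_seq k) ?iota_uniq ?mem_index_iota //=.
have : 0 <= \sum_(i <- index_iota 0 n0 | i != k) nc (u i) by apply: sumr_ge0 => j _; exact: nc_ge0.
lra.
Qed.

Lemma sum_uc_shift (k n N : nat) y : (k < N)%N -> (n < N)%N -> k != n ->
  \sum_(0 <= j < N) uc ((k%:R - n%:R) * (j%:R / N%:R + y)) = 0.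
Proof.
move=> kN nN kn; have N0 : (0 < N)%N by exact: leq_ltn_trans kN.
have Nn0 : N%:R != 0 :> R by rewrite pnatr_eq0 -lt0n.
pose g : R[i] := uc ((k%:R - n%:R) / N%:R).
rewrite (eq_bigr (fun j => uc ((k%:R - n%:R) * y) * g ^+ j)); last first.
  by move=> j _; rewrite /g ucX -ucD; congr uc; ring.
rewrite -big_distrr /=.
have g1 : g - 1 != 0.
  rewrite subr_eq0 /g; have [lt|gt|e] := ltngtP k n; last by rewrite e eqxx in kn.
    rewrite -opprB mulNr ucN -natrB 1?ltnW // invr_eq1 uc_eq1 //.
    by apply/negP => /dvdn_leq; lia.
  rewrite -natrB 1?ltnW // uc_eq1 //.
  by apply/negP => /dvdn_leq; lia.
have -> : \sum_(0 <= j < N) g ^+ j = 0; last by rewrite mulr0.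
apply: (mulfI g1); rewrite mulr0 big_mkord -subrX1 /g ucX mulrC divfK //.
by rewrite ucD ucN !uc_nat invr1 mulr1 subrr.
Qed.

(** Averaging over N-th roots of unity, turned by y, isolates a_n up to the
    coefficients of index at least N, which a slightly larger radius bounds
    geometrically. A finite average replaces the Cauchy integral, and N0 is uniform
    in y. *)
Lemma coef_average (a : nat -> R[i]) (F : R[i] -> R[i]) (r : R) (n : nat) (e : R) :
  (forall q, nc q < 1 -> csums (fun k => a k * q ^+ k) (F q)) ->
  0 < r < 1 -> 0 < e ->
  exists N0, forall N y, (N0 <= N)%N ->
    nc (a n * r%:C ^+ n - N%:R^-1 * \sum_(0 <= j < N)
        F (r%:C * uc (j%:R / N%:R + y)) * uc (- (n%:R * (j%:R / N%:R + y)))) <= e.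
Proof.
move=> hF /andP[r0 r1] e0.
(* a radius between r and 1, where the terms a_k r'^k are still bounded *)
pose r' := (1 + r) / 2.
have r'0 : 0 < r' by rewrite /r'; lra.
have r'1 : nc r'%:C < 1 by rewrite ncR ger0_norm ?(ltW r'0) // /r'; lra.
have [B hB] := csums_bounded (hF _ r'1).
pose s := r / r'.
have s0 : 0 <= s by rewrite divr_ge0 ?ltW.
have s1 : s < 1 by rewrite ltr_pdivrMr // mul1r /r'; lra.
have d0 : 0 < 1 - s by lra.
have B0 : 0 <= B by exact: le_trans (nc_ge0 _) (hB 0%N).
have hs k : nc (a k * r%:C ^+ k) <= B * s ^+ k.
  have -> : r%:C = r'%:C * s%:C by rewrite -rmorphM /s mulrC divfK ?lt0r_neq0.
  rewrite exprMn mulrA ncM ncX [nc s%:C]ncR ger0_norm //.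
  by rewrite ler_wpM2r ?exprn_ge0.
have [N1 hN1] : exists N1, forall N, (N1 <= N)%N -> B * s ^+ N / (1 - s) <= e.
  have : (fun N => B * s ^+ N / (1 - s)) @ \oo --> (0 : R).
    rewrite [X in _ --> X](_ : 0 = B * 0 / (1 - s)); last by ring.
    apply: cvgM; last exact: cvg_cst.
    apply: cvgM; first exact: cvg_cst.
    by apply: cvg_expr; rewrite ger0_norm.
  move=> /cvgrPdist_le /(_ e e0)[N1 _ h]; exists N1 => N /h /=.
  by rewrite sub0r normrN => /(le_trans (ler_norm _)).
exists (maxn N1 n.+1) => N y; rewrite geq_max => /andP[NN1 nN].
have N0 : (0 < N)%N by exact: leq_ltn_trans nN.
have Nn0 : N%:R != 0 :> R[i] by rewrite pnatr_eq0 -lt0n.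
pose q j : R[i] := r%:C * uc (j%:R / N%:R + y).
have q1 j : nc (q j) < 1 by rewrite ncM nc_uc mulr1 ncR ger0_norm // ltW.
have hlim : clim (fun L => N%:R^-1 * \sum_(0 <= j < N)
     uc (- (n%:R * (j%:R / N%:R + y))) * \sum_(0 <= k < L) a k * q j ^+ k)
   (N%:R^-1 * \sum_(0 <= j < N) uc (- (n%:R * (j%:R / N%:R + y))) * F (q j)).
  by apply/climZ/clim_sum => j; apply/climZ/hF.
rewrite ncBC (eq_bigr (fun j => uc (- (n%:R * (j%:R / N%:R + y))) * F (q j))); last first.
  by move=> j _; rewrite mulrC.
apply: clim_dist_le hlim _; exists N => L NL.
pose c k : R[i] := N%:R^-1 * \sum_(0 <= j < N) uc ((k%:R - n%:R) * (j%:R / N%:R + y)).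
have -> : N%:R^-1 * \sum_(0 <= j < N)
     uc (- (n%:R * (j%:R / N%:R + y))) * \sum_(0 <= k < L) a k * q j ^+ k =
   \sum_(0 <= k < L) a k * r%:C ^+ k * c k.
  rewrite /c; under [in RHS]eq_bigr do rewrite mulrCA.
  rewrite -mulr_sumr; congr (_ * _).
  under [in RHS]eq_bigr do rewrite mulr_sumr.
  rewrite exchange_big /=; apply: eq_bigr => j _.
  rewrite mulr_sumr; apply: eq_bigr => k _.
  have -> : q j ^+ k = r%:C ^+ k * uc (k%:R * (j%:R / N%:R + y)) by rewrite /q exprMn ucX.
  have -> : (k%:R - n%:R) * (j%:R / N%:R + y) =
    k%:R * (j%:R / N%:R + y) + - (n%:R * (j%:R / N%:R + y)) by ring.
  by rewrite ucD; ring.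
have cn : c n = 1.
  rewrite /c subrr; under eq_bigr do rewrite mul0r uc0.
  by rewrite sumr_const_nat subn0 mulVf.
have c0 k : (k < N)%N -> k != n -> c k = 0.
  by move=> kN kn; rewrite /c sum_uc_shift // mulr0.
have c1 k : nc (c k) <= 1.
  rewrite ncM ncV nc_nat ler_pdivrMl ?ltr0n // mulr1.
  apply: le_trans (nc_sum _ _ _) _; under eq_bigr do rewrite nc_uc.
  by rewrite sumr_const_nat subn0.
rewrite (@big_cat_nat _ _ _ N) //=.
have -> : \sum_(0 <= k < N) a k * r%:C ^+ k * c k = a n * r%:C ^+ n.
  rewrite (bigD1_seq n) ?iota_uniq ?mem_index_iota //= cn mulr1 big_seq_cond big1 ?addr0 //.
  by move=> k; rewrite mem_index_iota => /andP[kN kn]; rewrite c0 // mulr0.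
rewrite addrAC subrr add0r; apply: le_trans (hN1 N NN1).
apply: le_trans (nc_sum _ _ _) _.
apply: (@le_trans _ _ (\sum_(N <= k < L) B * s ^+ k)).
  apply: ler_sum => k _; rewrite ncM -[leRHS]mulr1.
  by apply: ler_pM; rewrite ?nc_ge0.
rewrite -mulr_sumr -mulrA ler_wpM2l //.
rewrite -{1}(add0n N) big_addn; under eq_bigr do rewrite exprD mulrC.
by rewrite -mulr_sumr ler_wpM2l ?exprn_ge0 // geo_sum_le ?s0.
Qed.

Lemma is_coef_seq_csums (t m : nat) (c : nat -> int) : is_coef_seq R t m c ->
  forall q, nc q < 1 -> csums (fun n => (c n)%:~R * q ^+ n)
    (qpoch q q ^+ m / qpoch (q ^+ t) (q ^+ t) ^+ m).
Proof.
by move=> hc q q1; apply/climP; apply: hc; rewrite normE (ltcR _ 1).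
Qed.

End Coefficients.

(** * The saddle point weight *)

Section Weights.
Variable R : realType.
Local Open Scope complex_scope.
Implicit Types (x phi lambda u B : R).

(** The main factor exp(B/z) of the generating function times the factor e^(n z)
    that comes with the n-th coefficient. *)
Definition weight B (n : nat) (x phi : R) : R[i] :=
  cexp (B%:C / (x -i* phi) + n%:R * (x -i* phi)).

(** The condition n x^2 = B puts the saddle point at z = x: with u = phi / x the
    exponent is B/x times 1/(1 - i u) + (1 - i u), whose imaginary part is only
    cubic in u. *)
Lemma weightE B n x phi : 0 < x -> n%:R * x ^+ 2 = B ->
  let u := phi / x in
  weight B n x phi = cexp ((2 * (B / x) - B / x * (u ^+ 2 / (1 + u ^+ 2))) +i*
     (- (B / x * (u ^+ 3 / (1 + u ^+ 2))))).
Proof.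
move=> x0 hB u; have xn0 := lt0r_neq0 x0.
have uE : phi = x * u by rewrite /u mulrC divfK.
have nE : n%:R = B / x ^+ 2 by rewrite -hB mulfK // expf_neq0.
have U0 : 1 + u ^+ 2 != 0 by rewrite lt0r_neq0 // ltr_wpDr ?sqr_ge0.
have D0 : x ^+ 2 + (- (x * u)) ^+ 2 != 0.
  rewrite (_ : _ + _ = x ^+ 2 * (1 + u ^+ 2)); last by ring.
  by rewrite mulf_neq0 // expf_neq0.
rewrite /weight; congr cexp; apply: eqC.
  rewrite ReD ReM ReV ImV nc_sqr Re_natM /= nE uE; move: D0 U0 xn0; clear -R.
  move=> D0 U0 xn0; rewrite (_ : x ^+ 2 + (- (x * u)) ^+ 2 = x ^+ 2 * (1 + u ^+ 2)); last by ring.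
  by field; rewrite U0 xn0.
rewrite ImD ImM ReV ImV nc_sqr Im_natM /= nE uE.
rewrite (_ : x ^+ 2 + (- (x * u)) ^+ 2 = x ^+ 2 * (1 + u ^+ 2)); last by ring.
by field; rewrite U0 xn0.
Qed.

(** The phase is at most 1, and cos 1 >= 1/2: inside this range the weight counts
    positively, so that no Gaussian integral has to be evaluated. *)
Lemma weight_inner B n x phi : 0 < x -> n%:R * x ^+ 2 = B -> 0 < B ->
  B / x * `|phi / x| ^+ 3 <= 1 ->
  nc (weight B n x phi) / 2 <= complex.Re (weight B n x phi).
Proof.
move=> x0 hB B0 hu; rewrite weightE // nc_cexp Re_cexp /=.
rewrite ler_wpM2l ?expR_ge0 // cosN.
set u := phi / x in hu *; set l := B / x in hu *.
have l0 : 0 < l by rewrite divr_gt0.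
set v := l * _; have v1 : `|v| <= 1.
  apply: le_trans hu; rewrite /v normrM (ger0_norm (ltW l0)) ler_wpM2l ?(ltW l0) //.
  have U0 : 0 < 1 + u ^+ 2 by rewrite ltr_wpDr ?sqr_ge0.
  rewrite normrM normrX normfV (ger0_norm (ltW U0)) ler_pdivrMr //.
  by rewrite ler_peMr ?exprn_ge0 // lerDl sqr_ge0.
have E : v / 2 *+ 2 = v by rewrite mulr2n; field.
rewrite -E cos_mulr2n cos2sin2 -[(1 - _) *+ 2]mulr_natr.
have : sin (v / 2) ^+ 2 <= (v / 2) ^+ 2.
  by rewrite -[leLHS]real_normK ?num_real // -[leRHS]real_normK ?num_real // lerXn2r ?nnegrE // abs_sin_le.
have : (v / 2) ^+ 2 <= 1 / 4 by move: v1; rewrite ler_norml => /andP[? ?]; nra.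
lra.
Qed.

Lemma weight_center B n x phi : 0 < x -> n%:R * x ^+ 2 = B -> 0 < B -> x <= B ->
  `|phi| <= x ^+ 2 / B -> expR (2 * (B / x)) / 4 <= nc (weight B n x phi).
Proof.
move=> x0 hB B0 xB hphi; rewrite weightE // nc_cexp /= expRD expRN.
rewrite ler_wpM2l ?expR_ge0 // lef_pV2 ?posrE ?expR_gt0 //.
apply: le_trans (expR1_le4 R); rewrite ler_expR.
set u := phi / x; have hu : `|u| <= x / B.
  rewrite normrM normfV (ger0_norm (ltW x0)) ler_pdivrMr //.
  by apply: le_trans hphi _; rewrite expr2 mulrAC.
have U0 : 0 < 1 + u ^+ 2 by rewrite ltr_wpDr ?sqr_ge0.
have hu2 : u ^+ 2 <= (x / B) ^+ 2.
  rewrite -(real_normK (num_real u)) lerXn2r ?nnegrE //.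
  by rewrite divr_ge0 ?ltW.
have h1 : u ^+ 2 / (1 + u ^+ 2) <= (x / B) ^+ 2.
  apply: le_trans hu2; rewrite ler_pdivrMr // ler_peMr ?sqr_ge0 // lerDl sqr_ge0 //.
apply: (@le_trans _ _ (B / x * (x / B) ^+ 2)); first by rewrite ler_wpM2l // divr_ge0 ?ltW.
rewrite (_ : _ * _ = x / B); last by field; rewrite !lt0r_neq0.
by rewrite ler_pdivrMr // mul1r.
Qed.

Lemma expRN_poly (v : R) k : 0 < v -> expR (- v) <= k.+1`!%:R / v ^+ k.+1.
Proof.
move=> v0; have := expR_ge1Dxn k (ltW v0); have vk : 0 < v ^+ k.+1 by exact: exprn_gt0.
have f0 : 0 < k.+1`!%:R :> R by rewrite ltr0n fact_gt0.
move=> h; rewrite expRN -[leRHS]invf_div lef_pV2 ?posrE ?expR_gt0 ?divr_gt0 //.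
by apply: le_trans h; rewrite lerDr.
Qed.

(** Beyond the range of weight_inner, l = B/x and u = phi/x satisfy l |u|^3 > 1,
    hence (l u^2)^3 >= l: the weight has dropped by exp of a power of l, which is
    smaller than any power of x. *)
Lemma weight_outer B : 0 < B -> exists2 C : R, 0 < C & forall n x phi,
  0 < x -> n%:R * x ^+ 2 = B -> `|phi| <= 16 * x -> 1 < B / x * `|phi / x| ^+ 3 ->
  nc (weight B n x phi) <= expR (2 * (B / x)) * (C * x ^+ 3).
Proof.
move=> B0; have [f f0 hf] : exists2 f : R, 0 < f & forall v : R, 0 < v -> expR (- v) <= f / v ^+ 9.
  (* (l u^2)^9 >= l^3, so the ninth power yields the required x^3. *)
  exists 9`!%:R; first by rewrite ltr0n fact_gt0.
  by move=> v v0; exact: (expRN_poly 8 v0).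
have [K K0 hK] : exists2 K : R, 0 < K & forall u : R, `|u| <= 16 -> 1 + u ^+ 2 <= K.
  (* 257 = 1 + 16^2 *)
  exists 257 => // u u16; rewrite -(real_normK (num_real u)).
  have : `|u| ^+ 2 <= 16 ^+ 2 by rewrite lerXn2r ?nnegrE.
  by clear; lra.
exists (f * K ^+ 9 / B ^+ 3); first by rewrite divr_gt0 ?mulr_gt0 ?exprn_gt0.
move=> n x phi x0 hB hphi hu; rewrite weightE // nc_cexp /= expRD ler_wpM2l ?expR_ge0 //.
set l := B / x in hu *; have l0 : 0 < l by rewrite divr_gt0.
set u := phi / x in hu *; have u16 : `|u| <= 16.
  by rewrite normrM normfV (ger0_norm (ltW x0)) ler_pdivrMr.
have U0 : 0 < 1 + u ^+ 2 by rewrite ltr_wpDr ?sqr_ge0.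
have U257 := hK u u16.
have up : 0 < `|u|.
  rewrite normr_gt0; apply: contraTneq hu => ->.
  by rewrite normr0 expr0n mulr0 -leNgt.
have u2 : 0 < u ^+ 2 by rewrite -(real_normK (num_real u)) exprn_gt0.
set v := l * (u ^+ 2 / (1 + u ^+ 2)); have v0 : 0 < v by rewrite mulr_gt0 // divr_gt0.
have v1 : l * u ^+ 2 / K <= v.
  rewrite /v -mulrA ler_wpM2l ?(ltW l0) // ler_wpM2l ?(ltW u2) //.
  by rewrite lef_pV2 ?posrE.
have w3 : l <= (l * u ^+ 2) ^+ 3.
  have -> : (l * u ^+ 2) ^+ 3 = l * (l * `|u| ^+ 3) ^+ 2.
    by rewrite -(real_normK (num_real u)); ring.
  by rewrite ler_peMr ?(ltW l0) // exprn_ege1 // ltW.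
apply: le_trans (hf v v0) _.
rewrite (_ : f * K ^+ 9 / B ^+ 3 * x ^+ 3 = f * (K ^+ 9 * ((B ^+ 3)^-1 * x ^+ 3))); last by ring.
rewrite ler_wpM2l ?(ltW f0) // -[leRHS]invrK lef_pV2 ?posrE ?exprn_gt0 //; last first.
  by rewrite invr_gt0 !mulr_gt0 ?invr_gt0 ?exprn_gt0.
have -> : (K ^+ 9 * ((B ^+ 3)^-1 * x ^+ 3))^-1 = l ^+ 3 / K ^+ 9.
  rewrite /l; field; rewrite !lt0r_neq0 //.
apply: (@le_trans _ _ ((l * u ^+ 2 / K) ^+ 9)); last first.
  by rewrite lerXn2r ?nnegrE ?(ltW v0) // divr_ge0 ?(ltW K0) // mulr_ge0 ?(ltW l0) // ltW.
rewrite [leRHS]expr_div_n ler_wpM2r ?invr_ge0 ?exprn_ge0 ?(ltW K0) //.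
have lu0 : 0 <= l * u ^+ 2 := mulr_ge0 (ltW l0) (ltW u2).
by rewrite (exprM (l * u ^+ 2) 3 3) lerXn2r ?nnegrE ?(ltW l0) ?(exprn_ge0 _ lu0).
Qed.

End Weights.

(** * Sums over the points at equal distance from the roots of unity *)

Section Columns.
Variable R : realType.
Local Open Scope complex_scope.
Implicit Types (x phi e : R) (t m h n r : nat).

Definition eta_ratio t m (q : R[i]) : R[i] := qpoch q q ^+ m / qpoch (q ^+ t) (q ^+ t) ^+ m.

Lemma Re_cexp_nc_natM m (L : R[i]) : nc (cexp (m%:R * L)) = expR (m%:R * complex.Re L).
Proof. by rewrite nc_cexp Re_natM. Qed.

(** The two estimates for minor arcs gain a factor e^(-kap m / x), which beats the
    factor x^(-m) coming from - m ln (1 - e^(-x)) and any further power of x. *)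
Lemma minor_bound t m : (1 < t)%N -> (0 < m)%N ->
  exists C d : R, [/\ 0 < C, 0 < d & forall x phi h, 0 < x < d ->
    `|t%:R * phi| <= pi -> (`|phi| <= 16 * x -> ~~ coprime h t) ->
    nc (eta_ratio t m (arcpt t h x phi)) <= expR (m%:R * growth R t / x) * (C * x ^+ 3)].
Proof.
move=> t1 m0; have t0 : (0 < t)%N by exact: ltnW.
have T0 : 0 < t%:R :> R by rewrite ltr0n.
have M0 : 0 < m%:R :> R by rewrite ltr0n.
pose kap : R := ((100 * t%:R) ^+ 2)^-1.
have kap0 : 0 < kap by rewrite invr_gt0 exprn_gt0 // mulr_gt0.
have [f f0 hf] : exists2 f : R, 0 < f & forall v : R, 0 < v -> expR (- v) <= f / v ^+ (m + 3).
  (* The exponent m + 3 pays for the factor x^(-m) and leaves x^3. *)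
  exists (m + 3)`!%:R; first by rewrite ltr0n fact_gt0.
  by move=> v v0; rewrite addn3; exact: expRN_poly.
have kap4 : kap <= (4 * t%:R)^-1.
  rewrite lef_pV2 ?posrE ?exprn_gt0 ?mulr_gt0 //.
  by have : 1 <= t%:R :> R by [rewrite ler1n]; nra.
exists (expR m%:R * 2 ^+ m * f / (m%:R * kap) ^+ (m + 3)), (Num.min 1 (170 * t%:R)^-1); split.
- by rewrite !mulr_gt0 ?expR_gt0 ?exprn_gt0 ?invr_gt0 ?exprn_gt0 // mulr_gt0.
- by rewrite lt_min ltr01 invr_gt0 mulr_gt0.
move=> x phi h /andP[x0]; rewrite lt_min => /andP[x1 xd] hpi hcop.
have tx : 17 * (t%:R * x) <= 1 / 10.
  move: xd; rewrite -[_^-1]mul1r ltr_pdivlMr ?mulr_gt0 //; lra.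
set q := arcpt _ _ _ _; have q1 : nc q < 1 by rewrite nc_arcpt expR_lt1; lra.
rewrite /eta_ratio; have [L [hL ->]] := quotient_exp m t0 q1.
rewrite Re_cexp_nc_natM.
have LB : complex.Re L <= (growth R t - kap) / x + 1 - ln (1 - expR (- x)).
  have [hphi|hphi] := leP `|phi| (16 * x).
    exact: (minor_noncoprime t1 x0 tx hphi (hcop hphi) hL).
  apply: le_trans (minor_far t1 x0 _ hpi (ltW hphi) hL) _; first by move: tx; lra.
  by rewrite !lerD2r ler_wpM2r ?invr_ge0 ?(ltW x0) // lerD2l lerN2.
have ex2 : x / 2 <= 1 - expR (- x).
  have /andP[_] : 1 - x <= expR (- x) <= 1 - x / 2 by apply: expRN_bounds; rewrite x0 ltW.
  by lra.
have x20 : 0 < x / 2 by rewrite divr_gt0.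
have ex0 : 0 < 1 - expR (- x) by exact: lt_le_trans ex2.
apply: (@le_trans _ _ (expR (m%:R * growth R t / x - m%:R * kap / x + m%:R - m%:R * ln (1 - expR (- x))))).
  rewrite ler_expR; apply: le_trans (_ : m%:R * ((growth R t - kap) / x + 1 - ln (1 - expR (- x))) <= _).
    by rewrite ler_pM2l.
  by rewrite le_eqVlt; apply/orP; left; apply/eqP; ring.
have v0 : 0 < m%:R * kap / x by rewrite divr_gt0 // mulr_gt0.
rewrite !expRD -!mulrA ler_wpM2l ?expR_ge0 //.
have h1 := hf _ v0.
have h2 : expR (- (m%:R * ln (1 - expR (- x)))) <= (2 / x) ^+ m.
  rewrite -mulrN expRM_natl (expRN (ln _)) lnK ?posrE // lerXn2r ?nnegrE ?invr_ge0 ?divr_ge0 ?(ltW ex0) ?(ltW x0) //.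
  by rewrite -[leRHS]invf_div lef_pV2 ?posrE.
rewrite [m%:R * (kap / x)]mulrA.
apply: (@le_trans _ _ (f / (m%:R * kap / x) ^+ (m + 3) * (expR m%:R * (2 / x) ^+ m))).
  apply: ler_pM; rewrite ?expR_ge0 ?mulr_ge0 ?expR_ge0 //.
  by rewrite ler_wpM2l ?expR_ge0.
have xm : x ^+ m != 0 by rewrite expf_neq0 // lt0r_neq0.
move: (m%:R * kap) (expR m%:R) => kk E.
rewrite !expr_div_n invf_div [x ^+ (m + 3)]exprD le_eqVlt; apply/orP; left; apply/eqP.
move: xm; move: (x ^+ m) (x ^+ 3) (kk ^+ (m + 3))^-1 (2 ^+ m) => A X Y P A0.
by field.
Qed.

Lemma growth_gt0 t : (1 < t)%N -> 0 < growth R t.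
Proof.
move=> t1; have T1 : 1 < t%:R :> R by rewrite ltr1n.
have T0 : 0 < t%:R :> R by apply: lt_trans T1.
by rewrite /growth divr_gt0 // mulr_gt0 ?zeta2_gt0 // subr_gt0 invf_lt1.
Qed.

Lemma alphaE t m r : alpha R t m r =
  \sum_(0 <= h < t | coprime h t) omega R t m h * uc (- (r%:R * (h%:R / t%:R))).
Proof.
apply: eq_bigr => h _; rewrite /omega /uc -cexpD; congr cexp; congr (_ + _).
rewrite natV_C -[2]/(2%:R : R[i]) -!(rmorph_nat (real_complex R)).
by apply: eqC; rewrite !(ReN, ImN, ReM, ImM) /=; ring.
Qed.

(** The contribution of the t points with the same x and phi to the coefficient of
    index n, for n = r modulo t: the phase e^(-2 pi i n h / t) then depends on r
    alone and summing over h produces alpha. *)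
Definition column t m r n x phi : R[i] :=
  \sum_(0 <= h < t) eta_ratio t m (arcpt t h x phi) *
     uc (- (r%:R * (h%:R / t%:R))) * cexp (n%:R * (x -i* phi)).

Lemma major_uniform t m e : (1 < t)%N -> 0 < e ->
  exists2 d : R, 0 < d & forall h x phi, (h < t)%N -> coprime h t ->
    0 < x < d -> `|phi| <= 16 * x ->
    nc (eta_ratio t m (arcpt t h x phi) -
        omega R t m h * cexp ((m%:R * growth R t)%:C / (x -i* phi))) <=
      e * nc (cexp ((m%:R * growth R t)%:C / (x -i* phi))).
Proof.
move=> t1 e0; have t0 : (0 < t)%N by exact: ltnW.
have hb b : exists2 d : R, 0 < d & forall h x phi, (h < b)%N -> coprime h t ->
    0 < x < d -> `|phi| <= 16 * x ->
    nc (eta_ratio t m (arcpt t h x phi) -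
        omega R t m h * cexp ((m%:R * growth R t)%:C / (x -i* phi))) <=
      e * nc (cexp ((m%:R * growth R t)%:C / (x -i* phi))).
  elim: b => [|b [d d0 IH]]; first by exists 1.
  have [cop|ncop] := boolP (coprime b t); last first.
    exists d => // h x phi; rewrite ltnS leq_eqVlt => /orP[/eqP ->|hb]; first by rewrite (negbTE ncop).
    exact: IH.
  have [d' d'0 h'] := @major_arc R t m b e t1 cop e0.
  exists (Num.min d d'); first by rewrite lt_min d0.
  move=> h x phi; rewrite ltnS leq_eqVlt => /orP[/eqP ->|hb] copt /andP[x0];
    rewrite lt_min => /andP[xd xd'] hphi; last by apply: IH => //; rewrite x0.
  have q1 : nc (arcpt t b x phi) < 1 by rewrite nc_arcpt expR_lt1; lra.
  rewrite /eta_ratio; have [L [hL ->]] := quotient_exp m t0 q1.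
  by apply: h' => //; rewrite x0.
exact: hb.
Qed.

(** Where the weight counts positively, a times the column is at least
    (1/2 - 1/8) a^2 |weight|, and near the center |weight| >= e^(2B/x) / 4; hence
    3/32. Elsewhere the weight counts positively or is O(x^3 e^(2B/x)), like the
    minor arcs, so that a lower bound without main term is enough. *)
Lemma column_estimate t m r (a : R) : (1 < t)%N -> (0 < m)%N ->
  alpha R t m r = a%:C -> a != 0 -> let B := m%:R * growth R t in
  exists K d : R, [/\ 0 < K, 0 < d & forall n x phi, 0 < x < d -> n%:R * x ^+ 2 = B ->
    `|t%:R * phi| <= pi ->
    - (expR (2 * (B / x)) * (K * x ^+ 3)) <= a * complex.Re (column t m r n x phi) /\
    (`|phi| <= x ^+ 2 / B ->
      expR (2 * (B / x)) * (3 / 32 * a ^+ 2 - K * x ^+ 3) <= a * complex.Re (column t m r n x phi))].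
Proof.
move=> t1 m0 alE a0 B; have t0 : (0 < t)%N by exact: ltnW.
have T0 : 0 < t%:R :> R by rewrite ltr0n.
have B0 : 0 < B by rewrite mulr_gt0 ?growth_gt0 // ltr0n.
have na0 : 0 < `|a| by rewrite normr_gt0.
have [C [d1 [C0 d10 hmin]]] := minor_bound t1 m0.
have e0 : 0 < `|a| / (8 * t%:R) by rewrite divr_gt0 // mulr_gt0.
have [d2 d20 hmaj] := @major_uniform t m _ t1 e0.
have [C' C'0 hout] := weight_outer B0.
pose K : R := `|a| * t%:R * C + 2 * a ^+ 2 * C'.
have a2 : 0 < a ^+ 2 by rewrite exprn_even_gt0.
have aC' : 0 < 2 * a ^+ 2 * C' by apply: mulr_gt0 => //; exact: mulr_gt0.
have K0 : 0 < K by apply: addr_gt0 => //; rewrite !mulr_gt0.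
exists K, (Num.min (Num.min d1 d2) (Num.min 16 B)); split => //.
  by rewrite !lt_min d10 d20 B0 ltr0n.
move=> n x phi /andP[x0]; rewrite !lt_min -!andbA => /and4P[xd1 xd2 x16 xB] hB hpi.
set E := expR (2 * (B / x)); have E0 : 0 < E by exact: expR_gt0.
have x3 : 0 < x ^+ 3 by exact: exprn_gt0.
have EE : E = expR (B / x) * expR (n%:R * x).
  rewrite /E -expRD; congr expR.
  have -> : n%:R * x = B / x by rewrite -hB; field; rewrite lt0r_neq0.
  by ring.
have small h : (`|phi| <= 16 * x -> ~~ coprime h t) ->
    nc (eta_ratio t m (arcpt t h x phi) * uc (- (r%:R * (h%:R / t%:R))) *
       cexp (n%:R * (x -i* phi))) <= E * (C * x ^+ 3).
  move=> hh; rewrite ncM [nc (_ * uc _)]ncM nc_uc mulr1 nc_cexp Re_natM /= EE [leRHS]mulrAC.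
  rewrite ler_wpM2r ?expR_ge0 //.
  by apply: hmin; rewrite ?x0.
have sum_small (P : pred nat) : (forall h, P h -> `|phi| <= 16 * x -> ~~ coprime h t) ->
    `|complex.Re (\sum_(0 <= h < t | P h) eta_ratio t m (arcpt t h x phi) *
      uc (- (r%:R * (h%:R / t%:R))) * cexp (n%:R * (x -i* phi)))| <= t%:R * (E * (C * x ^+ 3)).
  move=> hP; apply: le_trans (normRe_le _) _; apply: le_trans (nc_sum _ _ _) _.
  apply: (@le_trans _ _ (\sum_(0 <= h < t | P h) E * (C * x ^+ 3))).
    by apply: ler_sum => h Ph; apply: small; exact: hP.
  have EC0 : 0 <= E * (C * x ^+ 3) by rewrite !mulr_ge0 // ltW.
  rewrite big_mkcond /=; apply: (@le_trans _ _ (\sum_(0 <= h < t) E * (C * x ^+ 3))).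
    by apply: ler_sum => h _; case: ifP.
  by rewrite sumr_const_nat subn0 mulr_natl.
have Ka : `|a| * (t%:R * (E * (C * x ^+ 3))) <= E * (K * x ^+ 3).
  have -> : `|a| * (t%:R * (E * (C * x ^+ 3))) = E * ((`|a| * t%:R * C) * x ^+ 3) by ring.
  by rewrite ler_pM2l // ler_pM2r // lerDl ltW.
have [hphi|hphi] := ltP (16 * x) `|phi|.
  have low : - (E * (K * x ^+ 3)) <= a * complex.Re (column t m r n x phi).
    have := sum_small predT; rewrite -/(column t m r n x phi) => h.
    have {}h : `|complex.Re (column t m r n x phi)| <= t%:R * (E * (C * x ^+ 3)).
      by apply: h => h' _ hle; move: hphi; rewrite ltNge hle.
    have h2 : `|a * complex.Re (column t m r n x phi)| <= E * (K * x ^+ 3).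
      by rewrite normrM; apply: le_trans Ka; rewrite ler_pM2l.
    by move: h2; rewrite ler_norml => /andP[].
  split => // hc; exfalso; move: hphi; apply/negP; rewrite -leNgt.
  apply: le_trans hc _; rewrite ler_pdivrMr // expr2 [leRHS]mulrAC ler_wpM2r ?(ltW x0) //.
  by apply: le_trans (ltW xB) _; rewrite ler_peMl ?(ltW B0) // ler1n.
set W := weight B n x phi.
have main : `|complex.Re (\sum_(0 <= h < t | coprime h t) eta_ratio t m (arcpt t h x phi) *
      uc (- (r%:R * (h%:R / t%:R))) * cexp (n%:R * (x -i* phi))) - a * complex.Re W|
    <= `|a| / 8 * nc W.
  have -> : a * complex.Re W = complex.Re (a%:C * W).
    by rewrite ReM [complex.Re a%:C]/= [complex.Im a%:C]/= mul0r subr0.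
  rewrite -ReN -ReD; apply: le_trans (normRe_le _) _.
  have -> : a%:C * W = \sum_(0 <= h < t | coprime h t)
      omega R t m h * cexp (B%:C / (x -i* phi)) * uc (- (r%:R * (h%:R / t%:R))) * cexp (n%:R * (x -i* phi)).
    rewrite -alE alphaE mulr_suml; apply: eq_bigr => h _.
    by rewrite /W /weight cexpD; ring.
  rewrite -sumrB; apply: le_trans (nc_sum _ _ _) _.
  apply: (@le_trans _ _ (\sum_(0 <= h < t) `|a| / (8 * t%:R) * nc W)); last first.
    rewrite sumr_const_nat subn0 -[_ *+ t]mulr_natr le_eqVlt; apply/orP; left; apply/eqP.
    by field; rewrite lt0r_neq0.
  rewrite big_mkcond [leLHS]big_seq [leRHS]big_seq; apply: ler_sum => h; rewrite mem_index_iota => /andP[_ ht].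
  case: ifP => cop; last by rewrite mulr_ge0 ?nc_ge0 // ltW.
  have -> : nc W = nc (cexp (B%:C / (x -i* phi))) * nc (cexp (n%:R * (x -i* phi))).
    by rewrite /W /weight cexpD ncM.
  rewrite -!mulrBl ncM [nc (_ * uc _)]ncM nc_uc mulr1 [leRHS]mulrA.
  apply: ler_wpM2r; first exact: nc_ge0.
  by apply: hmaj => //; rewrite x0.
set S1 := complex.Re (\sum_(0 <= h < t | coprime h t) _) in main.
have := sum_small (fun h => ~~ coprime h t) (fun h hh _ => hh).
set S2 := complex.Re _ => hS2.
have colE : complex.Re (column t m r n x phi) = S1 + S2.
  by rewrite /column (bigID (fun h => coprime h t)) /= ReD.
have aS2 : - (E * (`|a| * t%:R * C * x ^+ 3)) <= a * S2.
  have : `|a * S2| <= E * (`|a| * t%:R * C * x ^+ 3).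
    rewrite normrM; have -> : E * (`|a| * t%:R * C * x ^+ 3) = `|a| * (t%:R * (E * (C * x ^+ 3))) by ring.
    by rewrite ler_pM2l.
  by rewrite ler_norml => /andP[].
have aS1 : a ^+ 2 * complex.Re W - a ^+ 2 / 8 * nc W <= a * S1.
  have : `|a * (S1 - a * complex.Re W)| <= `|a| * (`|a| / 8 * nc W) by rewrite normrM ler_pM2l.
  have -> : `|a| * (`|a| / 8 * nc W) = a ^+ 2 / 8 * nc W.
    by rewrite -[in RHS](real_normK (num_real a)); ring.
  by rewrite ler_norml => /andP[+ _]; rewrite mulrBr mulrA -expr2; clear; lra.
rewrite colE mulrDr.
have inner : B / x * `|phi / x| ^+ 3 <= 1 -> 3 / 8 * a ^+ 2 * nc W <= a * S1.
  move=> hi; apply: le_trans aS1; have hW := weight_inner x0 hB B0 hi; rewrite -/W in hW.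
  move: (ler_wpM2l (ltW a2) hW); set N := nc W; clear; lra.
have KE : E * (K * x ^+ 3) = E * (`|a| * t%:R * C * x ^+ 3) + 2 * a ^+ 2 * (E * (C' * x ^+ 3)).
  by rewrite /K; ring.
have EC0 : 0 <= E * (C' * x ^+ 3) by rewrite !mulr_ge0 // ltW.
have aEC : 0 <= 2 * a ^+ 2 * (E * (C' * x ^+ 3)) by rewrite mulr_ge0 // mulr_ge0 // ltW.
have nW0 : 0 <= a ^+ 2 * nc W by rewrite mulr_ge0 ?nc_ge0 // ltW.
split.
  have [hi|ho] := leP (B / x * `|phi / x| ^+ 3) 1.
    by move: (inner hi) aS2 aEC nW0; rewrite KE; clear; lra.
  have hW := hout n x phi x0 hB hphi ho; rewrite -/W -/E in hW.
  have : - (2 * a ^+ 2 * (E * (C' * x ^+ 3))) <= a * S1.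
    apply: le_trans aS1; have h1 := normRe_le W; rewrite ler_norml in h1; case/andP: h1 => h1 _.
    have h2 := ler_wpM2l (ltW a2) h1; have h3 := ler_wpM2l (ltW a2) hW.
    move: h2 h3 nW0 aEC; clear.
    by move: (nc W) (complex.Re W) (E * (C' * x ^+ 3)) (a ^+ 2) => N Q Z A h2 h3 h4 h5; lra.
  by move=> h; move: h aS2; rewrite KE; clear; lra.
move=> hc; have u1 : `|phi / x| <= x / B.
  rewrite normrM normfV (ger0_norm (ltW x0)) ler_pdivrMr //.
  by apply: le_trans hc _; rewrite expr2 mulrAC.
have hi : B / x * `|phi / x| ^+ 3 <= 1.
  apply: (@le_trans _ _ (B / x * (x / B) ^+ 3)).
    by rewrite ler_wpM2l ?divr_ge0 ?(ltW B0) ?(ltW x0) // lerXn2r ?nnegrE ?divr_ge0 ?(ltW B0) ?(ltW x0).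
  have -> : B / x * (x / B) ^+ 3 = (x / B) ^+ 2 by field; rewrite !lt0r_neq0.
  by rewrite exprn_ile1 ?divr_ge0 ?(ltW B0) ?(ltW x0) // ler_pdivrMr // mul1r ltW.
have hW := weight_center x0 hB B0 (ltW xB) hc; rewrite -/W -/E in hW.
have h1 := ler_wpM2l (ltW a2) hW; have h2 := inner hi.
move: h1 h2 aS2 aEC; rewrite mulrBr KE; clear; lra.
Qed.

End Columns.

(** * The sign of the coefficients *)

Section Signs.
Variable R : realType.
Local Open Scope complex_scope.
Implicit Types (x phi a : R) (t m n r : nat).

Lemma sum_ge_window (f : nat -> R) (M p q : nat) (l w : R) : (p <= q <= M)%N ->
  (forall i, (i < M)%N -> l <= f i) -> (forall i, (p <= i < q)%N -> l + w <= f i) ->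
  M%:R * l + (q - p)%:R * w <= \sum_(0 <= i < M) f i.
Proof.
move=> /andP[pq qM] hl hw.
have -> : M%:R * l + (q - p)%:R * w = \sum_(0 <= i < M) (l + (if (p <= i < q)%N then w else 0)).
  rewrite big_split /= sumr_const_nat subn0 mulr_natl; congr (_ + _).
  rewrite (@big_cat_nat _ _ _ q) //= (@big_cat_nat _ _ _ p 0 q) //=.
  rewrite [X in _ = X + _ + _]big_seq [X in _ = X + _ + _]big1 => [|i]; last first.
    by rewrite mem_index_iota => /andP[_ ip]; rewrite leqNgt ip.
  rewrite [X in _ = _ + X]big_seq [X in _ = _ + X]big1 => [|i]; last first.
    by rewrite mem_index_iota => /andP[qi _]; rewrite (ltnNge i) qi andbF.
  rewrite big_seq (eq_bigr (fun _ => w)) => [|i]; last by rewrite mem_index_iota => ->.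
  by rewrite -big_seq sumr_const_nat mulr_natl add0r addr0.
rewrite [leLHS]big_seq [leRHS]big_seq; apply: ler_sum => i; rewrite mem_index_iota => /andP[_ iM].
by case: ifP => [/hw //|_]; rewrite addr0; exact: hl.
Qed.

Lemma shifted_root_arcpt t h x (y : R) : (0 < t)%N ->
  (expR (- x))%:C * uc (h%:R / t%:R + y) = arcpt t h x (2 * pi * y).
Proof.
move=> t0; rewrite /arcpt ucD mulrCA -cexp_real; congr (_ * _).
by rewrite /uc -cexpD; congr cexp; apply: eqC => /=; ring.
Qed.

(** The index j = h M + i places the j-th of the tM-th roots of unity near the h-th of
    the t-th roots, at a distance that depends on i only. *)
Lemma average_columns t m r n M x (y0 : R) : (0 < t)%N -> (0 < M)%N -> n = r %[mod t] ->
  (expR (n%:R * x))%:C * \sum_(0 <= j < t * M)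
     eta_ratio t m ((expR (- x))%:C * uc (j%:R / (t * M)%:R + y0)) *
       uc (- (n%:R * (j%:R / (t * M)%:R + y0))) =
  \sum_(0 <= i < M) column t m r n x (2 * pi * (i%:R / (t * M)%:R + y0)).
Proof.
move=> t0 M0 nr; have tn0 : t%:R != 0 :> R by rewrite pnatr_eq0 -lt0n.
have Mn0 : M%:R != 0 :> R by rewrite pnatr_eq0 -lt0n.
rewrite big_nat_mul (eq_bigr (fun h => \sum_(0 <= i < M)
    eta_ratio t m (arcpt t h x (2 * pi * (i%:R / (t * M)%:R + y0))) *
    (uc (- (r%:R * (h%:R / t%:R))) * uc (- (n%:R * (i%:R / (t * M)%:R + y0)))))); last first.
  move=> h _; rewrite -{1}(add0n (h * M)%N) big_addn mulSn addnK; apply: eq_bigr => i _.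
  have -> : (i + h * M)%:R / (t * M)%:R + y0 = h%:R / t%:R + (i%:R / (t * M)%:R + y0) :> R.
    by rewrite !natrM natrD natrM; field; rewrite tn0 Mn0.
  have -> : - (n%:R * (h%:R / t%:R + (i%:R / (t * M)%:R + y0))) =
    - (n%:R * (h%:R / t%:R)) + - (n%:R * (i%:R / (t * M)%:R + y0)) by ring.
  rewrite shifted_root_arcpt // ucD; congr (_ * (_ * _)).
  have uE u : uc (- (u%:R * (h%:R / t%:R))) = (uc ((u * h %% t)%N%:R / t%:R))^-1 :> R[i].
    by rewrite mulrA -natrM ucN uc_modn.
  by rewrite !uE -modnMml nr modnMml.
rewrite exchange_big /= mulr_sumr; apply: eq_bigr => i _.
rewrite /column mulr_sumr; apply: eq_bigr => h _.
set psi := _ / _ + y0.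
have -> : cexp (n%:R * (x -i* (2 * pi * psi))) = (expR (n%:R * x))%:C * uc (- (n%:R * psi)).
  rewrite -cexp_real /uc -cexpD; congr cexp.
  by apply: eqC; rewrite ?Re_natM ?Im_natM /=; ring.
move: (eta_ratio _ _ _) => F; move: (uc (- (r%:R * _))) => U; move: (uc _) => V.
by ring.
Qed.

(** With n x^2 = B the center |phi| <= x^2 / B occupies a proportion of order x^2 of
    the circle and contributes a positive multiple of x^2 e^(2B/x) to a c(n),
    whereas all errors are O(x^3 e^(2B/x)). *)
Lemma coef_sign t m r a (c : nat -> int) : (1 < t)%N -> (0 < m)%N ->
  is_coef_seq R t m c -> alpha R t m r = a%:C -> a != 0 ->
  exists n0, forall n, (n0 <= n)%N -> n = r %[mod t] -> 0 < a * (c n)%:~R.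
Proof.
move=> t1 m0 hc alE a0; have t0 : (0 < t)%N by exact: ltnW.
have T0 : 0 < t%:R :> R by rewrite ltr0n.
have [K [d [K0 d0 hcol]]] := column_estimate t1 m0 alE a0.
set B := m%:R * growth R t in hcol.
have B0 : 0 < B by rewrite mulr_gt0 ?growth_gt0 // ltr0n.
have na0 : 0 < `|a| by rewrite normr_gt0.
have a2 : 0 < a ^+ 2 by rewrite exprn_even_gt0.
have p0 := pi_gt0 R.
pose b := 3 / 32 * a ^+ 2; have b0 : 0 < b by apply: mulr_gt0.
rewrite -/b in hcol; clearbody b B.
(* The third bound makes the center fit into one arc; by the fourth,
(K + 1) x^3 <= y b for its half width y below, so that the gain over the
center exceeds the losses by x^3. *)
pose x1 := Num.min (Num.min d 1) (Num.min (pi * B / t%:R) (b / (2 * pi * B) / (K + 1))).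
have K1 : 0 < K + 1 by rewrite addr_gt0.
have x10 : 0 < x1.
  rewrite !lt_min d0 ltr01 /=; apply/andP; split; first by rewrite divr_gt0 // mulr_gt0.
  by apply: divr_gt0 => //; apply: divr_gt0 => //; rewrite !mulr_gt0.
exists (Num.truncn (B / x1 ^+ 2)).+1 => n nn0 nr.
have n0 : (0 < n)%N by exact: leq_ltn_trans nn0.
have N0 : 0 < n%:R :> R by rewrite ltr0n.
pose x := Num.sqrt (B / n%:R).
have x0 : 0 < x by rewrite sqrtr_gt0 divr_gt0.
have xn : n%:R * x ^+ 2 = B by rewrite sqr_sqrtr ?divr_ge0 ?(ltW B0) // mulrC divfK ?lt0r_neq0.
have xx1 : x < x1.
  rewrite -(@ltr_pXn2r _ 2) ?nnegrE ?(ltW x0) ?(ltW x10) // sqr_sqrtr ?divr_ge0 ?(ltW B0) //.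
  rewrite ltr_pdivrMr // mulrC -ltr_pdivrMr ?exprn_gt0 //.
  by apply: lt_le_trans (truncnS_gt _) _; rewrite ler_nat.
have {x10 xx1 x1 nn0} : [/\ x < d, x < 1, x < pi * B / t%:R & x < b / (2 * pi * B) / (K + 1)].
  by move: xx1; rewrite !lt_min -!andbA => /and4P[].
move=> [xd xlt1 xt xb].
have x2 : 0 < x ^+ 2 by exact: exprn_gt0.
have x3 : 0 < x ^+ 3 by exact: exprn_gt0.
pose E := expR (2 * (B / x)); have E0 : 0 < E by exact: expR_gt0.
(* the half width of the center, in turns *)
pose y := x ^+ 2 / (2 * pi * B); have pB : 0 < 2 * pi * B by rewrite mulr_gt0 // mulr_gt0.
have y0 : 0 < y by rewrite divr_gt0.
have yt : y < (2 * t%:R)^-1.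
  rewrite ltr_pdivrMr // mulrC ltr_pdivlMr ?mulr_gt0 //.
  by move: xt; rewrite ltr_pdivlMr // expr2; nra.
pose e := expR (- (n%:R * x)) * (E * x ^+ 3 / (2 * `|a|)).
have e0 : 0 < e by rewrite mulr_gt0 ?expR_gt0 // divr_gt0 ?mulr_gt0.
have r1 : 0 < expR (- x) < 1 by rewrite expR_gt0 expR_lt1 oppr_lt0.
have [N1 hN1] := coef_average n (is_coef_seq_csums hc) r1 e0.
(* An even number of points per arc, so that the shift s by half an arc puts
the point of index M' exactly on a t-th root of unity. *)
pose M' := N1.+1; pose M := (2 * M')%N.
have M0 : (0 < M)%N by [].
have M'0 : 0 < M'%:R :> R by rewrite ltr0n.
have ME : M%:R = 2 * M'%:R :> R by rewrite natrM.
have tM : (N1 <= t * M)%N.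
  apply: leq_trans (leq_pmull _ t0); rewrite /M mul2n -addnn.
  exact: leq_trans (leqnSn _) (leq_addr _ _).
pose s : R := - (2 * t%:R)^-1.
have := hN1 _ s tM; set avg := _^-1 * _ => havg.
have avgE : (expR (n%:R * x))%:C * avg = ((t * M)%:R^-1)%:C *
    \sum_(0 <= i < M) column t m r n x (2 * pi * (i%:R / (t * M)%:R + s)).
  by rewrite /avg mulrCA natV_C -(average_columns m x s t0 M0 nr).
have tMn : (t * M)%:R = t%:R * (2 * M'%:R) :> R by rewrite natrM ME.
have phiE i : i%:R / (t * M)%:R + s = (i%:R - M'%:R) / (t%:R * (2 * M'%:R)).
  by rewrite tMn /s; field; rewrite !lt0r_neq0.
have phi_pi i : (i < M)%N -> `|t%:R * (2 * pi * (i%:R / (t * M)%:R + s))| <= pi.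
  move=> iM; rewrite phiE.
  have -> : t%:R * (2 * pi * ((i%:R - M'%:R) / (t%:R * (2 * M'%:R)))) =
     pi * ((i%:R - M'%:R) / M'%:R) :> R by field; rewrite !lt0r_neq0.
  rewrite normrM (ger0_norm (ltW p0)) ler_piMr ?(ltW p0) //.
  rewrite normrM normfV (ger0_norm (ltW M'0)) ler_pdivrMr // mul1r.
  have i2 : i%:R <= 2 * M'%:R :> R by rewrite -ME ler_nat ltnW.
  have i0 : 0 <= i%:R :> R by [].
  by rewrite ler_norml; move: i2 i0; move: (i%:R : R) (M'%:R : R) => I J; clear; lra.
have x0d : 0 < x < d by rewrite x0.
(* Only the half phi >= 0 of the center is used: it contains J points. *)
pose J := (Num.truncn ((t * M)%:R * y)).+1.
have tMy : 0 <= (t * M)%:R * y by rewrite mulr_ge0 // ltW.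
have JM : (J <= M')%N.
  rewrite /J -(ltr_nat R); apply: le_lt_trans (_ : (t * M)%:R * y < _).
    by rewrite truncn_le.
  rewrite tMn; move: yt; rewrite -[_^-1]mul1r ltr_pdivlMr ?mulr_gt0 // => yt.
  by move: yt M'0 T0; move: (M'%:R : R) => V; clear; nra.
have JL : (t * M)%:R * y <= J%:R by apply/ltW/truncnS_gt.
have low : M%:R * (- (E * (K * x ^+ 3))) + J%:R * (E * b) <=
    \sum_(0 <= i < M) a * complex.Re (column t m r n x (2 * pi * (i%:R / (t * M)%:R + s))).
  rewrite -{1}(addKn M' J); apply: sum_ge_window.
  - by rewrite leq_addr /= /M mul2n -addnn leq_add2l.
  - by move=> i iM; have [] := hcol n x _ x0d xn (phi_pi i iM).
  - move=> i /andP[iM' iJ].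
    have iM : (i < M)%N by apply: leq_trans iJ _; rewrite /M mul2n -addnn leq_add2l.
    have [_ h] := hcol n x _ x0d xn (phi_pi i iM).
    rewrite [leLHS](_ : _ = E * (b - K * x ^+ 3)); last by ring.
    apply: h; rewrite phiE -natrB //.
    have iJ' : (i - M')%:R <= (t * M)%:R * y.
      apply: le_trans (_ : (Num.truncn ((t * M)%:R * y))%:R <= _); last by rewrite truncn_le.
      by rewrite ler_nat leq_subLR -ltnS -addnS.
    rewrite ger0_norm; last by rewrite !mulr_ge0 ?invr_ge0 ?mulr_ge0 // ltW.
    rewrite [leLHS]mulrA ler_pdivrMr ?mulr_gt0 // -tMn.
    apply: le_trans (ler_wpM2l _ iJ') _; first by rewrite mulr_ge0 // ltW.
    rewrite le_eqVlt; apply/orP; left; apply/eqP; rewrite /y.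
    by move: p0; move: (@pi R) => P P0; field; rewrite !lt0r_neq0.
have tM0 : 0 < (t * M)%:R :> R by rewrite ltr0n muln_gt0 t0.
have main : E * x ^+ 3 <= a * complex.Re ((expR (n%:R * x))%:C * avg).
  have -> : a * complex.Re ((expR (n%:R * x))%:C * avg) = (t * M)%:R^-1 *
    \sum_(0 <= i < M) a * complex.Re (column t m r n x (2 * pi * (i%:R / (t * M)%:R + s))).
    rewrite avgE ReM [complex.Re _%:C]/= [complex.Im _%:C]/= mul0r subr0 Re_sum -mulr_sumr.
    by rewrite mulrCA.
  rewrite ler_pdivlMl //; apply: le_trans low.
  have h1 : M%:R * (E * (K * x ^+ 3)) <= (t * M)%:R * (E * (K * x ^+ 3)).
    rewrite ler_wpM2r ?ler_nat ?leq_pmull //.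
    by apply: mulr_ge0; [exact: ltW|apply: mulr_ge0; exact: ltW].
  have h2 : (t * M)%:R * y * (E * b) <= J%:R * (E * b).
    by rewrite ler_wpM2r // mulr_ge0 // ltW.
  have h3 : (K + 1) * x ^+ 3 <= y * b.
    move: xb; rewrite ltr_pdivlMr // => xb.
    have -> : y * b = x ^+ 2 * (b / (2 * pi * B)) by rewrite /y mulrAC mulrA.
    have -> : (K + 1) * x ^+ 3 = x ^+ 2 * (x * (K + 1)) by ring.
    by rewrite ler_pM2l // ltW.
  have h4 := ler_wpM2l (ltW (mulr_gt0 tM0 E0)) h3.
  move: h1 h2 h4; move: (x ^+ 3) ((t * M)%:R : R) (M%:R : R) (J%:R : R) => X T V W.
  by clear; lra.
have -> : (c n)%:~R = complex.Re ((c n)%:~R : R[i]).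
  by rewrite -(rmorph_int (real_complex R)).
have dist : nc ((c n)%:~R - (expR (n%:R * x))%:C * avg) <= E * x ^+ 3 / (2 * `|a|).
  have -> : (c n)%:~R - (expR (n%:R * x))%:C * avg =
     (expR (n%:R * x))%:C * ((c n)%:~R * (expR (- x))%:C ^+ n - avg).
    rewrite mulrBr; congr (_ - _); rewrite mulrCA -rmorphXn -rmorphM -expRM_natl -expRD.
    by rewrite mulrN subrr expR0 mulr1.
  rewrite ncM ncR ger0_norm ?expR_ge0 //; apply: le_trans (ler_wpM2l (expR_ge0 _) havg) _.
  by rewrite /e [leLHS]mulrA -expRD subrr expR0 mul1r.
have := le_trans (normRe_le _) dist; rewrite ReD ReN => h.
have h5 : `|a * (complex.Re (c n)%:~R - complex.Re ((expR (n%:R * x))%:C * avg))| <= E * x ^+ 3 / 2.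
  rewrite normrM; apply: le_trans (ler_wpM2l (ltW na0) h) _.
  by rewrite le_eqVlt; apply/orP; left; apply/eqP; field; rewrite lt0r_neq0.
have EX : 0 < E * x ^+ 3 by rewrite mulr_gt0.
move: h5 main EX; rewrite ler_norml mulrBr => /andP[+ _].
move: (a * _) (a * _) (E * x ^+ 3) => u v w; clear; lra.
Qed.

(** In the order of the complex numbers a positive or negative alpha is real, so
    its real part decides. *)
Lemma coef_signs_residue t m r (c : nat -> int) : (1 < t)%N -> (0 < m)%N ->
  is_coef_seq R t m c ->
  exists n0, forall n, (n0 <= n)%N -> n = r %[mod t] ->
    (0 < alpha R t m r -> 0 < c n) /\ (alpha R t m r < 0 -> c n < 0).
Proof.
move=> t1 m0 hc; have [/eqP im0|im] := boolP (complex.Im (alpha R t m r) == 0); last first.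
  by exists 0%N => n _ _; split; rewrite ltcE /= ?[0 == _]eq_sym (negbTE im).
have alE : alpha R t m r = (complex.Re (alpha R t m r))%:C by exact: eqC.
have [re0|re0] := eqVneq (complex.Re (alpha R t m r)) 0.
  by exists 0%N => n _ _; rewrite alE re0 !ltxx.
have [n0 hn] := coef_sign t1 m0 hc alE re0; exists n0 => n nn0 nr.
have H := hn n nn0 nr; rewrite !ltcE /=; split => /andP[_ h].
  by move: H; rewrite pmulr_rgt0 // ltr0z.
by move: H; rewrite nmulr_rgt0 // ltrz0.
Qed.

End Signs.

Unset Implicit Arguments.

Theorem theorem1p3 (R : realType) (t m : nat) (c : nat -> int)
  (ht : (1 < t)%N) (hm : (0 < m)%N) (hmt : (m * (t - 1) <= 24)%N)
  (hc : is_coef_seq R t m c) :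
  exists n0 : nat, (0 < n0)%N /\
    forall n : nat, (n0 <= n)%N ->
      (forall r : nat, r \in Pset R t m -> 0 < c (t * n + r)%N) /\
      (forall r : nat, r \in Nset R t m -> c (t * n + r)%N < 0).
Proof.
have hb b : exists n0, forall r n, (r < b)%N -> (n0 <= n)%N ->
    (0 < alpha R t m r -> 0 < c (t * n + r)%N) /\
    (alpha R t m r < 0 -> c (t * n + r)%N < 0).
  elim: b => [|b [n0 IH]]; first by exists 0%N.
  have [n1 h1] := coef_signs_residue b ht hm hc.
  exists (maxn n0 n1) => r n; rewrite ltnS geq_max leq_eqVlt.
  move=> /orP[/eqP -> /andP[_ n1n]|rb /andP[n0n _]]; last exact: IH.
  apply: h1; last by rewrite mulnC modnMDl.
  by apply: leq_trans n1n _; rewrite (leq_trans (leq_pmull n (ltnW ht))) ?leq_addr.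
have [n0 h] := hb t; exists n0.+1; split => // n /ltnW nn0.
split=> r; rewrite inE => -[rt al]; first exact: (h r n rt nn0).1.
exact: (h r n rt nn0).2.
Qed.
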